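(* Let $g:\mathbb{R}\times\mathcal{P}_2(\mathbb{R})\to\mathbb{R}$ satisfy assumptions (A1)–(A6) listed in the context. Let $X^0$ be the forward component of the $0$-MFG mean-field FBSDE, $m^0_t=\mathcal L(X^0_t)$, and let $(U_t,V_t,Q_t,\tilde Q_t)_{0\le t\le T}$ be the solution of the linear variational FBSDE $$dU_t=-V_t\,dt+d\tilde W_t,\qquad dV_t=Q_t\,dW_t+\tilde Q_t\,d\tilde W_t,$$ $$U_0=0,\qquad V_T=\partial^2_{xx}g(X^0_T,m^0_T)\,U_T+\hat{\mathbb{E}}^0\big[\partial^2_{xm}g(X^0_T,m^0_T)(\hat X^0_T)\,\hat U_T\big].$$ Then, for $\mathbb P^0$-almost every $\omega^0\in\Omega^0$, $(U_t(\omega^0,\cdot),V_t(\omega^0,\cdot))_{0\le t\le T}$ is a pair of Gaussian processes with mean zero on $(\tilde\Omega,\{\tilde{\mathcal F}_t\}_{0\le t\le T},\tilde{\mathbb P})$.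
   Context: Setup. Fix $T>0$ and a constant $\sigma$. $W$ and $\tilde W$ are independent real Brownian motions (individual noise and common noise) on a complete filtered probability space $(\Omega,\mathcal F,(\mathcal F_t)_{0\le t\le T},\mathbb P)$ of the product form $(\Omega^0\times\tilde\Omega,\mathcal F^0\otimes\tilde{\mathcal F},\mathbb P^0\otimes\tilde{\mathbb P})$, where $(\tilde\Omega,\tilde{\mathcal F},\tilde{\mathbb P})$ is the canonical space of $\tilde W$, and all other randomness ($W$ and the initial state) is carried by $(\Omega^0,\mathcal F^0,\mathbb P^0)$. $\tilde{\mathcal F}_t=\sigma(\tilde W_s;0\le s\le t)$. $\mathcal L(\xi)$ denotes the law of $\xi$ and $\mathcal L(\xi|\mathcal G)$ its conditional law. $\mathscr L^2_{\mathcal G}$ is the set of $\mathcal G$-measurable real square-integrable random variables, with norm $\|\cdot\|_2$. $\xi_0\in\mathscr L^2_{\mathcal F_0}$ is the given initial state. $\mathcal P_2(\mathbb R)$ is the space of Borel probability measures on $\mathbb R$ with finite second moment, with the 2-Wasserstein metric $\mathcal W_2$. $0$-MFG FBSDE. $(X^0,Y^0,Z^0,\tilde Z^0)$ is the unique solution of $dX_t=-Y_t\,dt+\sigma\,dW_t$, $dY_t=Z_t\,dW_t+\tilde Z_t\,d\tilde W_t$, $X_0=\xi_0$, $Y_T=\partial_xg(X_T,\mathcal L(X_T|\tilde{\mathcal F}_T))$; $X^0$ does not depend on $\tilde\omega\in\tilde\Omega$, so $\mathcal L(X^0_t|\tilde{\mathcal F}_t)=\mathcal L(X^0_t)$. Under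 (A1)–(A5) the linear variational FBSDE has a unique adapted square-integrable solution. For a random variable $\xi$ on $\Omega=\Omega^0\times\tilde\Omega$ and $\omega^0\in\Omega^0$, $\xi(\omega^0,\cdot)$ is the random variable $\tilde\omega\mapsto\xi(\omega^0,\tilde\omega)$ on $\tilde\Omega$. Derivative in the measure argument. For $F:\mathcal P_2(\mathbb R)\to\mathbb R$, the lift is $\tilde F(X)=F(\mathcal L(X))$ on $L^2(\hat\Omega)$, with $\hat\Omega$ an atomless Polish probability space. $F$ is differentiable at $m_0$ if $\tilde F$ is Fréchet differentiable at some $X_0$ with $\mathcal L(X_0)=m_0$; the derivative $\partial_mF(m_0)$ is the ($m_0$-a.e. unique) measurable function $\mathbb R\to\mathbb R$ in $L^2_{m_0}$ such that $F(\mathcal L(X_0+Y))-F(\mathcal L(X_0))-\hat{\mathbb E}[\partial_mF(m_0)(X_0)Y]=o(\|Y\|_2)$ as $Y\to0$ for every $X_0$ with law $m_0$. $\partial^2_{xm}g(x,m)(z)=\partial^2_{mx}g(x,m)(z)$ is the derivative in this sense of $m\mapsto\partial_xg(x,m)$, evaluated at $z$. Hat notation. $(\hat\Omega^0,\hat{\mathcal F}^0,\hat{\mathbb P}^0)$ is a copy of $(\Omega^0,\mathcal F^0,\mathbb P^0)$; for a random variable $\xi$ on $\Omega^0\times\tilde\Omega$, $\hat\xi$ is its copy on $\hat\Omega^0\times\tilde\Omega$ (same common noise), and $\hat{\mathbb E}^0$ is expectation over $\hat\omega^0\in\hat\Omega^0$ only. Thus $\hat{\mathbb{E}}^0[\partial^2_{xm}g(X^0_T,m^0_T)(\hat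 X^0_T)\hat U_T](\omega^0,\tilde\omega)=\int_{\Omega^0}\partial^2_{xm}g(X^0_T(\omega^0),m^0_T)(X^0_T(\hat\omega^0))\,U_T(\hat\omega^0,\tilde\omega)\,d\mathbb P^0(\hat\omega^0)$. Assumptions on $g$ (for some constant $K$). (A1) $\partial_xg$ exists and $|\partial_xg(x,m)-\partial_xg(x',m)|\le K|x-x'|$ for all $x,x'\in\mathbb R$, $m\in\mathcal P_2(\mathbb R)$. (A2) $(\partial_xg(x,m)-\partial_xg(x',m))(x-x')\ge0$ for all $x,x',m$. (A3) $|\partial_xg(x,m)-\partial_xg(x,m')|\le K\mathcal W_2(m,m')$ for all $x,m,m'$. (A4) (weak monotonicity) $\int_{\mathbb R^2}(\partial_xg(x,m)-\partial_xg(y,m'))(x-y)\,\gamma(dx,dy)\ge0$ for all $m,m'\in\mathcal P_2(\mathbb R)$ and all $\gamma\in\mathcal P_2(\mathbb R^2)$ with marginals $m,m'$. (A5) $\partial_xg$ is differentiable in $(x,m)$ with bounded and Lipschitz continuous derivatives, the bound and the Lipschitz constant being the same $K$; specifically, for the mixed derivative, for all $x$, $m,m'$ and $\xi,\xi'\in\mathscr L^2_{\mathcal F}$ with laws $m,m'$: $\mathbb E[\partial^2_{mx}g(x,m)(\xi)^2]^{1/2}\le K$ and $\mathbb E[(\partial^2_{mx}g(x,m)(\xi)-\partial^2_{mx}g(x,m')(\xi'))^2]^{1/2}\le K\|\xi-\xi'\|_2$. (A6) For all $m\in\mathcal P_2(\mathbb R)$ the map $(x,z)\mapsto\partial^2_{mx}g(x,m)(z)$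 is continuously differentiable, and for all $x,x'\in\mathbb R$, $m,m'\in\mathcal P_2(\mathbb R)$ and $\xi,\xi'\in\mathscr L^2_{\mathcal F}$ with laws $m,m'$: $\mathbb E[(\partial_z\partial^2_{xm}g(x,m)(\xi)-\partial_z\partial^2_{xm}g(x',m')(\xi'))^2]^{1/2}\le K(|x-x'|+\|\xi-\xi'\|_2)$. *)

(* Defs.v *)
From HB Require Import structures.
From mathcomp Require Import all_boot all_order all_algebra.
From mathcomp Require Import all_classical all_reals all_analysis.
Set Implicit Arguments.
Unset Strict Implicit.
Unset Printing Implicit Defensive.
Import Order.TTheory GRing.Theory Num.Theory.
Import numFieldNormedType.Exports.
Local Open Scope classical_set_scope.
Local Open Scope ring_scope.

(** * Laws, Wasserstein distance *)

Record P2 (R : realType) := MkP2 {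
  P2_prob :> probability R R ;
  P2_moment2 : (\int[P2_prob]_x (x ^+ 2)%:E < +oo)%E }.

Section laws.
Context {R : realType} {d} {T : measurableType d} (P : probability T R).

Definition has_law (X : T -> R) (m : P2 R) : Prop :=
  forall A : set R, measurable A -> P (X @^-1` A) = m A.

Definition norm2 (X : T -> R) : \bar R := 'N[P]_2%:E[EFin \o X].

Definition L2 (X : T -> R) : Prop :=
  measurable_fun setT X /\ (norm2 X < +oo)%E.

End laws.

Section wasserstein.
Context {R : realType}.
Implicit Types m : P2 R.

(* A coupling of two elements of P2 R automatically has finite second moment. *)
Definition coupling m m' (gam : probability (R * R)%type R) : Prop :=
  (forall A : set R, measurable A -> gam (fst @^-1` A) = m A) /\
  (forall A : set R, measurable A -> gam (snd @^-1` A) = m' A).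

Definition W2 m m' : R :=
  Num.sqrt (fine (ereal_inf
    [set (\int[gam]_z ((z.1 - z.2) ^+ 2)%:E)%E | gam in coupling m m'])).

End wasserstein.

(** * Differentiation with respect to the measure *)

Definition separable (T : topologicalType) : Prop :=
  exists2 D : set T, countable D & dense D.

Definition polish {R : realType} (T : pseudoPMetricType R) : Prop :=
  [/\ hausdorff_space T, separable T &
      forall G : set_system T, ProperFilter G -> cauchy G -> cvg G].

Definition borel {R : realType} (T : pseudoPMetricType R) :=
  g_sigma_algebraType (@open T).

Definition atomless {R : realType} {d} {T : measurableType d}
    (P : probability T R) : Prop :=
  forall A : set T, measurable A -> (0 < P A)%E ->
    exists B : set T, [/\ measurable B, B `<=` A & (0 < P B < P A)%E].

Section measure_derivative.
Context {R : realType} {d} {T : measurableType d} (P : probability T R).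

Definition bounded_linear_L2 (l : (T -> R) -> R) : Prop :=
  (forall (a : R) (Y Z : T -> R), L2 P Y -> L2 P Z ->
     l (fun w => a * Y w + Z w) = a * l Y + l Z) /\
  (exists C : R, forall Y : T -> R, L2 P Y ->
     (`|l Y|%:E <= C%:E * norm2 P Y)%E).

(* First-order expansion, with linear part [l], at [X0] (of law [m0]) of the
   lift X |-> F (law of X). *)
Definition lift_expansion (F : P2 R -> R) (m0 : P2 R) (X0 : T -> R)
    (l : (T -> R) -> R) : Prop :=
  forall eps : R, 0 < eps -> exists2 del : R, 0 < del &
    forall (Y : T -> R) (m : P2 R), L2 P Y -> (norm2 P Y <= del%:E)%E ->
      has_law P (fun w => X0 w + Y w) m ->
      (`|F m - F m0 - l Y|%:E <= eps%:E * norm2 P Y)%E.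

Definition is_measure_derivative (F : P2 R -> R) (m0 : P2 R) (h : R -> R) :
    Prop :=
  [/\ exists (X0 : T -> R) (l : (T -> R) -> R),
        [/\ L2 P X0, has_law P X0 m0, bounded_linear_L2 l &
            lift_expansion F m0 X0 l],
      L2 m0 h &
      forall X0 : T -> R, L2 P X0 -> has_law P X0 m0 ->
        lift_expansion F m0 X0 (fun Y => \int[P]_w (h (X0 w) * Y w))].

End measure_derivative.

(** * Assumptions on the cost function *)

Definition C1 {R : realType} (f : R * R -> R) : Prop :=
  (forall p, differentiable f p) /\
  (forall v, continuous (fun p => 'd f p v)).

Section assumptions.
Context {R : realType} (g : R -> P2 R -> R).

Definition dx (x : R) (m : P2 R) : R := derive1 (fun y => g y m) x.
Definition dxx (x : R) (m : P2 R) : R := derive1 (fun y => dx y m) x.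

Definition lipschitz_dx (K : R) : Prop :=
  (forall x m, derivable (fun y => g y m) x 1) /\
  (forall x x' m, `|dx x m - dx x' m| <= K * `|x - x'|).

Definition monotone_dx : Prop :=
  forall x x' m, 0 <= (dx x m - dx x' m) * (x - x').

Definition lipschitz_dx_law (K : R) : Prop :=
  forall x m m', `|dx x m - dx x m'| <= K * W2 m m'.

Definition weakly_monotone_dx : Prop :=
  forall (m m' : P2 R) gam, coupling m m' gam ->
    (0 <= \int[gam]_z ((dx z.1 m - dx z.2 m') * (z.1 - z.2))%:E)%E.

(* [D x m z] is a version of the mixed second derivative at (x, m), evaluated
   at z; [Ph] is the atomless space carrying the lift and [P] the space on
   which xi and xi' live.  Joint differentiability of [dx] in (x, m) follows
   from the two partial derivatives and the joint continuity of [dxx]. *)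
Context {dh} {Th : measurableType dh} (Ph : probability Th R).
Context {d} {T : measurableType d} (P : probability T R).
Variable D : R -> P2 R -> R -> R.

Definition smooth_dx (K : R) : Prop :=
  [/\ forall x m, derivable (fun y => dx y m) x 1,
      forall x m, is_measure_derivative Ph (dx x) m (D x m),
      (forall x m, `|dxx x m| <= K) /\
      (forall x x' m m',
         `|dxx x m - dxx x' m'| <= K * (`|x - x'| + W2 m m')),
      forall x m (xi : T -> R), L2 P xi -> has_law P xi m ->
        (norm2 P (fun w => D x m (xi w)) <= K%:E)%E &
      forall x m m' (xi xi' : T -> R), L2 P xi -> L2 P xi' ->
        has_law P xi m -> has_law P xi' m' ->
        (norm2 P (fun w => (D x m (xi w) - D x m' (xi' w))%R)
         <= K%:E * norm2 P (fun w => (xi w - xi' w)%R))%E].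

Definition dzD (x : R) (m : P2 R) (z : R) : R := derive1 (D x m) z.

Definition smooth_mixed (K : R) : Prop :=
  (forall m, C1 (fun p : R * R => D p.1 m p.2)) /\
  (forall x x' m m' (xi xi' : T -> R), L2 P xi -> L2 P xi' ->
     has_law P xi m -> has_law P xi' m' ->
     (norm2 P (fun w => (dzD x m (xi w) - dzD x' m' (xi' w))%R)
      <= K%:E * (`|x - x'|%:E + norm2 P (fun w => (xi w - xi' w)%R)))%E).

End assumptions.

(** * The canonical space C([0,T], R) of the common noise *)

Definition path_space {R : realType} (T : R) :=
  continuousType (set_type `[0, T]%classic) R.

HB.instance Definition _ {R : realType} (T : R) := Choice.on (path_space T).
HB.instance Definition _ {R : realType} (T : R) :=
  isPointed.Build (path_space T)
    (mkcts (@cst_continuous (set_type `[0, T]%classic) R 0)).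

(* The coordinate process; its value for t outside [0, T] is irrelevant. *)
Definition path_coord {R : realType} {T : R} (t : R) (w : path_space T) : R :=
  if insub t is Some s then (w : set_type `[0, T]%classic -> R) s else 0.

Definition path_sets {R : realType} {T : R} (t : R) :
    set (set (path_space T)) :=
  [set A | exists2 s, 0 <= s <= t &
     exists2 B : set R, measurable B & A = path_coord s @^-1` B].

Definition path_filtration {R : realType} {T : R} (t : R) :
    set (set (path_space T)) := <<s path_sets t >>.

Definition canonical_space {R : realType} (T : R) :=
  g_sigma_algebraType (@path_sets R T T).

(** * Filtrations, Brownian motions, Ito integrals *)

Definition measurable_wrt {R : realType} {T : Type} (G : set (set T))
    (X : T -> R) : Prop :=
  forall B : set R, measurable B -> G (X @^-1` B).

Section stochastic_calculus.
Context {R : realType} {d} {Om : measurableType d} (P : probability Om R).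
Variables (T : R) (F : R -> set (set Om)).
Implicit Types X Y Q W : R -> Om -> R.

(* Completeness: F_t contains the null sets of the ambient sigma-algebra.  The
   product sigma-algebra itself is not required to be complete, since a product
   of diffuse spaces essentially never is. *)
Definition complete_filtration : Prop :=
  [/\ forall t, 0 <= t <= T -> sigma_algebra setT (F t),
      forall t, 0 <= t <= T -> F t `<=` measurable,
      forall s t, 0 <= s -> s <= t -> t <= T -> F s `<=` F t &
      forall t N, 0 <= t <= T -> measurable N -> P N = 0%E -> F t N].

Definition adapted X : Prop :=
  forall t, 0 <= t <= T -> measurable_wrt (F t) (X t).

Definition continuous_paths X : Prop :=
  {ae P, forall w, {within `[0, T], continuous (fun t => X t w)}}.

(* (W, W') is a two-dimensional Brownian motion relative to F. *)
Definition independent_brownian_motions W W' : Prop :=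
  [/\ adapted W /\ adapted W',
      continuous_paths W /\ continuous_paths W',
      {ae P, forall w, W 0 w = 0 /\ W' 0 w = 0} &
      forall s t, 0 <= s -> s < t -> t <= T ->
      forall (E : set Om) (A A' : set R),
        F s E -> measurable A -> measurable A' ->
        P (E `&` [set w | A (W t w - W s w)]
             `&` [set w | A' (W' t w - W' s w)]) =
        (P E * normal_prob 0 (Num.sqrt (t - s)) A
             * normal_prob 0 (Num.sqrt (t - s)) A')%E].

Definition dist_dtdP Q Q' : \bar R :=
  (\int[P]_w \int[lebesgue_measure]_(s in `[0%R, T])
     ((Q s w - Q' s w) ^+ 2)%:E)%E.

Definition square_integrable_process Q : Prop :=
  [/\ adapted Q,
      measurable_fun (`[0, T] `*` [set: Om]) (fun p : R * Om => Q p.1 p.2) &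
      (dist_dtdP Q (fun _ _ => 0%R) < +oo)%E].

(* The integrand sum_(i < n) h_i 1_(]t_i, t_(i+1)]). *)
Record simple_integrand := SimpleIntegrand {
  si_n : nat ;
  si_t : nat -> R ;
  si_h : nat -> Om -> R ;
  si_ge0 : 0 <= si_t 0%N ;
  si_leT : si_t si_n <= T ;
  si_mono : forall i, (i < si_n)%N -> si_t i <= si_t i.+1 ;
  si_meas : forall i, (i < si_n)%N -> measurable_wrt (F (si_t i)) (si_h i) ;
  si_bounded : forall i, (i < si_n)%N -> exists C, forall w, `|si_h i w| <= C }.

Definition si_process (H : simple_integrand) (s : R) (w : Om) : R :=
  \sum_(i < si_n H) si_h H i w * \1_(`]si_t H i, si_t H i.+1]%classic) s.

Definition si_integral (H : simple_integrand) W (t : R) (w : Om) : R :=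
  \sum_(i < si_n H)
    si_h H i w * (W (Num.min (si_t H i.+1) t) w - W (Num.min (si_t H i) t) w).

(* [J] is (a version of) the Ito integral process of [Q] against [W]: the L2
   limit of the integrals of simple integrands approximating [Q]. *)
Definition is_ito_integral Q W J : Prop :=
  adapted J /\
  exists H : nat -> simple_integrand,
    (dist_dtdP (si_process (H k)) Q @[k --> \oo] --> 0%E) /\
    (forall t, 0 <= t <= T ->
       norm2 P (fun w => si_integral (H k) W t w - J t w) @[k --> \oo] --> 0%E).

(* (X, Y, Z, Z') is an adapted square-integrable solution of
     dX_t = - Y_t dt + dN_t,  dY_t = Z_t dW_t + Z'_t dW'_t,
     X_0 = x0 + N_0,  Y_T = G. *)
Definition fbsde_solution W W' (x0 : Om -> R) (N : R -> Om -> R) (G : Om -> R)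
    (X Y Z Z' : R -> Om -> R) : Prop :=
  [/\ [/\ square_integrable_process X, square_integrable_process Y,
          square_integrable_process Z & square_integrable_process Z'],
      continuous_paths X /\ continuous_paths Y,
      forall t, 0 <= t <= T -> {ae P, forall w,
        X t w = x0 w - \int[lebesgue_measure]_(s in `[0%R, t]) Y s w + N t w},
      exists J J' : R -> Om -> R,
        [/\ is_ito_integral Z W J, is_ito_integral Z' W' J' &
            forall t, 0 <= t <= T -> {ae P, forall w,
              Y t w = Y 0 w + J t w + J' t w}] &
      {ae P, forall w, Y T w = G w}].

(* [mu] is a regular version of the conditional law of [X] given [G]. *)
Definition is_conditional_law (G : set (set Om)) (X : Om -> R)
    (mu : Om -> P2 R) : Prop :=
  (forall B : set R, measurable B -> measurable_wrt G (fun w => fine (mu w B))) /\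
  (forall (A : set Om) (B : set R), G A -> measurable B ->
     P (A `&` X @^-1` B) = (\int[P]_(w in A) mu w B)%E).

End stochastic_calculus.

(** * Gaussian processes *)

Section gaussian.
Context {R : realType} {d} {Om : measurableType d} (P : probability Om R).

(* The degenerate case is separate because [normal_prob 0 0] is not the Dirac
   mass at 0. *)
Definition centered_gaussian (X : Om -> R) : Prop :=
  measurable_fun setT X /\
  (P [set w | X w = 0] = 1%E \/
   exists2 s : R, 0 < s & forall A : set R, measurable A ->
     P (X @^-1` A) = normal_prob 0 s A).

(* U and V are jointly Gaussian, hence each of them is Gaussian. *)
Definition centered_gaussian_pair (T : R) (U V : R -> Om -> R) : Prop :=
  forall (n : nat) (t a b : 'I_n -> R), (forall i, 0 <= t i <= T) ->
    centered_gaussian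
      (fun w => \sum_(i < n) (a i * U (t i) w + b i * V (t i) w)).

(* Adaptedness to the completion of G. *)
Definition adapted_ae (T : R) (G : R -> set (set Om)) (U : R -> Om -> R) :
    Prop :=
  forall t, 0 <= t <= T -> exists2 U' : Om -> R,
    measurable_wrt (G t) U' & {ae P, forall w, U t w = U' w}.

End gaussian.

(** * The two forward-backward systems *)

Section systems.
Context {R : realType} (T : R) {d0} {Om0 : measurableType d0}.
Variables (P0 : probability Om0 R) (Pt : probability (canonical_space T) R).
Let Om := (Om0 * canonical_space T)%type.
Let P : probability Om R := (P0 \x Pt)%E.
Variables (F : R -> set (set Om)) (W : R -> Om0 -> R).

Definition idiosyncratic_noise : R -> Om -> R := fun t w => W t w.1.
Definition common_noise : R -> Om -> R := fun t w => path_coord t w.2.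
Definition common_filtration (t : R) : set (set Om) :=
  [set snd @^-1` A | A in path_filtration t].

Variables (g : R -> P2 R -> R) (D : R -> P2 R -> R -> R).

Definition zero_mfg_solution (sigma : R) (xi0 : Om0 -> R)
    (X Y Z Z' : R -> Om -> R) : Prop :=
  exists2 mu : Om -> P2 R,
    is_conditional_law P (common_filtration T) (X T) mu &
    fbsde_solution P T F idiosyncratic_noise common_noise
      (fun w => xi0 w.1) (fun t w => sigma * W t w.1)
      (fun w => dx g (X T w) (mu w)) X Y Z Z'.

(* The copy of a random variable on (a copy of Om0) * canonical_space T keeps
   the second coordinate, so the partial expectation is an integral over Om0
   alone. *)
Definition variational_solution (X0 : R -> Om0 -> R) (m0T : P2 R)
    (U V Q Q' : R -> Om -> R) : Prop :=
  fbsde_solution P T F idiosyncratic_noise common_noise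
    (fun=> 0) common_noise
    (fun w => dxx g (X0 T w.1) m0T * U T w
       + \int[P0]_v (D (X0 T w.1) m0T (X0 T v) * U T (v, w.2)))
    U V Q Q'.

End systems.

Arguments idiosyncratic_noise {R} T {d0 Om0} W t w.
Arguments common_noise {R} T {d0 Om0} t w.

(* Main.v *)
(* Call idiosyncratic the information carried by xi0 and W, and conditionally
   linear the variables sum_j c_j (Wt_{s_(j+1)} - Wt_{s_j}) with idiosyncratic
   coefficients c_j.  For fixed omega^0 the latter are linear combinations of
   increments of the common noise, hence centered Gaussian, so it suffices to show
   that U_t and V_t are limits of conditionally linear variables.

   First, X^0_T is idiosyncratic: replacing it by its conditional expectation does
   not increase the cost, because dx g(., m^0_T) is monotone.  The terminal operator
   f |-> dxx g f + E^[dxm g f^] is then positive, by a second-order expansion of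
   weak monotonicity, and preserves conditional linearity.  Hence the component of
   (U, V) orthogonal to the conditionally linear variables solves the same linear
   system without noise, and a monotone system without noise vanishes.  Since the
   orthogonal projection depends on the grid, the argument is run on the grid
   kT/N with an error bound of order N^(-1/2) at times t < T; the time T and the
   irrational times follow by continuity of paths, and U is recovered from V by
   Riemann sums. *)

(* [F] may be larger than the filtration of the noises, so no martingale representation is
   available. Its substitute is immersion: seen from [F t], the future of [W] depends on [W t]
   alone, and later common increments stay centered against cylinders of [W]. Hence projecting an
   [F t]-measurable variable onto the conditionally linear ones gives an [F t]-measurable one, and
   the defect of [V] along the grid is a martingale.

   The rate comes from comparing a grid sum with a time integral. On each cell the increment of [V]
   is paired with the terminal defect by Young's inequality with weight lambda: the squared
   increments telescope to at most lambda E[V_T^2], the other terms add up to at most N E[V_T^2] /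
   lambda. The choice lambda = sqrt N balances them, while the defect at t_k is counted N - k times.

   Refining the grid makes the defects at a fixed time summable in mean square, so the
   approximations converge almost surely, and Fubini transfers this to almost every omega^0. There
   they are centered Gaussian, a class closed under almost sure limits. *)
Require Import Defs.
From HB Require Import structures.
From mathcomp Require Import all_boot all_order all_algebra.
From mathcomp Require Import all_classical all_reals all_analysis.
From mathcomp Require Import measurable_realfun.
From mathcomp Require Import ring lra.
Set Implicit Arguments.
Unset Strict Implicit.
Unset Printing Implicit Defensive.
Import Order.TTheory GRing.Theory Num.Theory.
Import numFieldNormedType.Exports.
Local Open Scope classical_set_scope.
Local Open Scope ring_scope.

(** * Integrable and square-integrable random variables *)

Section expectation.
Context {R : realType} {d} {T : measurableType d} (P : probability T R).
Implicit Types f g h : T -> R.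

Definition L1 f := P.-integrable setT (EFin \o f).

Lemma L1_meas f : L1 f -> measurable_fun setT f.
Proof. by move=> /measurable_int/measurable_EFinP. Qed.

Lemma L1D f g : L1 f -> L1 g -> L1 (fun w => f w + g w).
Proof.
by move=> hf hg; apply: eq_integrable (integrableD measurableT hf hg) => // w _.
Qed.

Lemma L1Z a f : L1 f -> L1 (fun w => a * f w).
Proof.
move=> hf; have := @integrableZl _ _ _ P _ measurableT a _ hf.
by apply: eq_integrable => // w _; rewrite /= EFinM.
Qed.

Lemma L1N f : L1 f -> L1 (fun w => - f w).
Proof. by move=> /(L1Z (-1)); under eq_fun do rewrite mulN1r. Qed.

Lemma L1B f g : L1 f -> L1 g -> L1 (fun w => f w - g w).
Proof. by move=> hf hg; apply: L1D => //; exact: L1N. Qed.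

Lemma L1_cst a : L1 (fun=> a).
Proof. exact: finite_measure_integrable_cst. Qed.

Lemma L1_sum (I : Type) (r : seq I) (F : I -> T -> R) :
  (forall i, L1 (F i)) -> L1 (fun w => \sum_(i <- r) F i w).
Proof.
move=> h; elim: r => [|i r IH].
  by under eq_fun do rewrite big_nil; exact: L1_cst.
by under eq_fun do rewrite big_cons; exact: L1D.
Qed.

Lemma L1_le f g : measurable_fun setT f -> L1 g ->
  (forall w, `|f w| <= `|g w|) -> L1 f.
Proof.
move=> mf hg fg; apply: (le_integrable measurableT _ _ hg).
  exact/measurable_EFinP.
by move=> w _; rewrite /= lee_fin.
Qed.

Lemma L1_bounded f C : measurable_fun setT f -> (forall w, `|f w| <= C) -> L1 f.
Proof.
move=> mf fC; apply: (L1_le mf (L1_cst C)) => w.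
by rewrite (le_trans (fC w))// ler_norm.
Qed.

Lemma L1_mul_bounded f g C : measurable_fun setT f -> (forall w, `|f w| <= C) ->
  L1 g -> L1 (fun w => f w * g w).
Proof.
move=> mf fC hg; apply: (@L1_le _ (fun w => C * g w)).
- by apply: measurable_funM => //; exact: L1_meas.
- exact: L1Z.
- by move=> w; rewrite !normrM ler_wpM2r// (le_trans (fC w))// ler_norm.
Qed.

Lemma L1_indic (A : set T) : measurable A -> L1 (\1_A).
Proof.
move=> mA; apply: (@L1_bounded _ 1); first exact: measurable_indic.
by move=> w; rewrite indicE; case: (_ \in _) => /=; rewrite ?normr0 ?normr1.
Qed.

Lemma exD f g : L1 f -> L1 g ->
  \int[P]_w (f w + g w) = \int[P]_w f w + \int[P]_w g w.
Proof. exact: RintegralD. Qed.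

Lemma exZ a f : L1 f -> \int[P]_w (a * f w) = a * \int[P]_w f w.
Proof. exact: RintegralZl. Qed.

Lemma exN f : L1 f -> \int[P]_w (- f w) = - \int[P]_w f w.
Proof.
by move=> hf; rewrite -mulN1r -exZ//; apply: eq_Rintegral => w _; rewrite mulN1r.
Qed.

Lemma exB f g : L1 f -> L1 g ->
  \int[P]_w (f w - g w) = \int[P]_w f w - \int[P]_w g w.
Proof. by move=> hf hg; rewrite RintegralB. Qed.

Lemma ex_cst a : \int[P]_w a = a.
Proof. rewrite Rintegral_cst// (_ : fine _ = 1) ?mulr1//.
exact: (congr1 fine (probability_setT P)). Qed.

Lemma ex_sum (I : Type) (r : seq I) (F : I -> T -> R) :
  (forall i, L1 (F i)) ->
  \int[P]_w (\sum_(i <- r) F i w) = \sum_(i <- r) \int[P]_w F i w.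
Proof.
move=> h; elim: r => [|i r IH].
  by rewrite big_nil; under eq_Rintegral do rewrite big_nil; rewrite ex_cst.
under eq_Rintegral do rewrite big_cons.
by rewrite exD ?IH ?big_cons//; exact: L1_sum.
Qed.

Lemma ex_ge0 f : (forall w, 0 <= f w) -> 0 <= \int[P]_w f w.
Proof. by move=> h; apply: Rintegral_ge0. Qed.

Lemma ex_le f g : L1 f -> L1 g -> (forall w, f w <= g w) ->
  \int[P]_w f w <= \int[P]_w g w.
Proof. by move=> hf hg h; apply: le_Rintegral. Qed.

Lemma ex_indic (A : set T) : measurable A -> \int[P]_w \1_A w = fine (P A).
Proof. by move=> mA; rewrite /Rintegral integral_indic// setIT. Qed.

Lemma EFin_ex f : L1 f -> (\int[P]_w f w)%:E = (\int[P]_w (f w)%:E)%E.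
Proof. by move=> hf; rewrite /Rintegral fineK//; exact: integrable_fin_num. Qed.

Lemma L1_ae f g : measurable_fun setT g -> {ae P, forall w, f w = g w} ->
  L1 f -> L1 g.
Proof.
move=> mg fg hf; apply/integrableP; split; first exact/measurable_EFinP.
have /integrableP[mf] := hf.
rewrite (@ae_eq_integral _ _ _ P setT (fun x => `|(EFin \o g) x|)%E)//.
- exact: measurableT_comp.
- by apply: measurableT_comp => //; exact/measurable_EFinP.
- by apply: filterS fg => w /= -> _.
Qed.

Lemma ex_ae f g : measurable_fun setT f -> measurable_fun setT g ->
  {ae P, forall w, f w = g w} -> \int[P]_w f w = \int[P]_w g w.
Proof.
move=> mf mg fg; rewrite /Rintegral; congr fine.
apply: ae_eq_integral => //; [exact/measurable_EFinP|exact/measurable_EFinP|].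
by apply: filterS fg => w /= -> _.
Qed.

Lemma ex_eq0 f : L1 f -> (forall w, 0 <= f w) -> \int[P]_w f w = 0 ->
  {ae P, forall w, f w = 0}.
Proof.
move=> hf f0 e0.
have /(ae_eq_integral_abs P measurableT) : measurable_fun setT (EFin \o f).
  by apply/measurable_EFinP; exact: L1_meas.
case=> + _; case.
  transitivity (\int[P]_w (f w)%:E)%E.
    by apply: eq_integral => w _; rewrite /= ger0_norm.
  by rewrite -EFin_ex// e0.
move=> N hN; exists N; split; [by case: hN|by case: hN|].
case: hN => mN PN sub w /= h; apply: sub => /= /(_ I) [] h'; exact: h.
Qed.

Lemma ae_contradiction : {ae P, forall w : T, False} -> False.
Proof.
move=> [N [mN N0 sub]].
have NT : N = setT by apply/seteqP; split => // x _; apply: sub.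
have := probability_setT P; rewrite -NT => h.
have : (1%E : \bar R) = 0%E := etrans (esym h) N0.
by move=> [] /eqP; rewrite oner_eq0.
Qed.

Lemma L2_Lfun f : L2 P f <-> f \in Lfun P 2%:E.
Proof.
split=> [[mf nf]|].
  by rewrite inE; apply/andP; split; rewrite inE.
by rewrite inE => /andP[]; rewrite !inE.
Qed.

Lemma L2_meas f : L2 P f -> measurable_fun setT f. Proof. by case. Qed.

Lemma L2_mul f g : L2 P f -> L2 P g -> L1 (fun w => f w * g w).
Proof.
move=> /L2_Lfun hf /L2_Lfun hg; apply/Lfun1_integrable.
exact: Lfun2_mul_Lfun1.
Qed.

Lemma L2_sq f : L2 P f -> L1 (fun w => f w ^+ 2).
Proof. by move=> hf; under eq_fun do rewrite expr2; exact: L2_mul. Qed.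

Lemma norm2E f : norm2 P f = ((\int[P]_w (f w ^+ 2)%:E) `^ 2^-1)%E.
Proof.
rewrite /norm2 unlock /Lnorm; congr (poweR _ _).
apply: eq_integral => w _ /=.
by rewrite powR_mulrn// -normrX ger0_norm// sqr_ge0.
Qed.

Lemma L2P f : L2 P f <-> measurable_fun setT f /\ L1 (fun w => f w ^+ 2).
Proof.
split=> [hf|[mf hf]]; first by split; [exact: L2_meas|exact: L2_sq].
split => //; rewrite norm2E poweR_lty//.
by rewrite -EFin_ex// ltry.
Qed.

Lemma norm2_sqrt f : L2 P f -> norm2 P f = (Num.sqrt (\int[P]_w (f w ^+ 2)))%:E.
Proof.
move=> hf; rewrite norm2E -EFin_ex; last exact: L2_sq.
by rewrite poweR_EFin powR12_sqrt// ex_ge0// => w; exact: sqr_ge0.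
Qed.

Lemma L2_L1 f : L2 P f -> L1 f.
Proof.
move=> /L2P[mf hf]; apply: (@L1_le _ (fun w => 1 + f w ^+ 2)) => //.
  by apply: L1D => //; exact: L1_cst.
move=> w; rewrite [leRHS]ger0_norm ?addr_ge0 ?sqr_ge0//.
by rewrite -[f w ^+ 2]real_normK ?num_real//; nra.
Qed.

Lemma L2_le f g : measurable_fun setT f -> L2 P g ->
  (forall w, `|f w| <= `|g w|) -> L2 P f.
Proof.
move=> mf /L2P[mg hg] fg; apply/L2P; split => //.
apply: (L1_le _ hg); first exact: measurable_funX.
by move=> w; rewrite !normrX lerXn2r ?nnegrE.
Qed.

Lemma L2_cst a : L2 P (fun=> a).
Proof. by apply/L2P; split => //; exact: L1_cst. Qed.

Lemma L2Z a f : L2 P f -> L2 P (fun w => a * f w).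
Proof.
move=> /L2P[mf hf]; apply/L2P; split; first exact: measurable_funM.
by under eq_fun do rewrite exprMn; exact: L1Z.
Qed.

Lemma L2D f g : L2 P f -> L2 P g -> L2 P (fun w => f w + g w).
Proof.
move=> hf hg; apply/L2P; split.
  by apply: measurable_funD; exact: L2_meas.
under eq_fun do rewrite sqrrD -mulr_natl.
apply: L1D; last exact: L2_sq.
by apply: L1D; [exact: L2_sq|apply: L1Z; exact: L2_mul].
Qed.

Lemma L2N f : L2 P f -> L2 P (fun w => - f w).
Proof. by move=> /(L2Z (-1)); under eq_fun do rewrite mulN1r. Qed.

Lemma L2B f g : L2 P f -> L2 P g -> L2 P (fun w => f w - g w).
Proof. by move=> hf hg; apply: L2D => //; exact: L2N. Qed.

Lemma L2_sum (I : Type) (r : seq I) (F : I -> T -> R) :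
  (forall i, L2 P (F i)) -> L2 P (fun w => \sum_(i <- r) F i w).
Proof.
move=> h; elim: r => [|i r IH].
  by under eq_fun do rewrite big_nil; exact: L2_cst.
by under eq_fun do rewrite big_cons; exact: L2D.
Qed.

Lemma L2_mul_bounded f g C : measurable_fun setT f -> (forall w, `|f w| <= C) ->
  L2 P g -> L2 P (fun w => f w * g w).
Proof.
move=> mf fC hg; apply: (@L2_le _ (fun w => C * g w)).
- by apply: measurable_funM => //; exact: L2_meas.
- exact: L2Z.
- by move=> w; rewrite !normrM ler_wpM2r// (le_trans (fC w))// ler_norm.
Qed.

Lemma L2_bounded f C : measurable_fun setT f -> (forall w, `|f w| <= C) ->
  L2 P f.
Proof.
move=> mf fC; apply: (L2_le mf (L2_cst C)) => w.
by rewrite (le_trans (fC w))// ler_norm.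
Qed.

Lemma L2_ae f g : measurable_fun setT g -> {ae P, forall w, f w = g w} ->
  L2 P f -> L2 P g.
Proof.
move=> mg fg /L2P[mf hf]; apply/L2P; split => //.
apply: L1_ae hf; first exact: measurable_funX.
by apply: filterS fg => w ->.
Qed.

(** The quadratic form E[(x f + y g)^2] in (x, y) is nonnegative; it is evaluated at one well chosen
    point. *)
Lemma cauchy_schwarz f g : L2 P f -> L2 P g ->
  (\int[P]_w (f w * g w)) ^+ 2 <=
  (\int[P]_w (f w ^+ 2)) * (\int[P]_w (g w ^+ 2)).
Proof.
move=> hf hg; set a := \int[P]_w (f w ^+ 2); set b := \int[P]_w (f w * g w).
set c := \int[P]_w (g w ^+ 2).
have quad x y : 0 <= x ^+ 2 * a + 2 * (x * y) * b + y ^+ 2 * c.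
  rewrite /a /b /c -(exZ _ (L2_sq hf)) -(exZ _ (L2_mul hf hg)) -(exZ _ (L2_sq hg)).
  have h1 := L1Z (x ^+ 2) (L2_sq hf); have h3 := L1Z (y ^+ 2) (L2_sq hg).
  have h2 := L1Z (2 * (x * y)) (L2_mul hf hg).
  rewrite -(exD h1 h2) -(exD (L1D h1 h2) h3).
  apply: ex_ge0 => w.
  by rewrite (_ : _ + _ = (x * f w + y * g w) ^+ 2) ?sqr_ge0//; ring.
have a0 : 0 <= a by apply: ex_ge0 => w; exact: sqr_ge0.
have c0 : 0 <= c by apply: ex_ge0 => w; exact: sqr_ge0.
have [c00|cn0] := eqVneq c 0.
  have [->|b0] := eqVneq b 0; first by rewrite expr0n mulr_ge0.
  (* For c = 0 the form is affine in y, and this y gives it the value -1. *)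
  have := quad 1 (- (a + 1) / (2 * b)).
  rewrite c00 mulr0 addr0 !mul1r expr1n mul1r.
  have -> : a + 2 * (- (a + 1) / (2 * b)) * b = -1 by field.
  by rewrite oppr_ge0 ler10.
have cp : 0 < c by rewrite lt_neqAle eq_sym cn0.
(* The minimizer, scaled by c to avoid a division. *)
have := quad c (- b).
have -> : c ^+ 2 * a + 2 * (c * - b) * b + (- b) ^+ 2 * c = c * (a * c - b ^+ 2).
  by ring.
by rewrite pmulr_rge0// subr_ge0.
Qed.

Lemma cauchy_schwarz_sqrt f g : L2 P f -> L2 P g ->
  `|\int[P]_w (f w * g w)| <=
  Num.sqrt (\int[P]_w (f w ^+ 2)) * Num.sqrt (\int[P]_w (g w ^+ 2)).
Proof.
move=> hf hg; rewrite -sqrtrM; last by apply: ex_ge0 => w; exact: sqr_ge0.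
by rewrite -sqrtr_sqr ler_wsqrtr// cauchy_schwarz.
Qed.

Lemma ex_sq_eq0 f : L2 P f -> \int[P]_w (f w ^+ 2) = 0 ->
  {ae P, forall w, f w = 0}.
Proof.
move=> hf /ex_eq0 h.
have := h (L2_sq hf) (fun w => sqr_ge0 _).
by apply: filterS => w /eqP; rewrite sqrf_eq0 => /eqP.
Qed.
End expectation.

(** * Image laws and centered normal laws *)

Section image_law.
Context {R : realType} {d d'} {T : measurableType d} {T' : measurableType d'}.
Variables (P : {measure set T -> \bar R}) (mu : {measure set T' -> \bar R}).
Variable X : T -> T'.
Hypothesis mX : measurable_fun setT X.
Hypothesis law_X : forall A, measurable A -> P (X @^-1` A) = mu A.

Lemma ge0_integral_law (f : T' -> \bar R) : measurable_fun setT f ->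
  (forall y, 0 <= f y)%E -> (\int[mu]_y f y = \int[P]_x f (X x))%E.
Proof.
move=> mf f0.
rewrite -(@eq_measure_integral _ _ _ setT mu (pushforward P X)); last first.
  by move=> A mA _; rewrite -law_X.
by rewrite ge0_integral_pushforward.
Qed.

Lemma integral_law (f : T' -> \bar R) : measurable_fun setT f ->
  (\int[mu]_y f y = \int[P]_x f (X x))%E.
Proof.
move=> mf; rewrite integralE [RHS]integralE; congr (_ - _)%E.
  rewrite (ge0_integral_law (measurable_funepos mf)).
    by apply: eq_integral => x _; rewrite !funeposE.
  by move=> y; exact: funepos_ge0.
rewrite (ge0_integral_law (measurable_funeneg mf)).
  by apply: eq_integral => x _; rewrite !funenegE.
by move=> y; exact: funeneg_ge0.
Qed.

Lemma ex_law (f : T' -> R) : measurable_fun setT f ->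
  \int[mu]_y f y = \int[P]_x f (X x).
Proof. by move=> mf; rewrite /Rintegral integral_law//; exact/measurable_EFinP. Qed.

Lemma integrable_law (f : T' -> R) : measurable_fun setT f ->
  mu.-integrable setT (EFin \o f) <-> P.-integrable setT (EFin \o (f \o X)).
Proof.
move=> mf; have mf' : measurable_fun setT (EFin \o f) by exact/measurable_EFinP.
have mfX : measurable_fun setT (EFin \o (f \o X)).
  by apply/measurable_EFinP; exact: measurableT_comp.
have E : (\int[mu]_y `|(f y)%:E| = \int[P]_x `|(f (X x))%:E|)%E.
  by rewrite ge0_integral_law//; exact: measurableT_comp.
by split => /integrableP[_ h]; apply/integrableP; split => //;
   move: h; rewrite /= ?E// -E.
Qed.

End image_law.

Section law_existence.
Context {R : realType} {d d'} {T : measurableType d} {T' : measurableType d'}.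
Variable P : probability T R.

Lemma exists_law (X : T -> T') : measurable_fun setT X ->
  exists mu : probability T' R, forall A, measurable A -> P (X @^-1` A) = mu A.
Proof.
move=> mX.
pose X' : {mfun T >-> T'} := HB.pack X (isMeasurableFun.Build _ _ _ _ X mX).
by exists (distribution P X').
Qed.

End law_existence.

Section normal_integral.
Context {R : realType}.
Local Notation mu := (@lebesgue_measure R).
Import HBNNSimple.

(** On indicators this is the definition of [normal_prob]; simple functions and monotone convergence
    do the rest. *)
Lemma integral_normal_prob m s (f : measurableTypeR R -> \bar R) :
  measurable_fun setT f -> (forall x, 0 <= f x)%E ->
  (\int[normal_prob m s]_x f x = \int[mu]_x (f x * (normal_pdf m s x)%:E))%E.
Proof.
move=> mf f0.
have mpdf : measurable_fun setT (fun x => (normal_pdf m s x)%:E).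
  by apply/measurable_EFinP; exact: measurable_normal_pdf.
have pdf0 x : (0 <= (normal_pdf m s x)%:E)%E by rewrite lee_fin normal_pdf_ge0.
pose f_ := nnsfun_approx measurableT mf.
have indic E : measurable E -> (\int[normal_prob m s]_x (\1_E x)%:E =
    \int[mu]_x ((\1_E x)%:E * (normal_pdf m s x)%:E))%E.
  move=> mE; rewrite integral_indic//= /normal_prob setIT.
  rewrite integral_mkcond; apply: eq_integral => x _.
  by rewrite patchE indicE; case: ifPn => _; rewrite ?mul1e ?mul0e.
have nns (h : {nnsfun _ >-> R}) : (\int[normal_prob m s]_x (h x)%:E =
    \int[mu]_x ((h x)%:E * (normal_pdf m s x)%:E))%E.
  under [LHS]eq_integral do rewrite fimfunE -fsumEFin//.
  rewrite [LHS]ge0_integral_fsum//; last 2 first.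
  - move=> r; apply/measurable_EFinP; apply: measurable_funM; first by [].
    by apply: measurable_indic; exact: measurable_sfunP.
  - by move=> n x _; rewrite EFinM nnfun_muleindic_ge0.
  under [RHS]eq_integral.
    move=> x _; rewrite fimfunE -fsumEFin// ge0_mule_fsuml; last first.
      by move=> r; rewrite EFinM nnfun_muleindic_ge0.
    over.
  rewrite [RHS]ge0_integral_fsum//; last 2 first.
  - move=> r; apply: emeasurable_funM => //.
    apply/measurable_EFinP; apply: measurable_funM; first by [].
    by apply: measurable_indic; exact: measurable_sfunP.
  - by move=> n x _; rewrite mule_ge0// EFinM nnfun_muleindic_ge0.
  apply: eq_fsbigr => r _.
  under eq_integral do rewrite EFinM.
  rewrite integralZl_indic_nnsfun// indic//.
  under [RHS]eq_integral do rewrite EFinM -muleA.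
  have [r0|r0] := leP 0 r.
    rewrite ge0_integralZl//.
      by apply: emeasurable_funM => //; exact/measurable_EFinP/measurable_indic.
    by move=> x _; rewrite mule_ge0// lee_fin.
  rewrite preimage_nnfun0// indic0.
  by rewrite !integral0_eq ?mule0// => x _; rewrite /= ?mul0e ?mule0.
transitivity (lim (\int[normal_prob m s]_x (f_ n x)%:E @[n --> \oo])%E).
  rewrite -monotone_convergence//=.
  - apply: eq_integral => ? /[!inE] xD; apply/esym/cvg_lim => //=.
    exact: cvg_nnsfun_approx.
  - by move=> n; apply/measurable_EFinP.
  - by move=> n ? _; rewrite lee_fin.
  - by move=> ? _ ? ? mn; rewrite lee_fin; exact/lefP/nd_nnsfun_approx.
under eq_fun do rewrite nns.
rewrite -monotone_convergence//=.
- apply: eq_integral => x _; apply/cvg_lim => //=.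
  by apply: cvgeZr => //; exact: cvg_nnsfun_approx.
- by move=> n; apply: emeasurable_funM => //; apply/measurable_EFinP.
- by move=> n x _; rewrite mule_ge0// lee_fin.
- move=> x _ a b ab; apply: lee_wpmul2r => //.
  by rewrite lee_fin; exact/lefP/nd_nnsfun_approx.
Qed.

End normal_integral.

Section standard_normal.
Context {R : realType}.
Local Notation mu := (@lebesgue_measure R).

Lemma normal_law_subproof (s : R) : exists nu : probability R R,
  forall A, measurable A -> normal_prob 0 s A = nu A.
Proof.
have mid : measurable_fun [set: measurableTypeR R] (fun x : measurableTypeR R => x : R).
  by move=> _ B mB; rewrite setTI.
exact: (@exists_law R _ _ _ _ (normal_prob 0 s) _ mid).
Qed.

(* [normal_prob] is a measure on [measurableTypeR R], which is not the canonical
   measurable structure of R. *)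
Definition normal_law (s : R) : probability R R := sval (cid (normal_law_subproof s)).

Lemma normal_lawE s (A : set R) : measurable A -> normal_law s A = normal_prob 0 s A.
Proof. by move=> mA; rewrite /normal_law; case: cid => nu h /=; rewrite h. Qed.

Lemma integral_normal_law s (f : R -> \bar R) : measurable_fun setT f ->
  (forall x, 0 <= f x)%E ->
  (\int[normal_law s]_x f x = \int[mu]_x (f x * (normal_pdf 0 s x)%:E))%E.
Proof.
move=> mf f0.
have mid : measurable_fun [set: measurableTypeR R] (fun x : measurableTypeR R => x : R).
  by move=> _ B mB; rewrite setTI.
rewrite (@ge0_integral_law R _ _ _ _ (normal_prob 0 s) (normal_law s) _ mid)//.
  exact: integral_normal_prob.
by move=> A mA; exact/esym/normal_lawE.
Qed.

Lemma integral_normal_subst m s (f : R -> R) : 0 < s -> continuous f ->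
  (forall x, 0 <= f x) ->
  (\int[normal_law 1]_x (f (m + s * x))%:E =
   \int[mu]_x (f x * normal_pdf m s x)%:E)%E.
Proof.
move=> s0 cf f0; rewrite integral_normal_law; last 2 first.
- apply/measurable_EFinP; apply: measurableT_comp.
    by apply: continuous_measurable_fun.
  by apply: measurable_funD => //; apply: measurable_funM.
- by move=> x; rewrite lee_fin.
pose F (x : R) := m + s * x.
have dF : F^`()%classic = cst s.
  apply/funext => x; rewrite /F derive1E deriveD// deriveM// derive_cst.
  by rewrite add0r derive_id derive_cst scaler0 addr0 /GRing.scale/= mulr1.
have s0' : s != 0 by rewrite gt_eqF.
rewrite (@increasing_ge0_integration_by_substitutionT _ F
  (fun x => f x * normal_pdf m s x)).
- apply: eq_integral => x _; rewrite -EFinM; congr EFin.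
  rewrite dF /= /GRing.mul_fun/= -mulrA; congr (_ * _).
  rewrite !normal_pdfE ?oner_eq0//= /normal_fun /F.
  transitivity (normal_peak s * s * expR (- (s * x) ^+ 2 / (s ^+ 2 *+ 2))).
    rewrite subr0; congr (_ * _).
      rewrite /normal_peak expr1n mul1r -mulrnAr sqrtrM ?sqr_ge0//.
      by rewrite sqrtr_sqr gtr0_norm// invfM mulrAC mulVf// mul1r.
    by congr expR; rewrite !mulNr; congr (- _); field; rewrite s0'.
  have e : m + s * x - m = s * x by rewrite addrC addKr.
  by rewrite -[in LHS]e mulrAC.
- by move=> x y xy; rewrite /F ltrD2l ltr_pM2l.
- by rewrite dF => ?; exact: cvg_cst.
- by rewrite dF; exact: is_cvg_cst.
- by rewrite dF; exact: is_cvg_cst.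
- by move=> x; rewrite /F.
- apply/cvgrNyPle => A; apply: filterS (nbhs_ninfty_le (num_real ((A - m) / s))) => x.
  by rewrite ler_pdivlMr// /F => h; lra.
- apply/cvgryPge => A; apply: filterS (nbhs_pinfty_ge (num_real ((A - m) / s))) => x.
  by rewrite ler_pdivrMr// /F => h; lra.
- by move=> x; apply: continuousM; [exact: cf|exact: continuous_normal_pdf].
- by move=> x; rewrite mulr_ge0// normal_pdf_ge0.
Qed.

Lemma normal_peakE (s : R) : 0 < s -> normal_peak s = (s * Num.sqrt (pi *+ 2))^-1.
Proof.
by move=> s0; rewrite /normal_peak -mulrnAr sqrtrM ?sqr_ge0// sqrtr_sqr gtr0_norm.
Qed.

Lemma normal_law_scale s (f : R -> R) : 0 < s -> continuous f ->
  (forall x, 0 <= f x) ->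
  (\int[normal_law s]_x (f x)%:E = \int[normal_law 1]_x (f (s * x))%:E)%E.
Proof.
move=> s0 cf f0; have fE0 x : (0 <= (f x)%:E)%E by rewrite lee_fin.
have mf : measurable_fun setT (EFin \o f).
  by apply/measurable_EFinP; exact: continuous_measurable_fun.
apply: (etrans (integral_normal_law s mf fE0)).
apply: (etrans _ (etrans (esym (integral_normal_subst 0 s0 cf f0)) _)).
  by apply: eq_integral => x _; rewrite -EFinM.
by apply: eq_integral => x _; rewrite add0r.
Qed.

Lemma L2_std_normal : L2 (normal_law 1) (fun x : R => x).
Proof.
apply/L2P; split; first exact: measurable_id.
apply/integrableP; split.
  by apply/measurable_EFinP; apply: measurable_funX; exact: measurable_id.
under eq_integral do rewrite /= ger0_norm ?sqr_ge0//.
have mX2 : measurable_fun setT (fun x : R => (x ^+ 2)%:E).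
  by apply/measurable_EFinP; apply: measurable_funX; exact: measurable_id.
rewrite integral_normal_law//; last by move=> x; rewrite lee_fin sqr_ge0.
(* After division by the common factors this reads x^2 <= 3 exp(3 x^2 / 8), which follows from exp u
   >= 1 + u. The wider normal density serves as an integrable bound. *)
have bound (x : R) : x ^+ 2 * normal_pdf 0 1 x <= 6 * normal_pdf 0 2 x.
  rewrite !normal_pdfE ?oner_eq0//= !normal_peakE// !mul1r.
  have c0 : 0 < Num.sqrt (pi *+ 2) :> R by rewrite sqrtr_gt0 mulrn_wgt0// pi_gt0.
  set c := Num.sqrt (pi *+ 2) in c0 *.
  rewrite /normal_fun !subr0 expr1n.
  set e2 := expR (- x ^+ 2 / (2 ^+ 2 *+ 2)).
  have -> : expR (- x ^+ 2 / (1 *+ 2)) = e2 * expR (- (3 * x ^+ 2 / 8)).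
    rewrite -expRD; congr expR.
    have -> : 2 ^+ 2 *+ 2 = 8 :> R by ring.
    by have -> : 1 *+ 2 = 2 :> R by []; lra.
  have -> : 6 * ((2 * c)^-1 * e2) = c^-1 * (3 * e2).
    by field; rewrite gt_eqF.
  rewrite [leLHS]mulrCA ler_pM2l ?invr_gt0// mulrCA mulrC.
  apply: ler_wpM2r; first exact: expR_ge0.
  rewrite expRN ler_pdivrMr ?expR_gt0//.
  have := expR_ge1Dx (3 * x ^+ 2 / 8).
  by have := sqr_ge0 x; lra.
apply: (@le_lt_trans _ _ (\int[mu]_x (6%:E * (normal_pdf 0 2 x)%:E))%E).
  apply: ge0_le_integral => //.
  - by move=> x _; rewrite -EFinM lee_fin mulr_ge0 ?sqr_ge0 ?normal_pdf_ge0.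
  - apply: emeasurable_funM => //; apply/measurable_EFinP.
    exact: measurable_normal_pdf.
  - apply: emeasurable_funM => //; apply/measurable_EFinP.
    exact: measurable_normal_pdf.
  - by move=> x _; rewrite -!EFinM lee_fin.
rewrite ge0_integralZl//.
- by rewrite integral_normal_pdf mule1 ltry.
- by apply/measurable_EFinP; exact: measurable_normal_pdf.
- by move=> x _; rewrite lee_fin normal_pdf_ge0.
Qed.

Lemma L2_normal_law (s : R) : 0 < s -> L2 (normal_law s) (fun x : R => x).
Proof.
move=> s0; apply/L2P; split; first exact: measurable_id.
apply/integrableP; split.
  by apply/measurable_EFinP; apply: measurable_funX; exact: measurable_id.
under eq_integral do rewrite /= ger0_norm ?sqr_ge0//.
rewrite (normal_law_scale s0 (f := fun x => x ^+ 2))//; last 2 first.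
- by move=> x; exact: exprn_continuous.
- by move=> x; exact: sqr_ge0.
have /(L2Z s)/L2_sq/integrableP[_] := L2_std_normal.
by under eq_integral do rewrite /= ger0_norm ?sqr_ge0//.
Qed.

Lemma normal_law_set1 (s x : R) : 0 < s -> normal_law s [set x] = 0%E.
Proof. by move=> s0; rewrite normal_lawE// /normal_prob integral_set1. Qed.

Lemma normal_law_var_gt0 (s : R) : 0 < s -> 0 < \int[normal_law s]_x (x ^+ 2).
Proof.
move=> s0; rewrite lt_neqAle ex_ge0 ?andbT; last by move=> x; exact: sqr_ge0.
apply/eqP => /esym /(ex_sq_eq0 (L2_normal_law s0)) h.
apply: (@ae_contradiction _ _ _ (normal_law s)).
have h' : {ae normal_law s, forall x, x <> 0 :> R}.
  exists [set 0%R : R]; split => //; first exact: normal_law_set1.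
  by move=> x /= /contrapT.
by near=> x; apply: (near h' x) => //; exact: (near h x).
Unshelve. all: end_near. Qed.

(** The line is split at 0 and each half is reflected onto the other. *)
Lemma normal_law_sym s (f : R -> R) : 0 < s -> continuous f -> (forall x, 0 <= f x) ->
  \int[normal_law s]_x f (- x) = \int[normal_law s]_x f x.
Proof.
move=> s0 cf f0.
have cfN : continuous (fun x : R => f (- x)).
  by move=> x; apply: continuous_comp; [exact: oppr_continuous|exact: cf].
have ce (h : R -> R) : continuous h -> measurable_fun setT (EFin \o h).
  by move=> ch; apply/measurable_EFinP; exact: continuous_measurable_fun.
have cn : continuous (normal_pdf 0 s) by apply: continuous_normal_pdf; rewrite gt_eqF.
pose G x := f x * normal_pdf 0 s x; pose G' x := f (- x) * normal_pdf 0 s x.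
have cG : continuous G by move=> x; apply: continuousM; [exact: cf|exact: cn].
have cG' : continuous G' by move=> x; apply: continuousM; [exact: cfN|exact: cn].
have G0 x : 0 <= G x by rewrite mulr_ge0// normal_pdf_ge0.
have G0' x : 0 <= G' x by rewrite mulr_ge0// normal_pdf_ge0.
have GN x : G (- x) = G' x.
  rewrite /G /G' !normal_pdfE ?gt_eqF//= /normal_fun !subr0.
  by rewrite sqrrN.
have fE0 x : (0 <= (f x)%:E)%E by rewrite lee_fin.
have fNE0 x : (0 <= (f (- x))%:E)%E by rewrite lee_fin.
congr fine; rewrite (integral_normal_law s (ce _ cfN) fNE0) (integral_normal_law s (ce _ cf) fE0).
transitivity (\int[mu]_x (G' x)%:E)%E; first by apply: eq_integral => x _; rewrite -EFinM.
transitivity (\int[mu]_x (G x)%:E)%E; last by apply: eq_integral => x _; rewrite -EFinM.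
have split0 (h : R -> R) : continuous h -> (forall x, 0 <= h x) ->
    (\int[mu]_x (h x)%:E = \int[mu]_(x in `]-oo, 0%R]) (h x)%:E
      + \int[mu]_(x in `[0%R, +oo[) (h x)%:E)%E.
  move=> ch h0; rewrite -[X in (_ + X)%E]integral_itv_obnd_cbnd; last first.
    by apply: measurable_funTS; exact: ce.
  rewrite -ge0_integral_setU//=.
  - by rewrite (@itv_setU_setT _ R false 0).
  - by apply: measurable_funTS; exact: ce.
  - by move=> x _; rewrite lee_fin.
  - apply/disj_setPS => x []/=; rewrite !in_itv/= andbT => h1 h2.
    by have := lt_le_trans h2 h1; rewrite ltxx.
have refl (h : R -> R) : continuous h -> (forall x, 0 <= h x) ->
    (\int[mu]_(x in `]-oo, 0%R]) (h x)%:E = \int[mu]_(x in `[0%R, +oo[) (h (- x))%:E)%E.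
  move=> ch h0; have := @ge0_integration_by_substitutionNy R h 0.
  by rewrite oppr0 => ->//; exact: continuous_subspaceT.
rewrite (split0 _ cG' G0') (split0 _ cG G0) (refl _ cG G0) (refl _ cG' G0') addeC.
have e1 : (\int[mu]_(x in `[0%R, +oo[) (G (- x))%:E = \int[mu]_(x in `[0%R, +oo[) (G' x)%:E)%E.
  by apply: eq_integral => x _; rewrite GN.
have e2 : (\int[mu]_(x in `[0%R, +oo[) (G' (- x))%:E = \int[mu]_(x in `[0%R, +oo[) (G x)%:E)%E.
  by apply: eq_integral => x _; rewrite -GN opprK.
by rewrite e1 e2.
Qed.

Lemma normal_law_mean (s : R) : 0 < s -> \int[normal_law s]_x x = 0.
Proof.
move=> s0; have l1 := L2_L1 (L2_normal_law s0).
have l2 : L1 (normal_law s) (fun x : R => `|x|).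
  apply: (L1_le _ l1) => [|x]; last by rewrite normr_id.
  by apply: measurableT_comp => //; exact: measurable_id.
(* Symmetry is available for nonnegative functions, hence for |x| + x in place of x. *)
have c : continuous (fun x : R => `|x| + x).
  by move=> x; apply: cvgD; [exact: norm_continuous|exact: cvg_id].
have ge0 (x : R) : 0 <= `|x| + x by have := ler_norm (- x); rewrite normrN; lra.
have := normal_law_sym s0 c ge0.
under eq_Rintegral do rewrite normrN.
by rewrite exB// exD//; lra.
Qed.

End standard_normal.

(** * Gaussian variables: limits and convolution *)

Section limits.
Context {R : realType} {d} {T : measurableType d} (P : probability T R).

Lemma ex_dct (f_ : nat -> T -> R) (f g : T -> R) :
  (forall n, measurable_fun setT (f_ n)) -> measurable_fun setT f -> L1 P g ->
  (forall n w, `|f_ n w| <= g w) ->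
  {ae P, forall w, f_ n w @[n --> \oo] --> f w} ->
  \int[P]_w f_ n w @[n --> \oo] --> \int[P]_w f w.
Proof.
move=> mf_ mf hg fg hcv.
have := @dominated_convergence _ _ _ P _ measurableT (fun n => EFin \o f_ n)
  (EFin \o f) (EFin \o g).
case.
- by move=> n; exact/measurable_EFinP.
- exact/measurable_EFinP.
- apply: filterS hcv => w h _.
  by apply: cvg_comp h _ => //.
- exact: hg.
- by apply: aeW => w n _ /=; rewrite lee_fin.
move=> hf _ h; apply: fine_cvg; rewrite /= /Rintegral fineK//.
exact: integrable_fin_num.
Qed.

Lemma ex_dct_bounded (f_ : nat -> T -> R) (f : T -> R) (C : R) :
  (forall n, measurable_fun setT (f_ n)) -> measurable_fun setT f ->
  (forall n w, `|f_ n w| <= C) ->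
  {ae P, forall w, f_ n w @[n --> \oo] --> f w} ->
  \int[P]_w f_ n w @[n --> \oo] --> \int[P]_w f w.
Proof. by move=> h1 h2 h3 h4; apply: (@ex_dct _ _ (cst C)) => //; exact: L1_cst. Qed.

End limits.

Section law_determination.
Context {R : realType}.

Lemma continuous_clamp (f : R -> R) : continuous f ->
  continuous (fun x => Num.max 0 (Num.min 1 (f x))).
Proof.
move=> cf x.
apply: (@continuous_max R R (fun=> 0) (fun x => Num.min 1 (f x)) x).
  exact: cst_continuous.
apply: (@continuous_min R R (fun=> 1) f x); first exact: cst_continuous.
exact: cf.
Qed.

Lemma clamp_itv (y : R) : 0 <= Num.max 0 (Num.min 1 y) <= 1.
Proof. by rewrite le_max lexx ge_max ler01 ge_min lexx. Qed.

Definition test_fun (f : R -> R) := continuous f /\ forall x, 0 <= f x <= 1.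

Lemma test_fun_meas f : test_fun f -> measurable_fun setT f.
Proof. by case=> cf _; exact: continuous_measurable_fun. Qed.

Lemma test_fun_norm f x : test_fun f -> `|f x| <= 1.
Proof. by case=> _ /(_ x) /andP[h1 h2]; rewrite ger0_norm. Qed.

(** Open rays form a generating pi-system, and their indicators are limits of the clamped linear
    functions n (a - x). *)
Lemma prob_determined (m1 m2 : probability R R) :
  (forall f, test_fun f -> \int[m1]_x f x = \int[m2]_x f x) ->
  forall A, measurable A -> m1 A = m2 A.
Proof.
move=> h.
have half a : m1 `]-oo, a[%classic = m2 `]-oo, a[%classic.
  pose f n (x : R) : R := Num.max 0 (Num.min 1 (n%:R * (a - x))).
  have tf n : test_fun (f n).
    split; last by move=> x; exact: clamp_itv.
    apply: continuous_clamp => x.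
    apply: cvgM; first exact: cvg_cst.
    by apply: cvgB; [exact: cvg_cst|exact: cvg_id].
  have cv (m : probability R R) :
      \int[m]_x f n x @[n --> \oo] --> \int[m]_x (\1_(`]-oo, a[%classic) x : R).
    apply: (@ex_dct_bounded _ _ _ m f _ 1).
    - by move=> n; exact: test_fun_meas.
    - exact: measurable_indic.
    - by move=> n x; exact: test_fun_norm.
    - apply: aeW => x; rewrite indicE mem_setE in_itv/=.
      have [xa|ax] := ltP x a.
        apply: cvg_near_cst; near=> n.
        rewrite /f (min_idPl _); first by rewrite (max_idPr _).
        rewrite -ler_pdivrMr ?subr_gt0// mul1r.
        by near: n; exact: nbhs_infty_ger.
      apply: cvg_near_cst; near=> n.
      rewrite /f (max_idPl _)// ge_min; apply/orP; right.
      by rewrite mulr_ge0_le0// subr_le0.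
  have : \int[m1]_x (\1_(`]-oo, a[%classic) x : R) = \int[m2]_x (\1_(`]-oo, a[%classic) x : R).
    apply: (cvg_unique _ (cv m1)) => //.
    have -> : (fun n => \int[m1]_x f n x) = (fun n => \int[m2]_x f n x).
      by apply/funext => n; exact: h.
    exact: cv.
  rewrite !ex_indic// => e.
  by rewrite -(fineK (fin_num_measure m1 _ _))// e fineK// fin_num_measure.
move=> A mA.
apply: (measure_unique (@RGenInftyO.G R) (fun n => `]-oo, n%:R[%classic)) => //.
- exact: RGenInftyO.measurableE.
- move=> X Y [x ->] [y ->]; exists (Num.min x y).
  by apply/seteqP; split => z /=; rewrite !in_itv/= lt_min; [case=> -> ->|case/andP].
- by move=> n; exists n%:R.
- apply/seteqP; split => // x _; exists (Num.truncn x).+1 => //=.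
  by rewrite in_itv/= truncnS_gt.
- by move=> X [x ->]; exact: half.
- by move=> n; rewrite (le_lt_trans (probability_le1 _ _))// ltry.
Unshelve. all: end_near. Qed.

(* Tested against continuous functions, so that [s = 0] gives the Dirac mass
   at 0 and almost sure limits need no case distinction. *)
Definition gauss d (T : measurableType d) (P : probability T R) (s : R)
    (X : T -> R) : Prop :=
  [/\ measurable_fun setT X, 0 <= s & forall f, test_fun f ->
     \int[P]_w f (X w) = \int[normal_law 1]_y f (s * y)].

Lemma normal_law_scale_test s (f : R -> R) : 0 < s -> test_fun f ->
  \int[normal_law s]_x f x = \int[normal_law 1]_x f (s * x).
Proof.
move=> s0 [cf f01]; rewrite /Rintegral normal_law_scale//.
by move=> x; have /andP[] := f01 x.
Qed.

Lemma gauss_centered d (T : measurableType d) (P : probability T R) s X :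
  gauss P s X -> centered_gaussian P X.
Proof.
move=> [mX s0 hX]; split => //.
have [mu hmu] := exists_law P mX.
move: s0; rewrite le_eqVlt => /orP[/eqP s0|s0].
  (* In the degenerate case the law is compared with that of the constant 0, through test
     functions. *)
  left; have [nu hnu] := @exists_law _ _ _ _ _ P (fun=> 0 : R) (measurable_cst _).
  have e : mu [set 0] = nu [set 0].
    apply: prob_determined => // f tf.
    rewrite (ex_law mX hmu (test_fun_meas tf)) hX// -s0.
    rewrite (ex_law _ hnu (test_fun_meas tf)) ?ex_cst//.
    by under eq_Rintegral do rewrite mul0r; rewrite ex_cst.
  have := hmu [set 0] (measurable_set1 0); rewrite e -hnu//.
  move=> h; rewrite [LHS]h.
  rewrite (_ : _ @^-1` _ = setT) ?probability_setT//.
  by apply/seteqP; split.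
right; exists s => // A mA.
transitivity (mu A); first exact: hmu.
transitivity (normal_law s A); last exact: normal_lawE.
apply: (@prob_determined mu (normal_law s) _ A mA) => f tf.
have e1 := ex_law mX hmu (test_fun_meas tf).
exact: (etrans e1 (etrans (hX f tf) (esym (normal_law_scale_test s0 tf)))).
Qed.

Lemma continuous_test_scale (f : R -> R) : test_fun f ->
  forall s, test_fun (fun y => f (s * y)).
Proof.
move=> [cf f01] s; split => // x.
apply: (@continuous_comp _ _ _ (fun y => s * y) f); last exact: cf.
by apply: cvgM; [exact: cvg_cst|exact: cvg_id].
Qed.

Lemma cvg_test_scale (f : R -> R) (s : nat -> R) (l : R) : test_fun f ->
  s n @[n --> \oo] --> l ->
  \int[normal_law 1]_y f (s n * y) @[n --> \oo] --> \int[normal_law 1]_y f (l * y).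
Proof.
move=> tf sl; apply: (@ex_dct_bounded _ _ _ _ _ _ 1).
- by move=> n; apply: test_fun_meas; exact: continuous_test_scale.
- by apply: test_fun_meas; exact: continuous_test_scale.
- by move=> n y; exact: test_fun_norm.
- apply: aeW => y; apply: continuous_cvg; first exact: (proj1 tf).
  by apply: cvgM => //; exact: cvg_cst.
Qed.

(** The deviations [s n] must stay bounded, since otherwise the mass would escape to infinity and
    not converge to the law of [X]. A convergent subsequence of them then gives the deviation of the
    limit, as expectations of test functions determine the law. *)
Lemma gauss_limit d (T : measurableType d) (P : probability T R)
    (s : nat -> R) (X_ : nat -> T -> R) (X : T -> R) :
  (forall n, gauss P (s n) (X_ n)) -> measurable_fun setT X ->
  {ae P, forall w, X_ n w @[n --> \oo] --> X w} ->
  exists l, gauss P l X.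
Proof.
move=> hX mX cX.
have cE f : test_fun f ->
    \int[P]_w f (X_ n w) @[n --> \oo] --> \int[P]_w f (X w).
  move=> tf; apply: (@ex_dct_bounded _ _ _ _ _ _ 1).
  - move=> n; apply: measurableT_comp; first exact: test_fun_meas.
    by case: (hX n).
  - by apply: measurableT_comp => //; exact: test_fun_meas.
  - by move=> n y; exact: test_fun_norm.
  - apply: filterS cX => w; apply: continuous_cvg.
    exact: (proj1 tf).
(* A test function equal to 1 on [-M, M] and to 0 outside [-M-1, M+1]. *)
pose cut (M x : R) : R := Num.max 0 (Num.min 1 (M + 1 - `|x|)).
have tcut M : test_fun (cut M).
  split; last by move=> x; exact: clamp_itv.
  apply: continuous_clamp => x.
  by apply: cvgB; [exact: cvg_cst|exact: norm_continuous].
have [M hM] : exists M : R, 1 / 2 < \int[P]_w cut M (X w).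
  have cv : \int[P]_w cut n%:R (X w) @[n --> \oo] --> \int[P]_w (1 : R).
    apply: (@ex_dct_bounded _ _ _ _ _ _ 1) => //.
    - move=> n; apply: measurableT_comp => //; exact: test_fun_meas.
    - by move=> n w; exact: test_fun_norm.
    - apply: aeW => w; apply: cvg_near_cst; near=> n.
      rewrite /cut (min_idPl _); first by rewrite (max_idPr _).
      suff : `|X w| <= n%:R by lra.
      by near: n; exact: nbhs_infty_ger.
  rewrite ex_cst in cv.
  have /(cvgr_gt _ cv) : (1 / 2 : R) < 1 by lra.
  by move=> [N _ /(_ N (leqnn N)) h]; exists N%:R.
(* [X] keeps more than half of its mass near the origin, a normal variable of deviation [S] keeps
   less; since [cut] decreases in |x|, every deviation above [S] keeps less as well. *)
have [S S0 hS] : exists2 S : R, 0 <= S &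
    \int[normal_law 1]_y cut M (S * y) < 1 / 2.
  have cv : \int[normal_law 1]_y cut M (n%:R * y) @[n --> \oo] -->
      \int[normal_law 1]_y (0 : R).
    apply: (@ex_dct_bounded _ _ _ _ _ _ 1) => //.
    - by move=> n; apply: test_fun_meas; exact: continuous_test_scale.
    - by move=> n w; exact: test_fun_norm.
    - exists [set 0]; split => //; first exact: normal_law_set1.
      move=> y /= h; apply: contrapT => y0; apply: h.
      apply: cvg_near_cst; near=> n.
      rewrite /cut (max_idPl _)// ge_min; apply/orP; right.
      rewrite normrM normr_nat.
      suff : M + 1 <= n%:R * `|y| by lra.
      have y0' : 0 < `|y| by rewrite normr_gt0; apply/eqP.
      rewrite -ler_pdivrMr//.
      by near: n; exact: nbhs_infty_ger.
  rewrite ex_cst in cv.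
  have /(cvgr_lt _ cv) : (0 : R) < 1 / 2 by lra.
  by move=> [N _ /(_ N (leqnn N)) h]; exists N%:R.
have [N hN] : exists N, forall n, (N <= n)%N -> 0 <= s n <= S.
  have /(cvgr_gt _ (cE _ (tcut M))) [N _ h] := hM.
  exists N => n /h /=; have [_ s0 ->//] := hX n.
  rewrite s0 /= => h1; rewrite leNgt; apply/negP => Ss.
  have : \int[normal_law 1]_y cut M (s n * y) <= \int[normal_law 1]_y cut M (S * y).
    apply: ex_le.
    - apply: (@L1_bounded _ _ _ _ _ 1).
        by apply: test_fun_meas; exact: continuous_test_scale.
      by move=> y; exact: test_fun_norm.
    - apply: (@L1_bounded _ _ _ _ _ 1).
        by apply: test_fun_meas; exact: continuous_test_scale.
      by move=> y; exact: test_fun_norm.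
    - move=> y; rewrite /cut.
      have : `|S * y| <= `|s n * y|.
        by rewrite !normrM ler_wpM2r// !ger0_norm// ltW.
      move: (`|S * y|) (`|s n * y|) => a b ab.
      rewrite ge_max le_max lexx /= le_max; apply/orP; right.
      by rewrite le_min !ge_min lexx /=; apply/orP; right; lra.
  by lra.
have [phi iphi /cvg_ex[l hl]] : exists2 phi : nat -> nat, increasing_seq phi &
    cvgn ((fun n => s (N + n)%N) \o phi).
  apply: bolzano_weierstrass; exists S; split; first exact: num_real.
  move=> x Sx n _ /=; have /andP[h1 h2] := hN (N + n)%N (leq_addr _ _).
  by rewrite ger0_norm// (le_trans h2)// ltW.
exists l; split => //.
- rewrite -(cvg_lim _ hl)//; apply: limr_ge; first by apply/cvg_ex; exists l.
  apply: nearW => n /=; by have /andP[] := hN (N + phi n)%N (leq_addr _ _).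
- move=> f tf.
  have c1 := cvg_test_scale tf hl.
  apply: (cvg_unique _ _ c1) => //.
  have c2 : \int[P]_w f (X_ (N + phi n)%N w) @[n --> \oo] --> \int[P]_w f (X w).
    apply: (@cvg_comp _ _ _ (fun n => (N + phi n)%N)
      (fun n => \int[P]_w f (X_ n w)) _ \oo _ _ (cE _ tf)).
    apply/cvgnyPge => A; near=> n.
    apply: (@leq_trans n); first by near: n; exact: nbhs_infty_ge.
    rewrite (leq_trans _ (leq_addl _ _))//.
    elim: (n) => // k IH; apply: leq_ltn_trans IH _.
    by have /increasing_seqP := iphi; apply.
  have -> : (fun n => \int[normal_law 1]_y f (((fun n0 => s (N + n0)%N) \o phi) n * y))
    = (fun n => \int[P]_w f (X_ (N + phi n)%N w)).
    by apply/funext => n; have [_ _ ->] := hX (N + phi n)%N.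
  exact: c2.
Unshelve. all: end_near. Qed.

End law_determination.

(** * Sums of independent normal variables *)

Section convolution.
Context {R : realType}.
Local Notation mu := (@lebesgue_measure R).
Local Notation gam := (normal_law (1 : R)).

(* Completing the square. *)
Lemma normal_pdf_mul (a b c x z : R) : 0 < a -> 0 < b -> 0 < c ->
  c ^+ 2 = a ^+ 2 + b ^+ 2 ->
  normal_pdf 0 1 x * normal_pdf (a * x) b z =
  normal_pdf 0 c z * normal_pdf (a * z / c ^+ 2) (b / c) x.
Proof.
move=> a0 b0 c0 cE.
have bc0 : 0 < b / c by rewrite divr_gt0.
rewrite !normal_pdfE ?oner_eq0 ?gt_eqF//= /normal_fun !normal_peakE// mul1r.
have q0 : 0 < Num.sqrt (pi *+ 2) :> R by rewrite sqrtr_gt0 mulrn_wgt0// pi_gt0.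
set q := Num.sqrt (pi *+ 2) in q0 *.
rewrite mulrACA [RHS]mulrACA -!expRD; congr (_ * expR _).
  by field; rewrite !gt_eqF.
rewrite !subr0 expr1n.
have hb : b != 0 by rewrite gt_eqF.
have hc : c != 0 by rewrite gt_eqF.
have key : x ^+ 2 + (z - a * x) ^+ 2 / b ^+ 2 =
    z ^+ 2 / c ^+ 2 + (x - a * z / c ^+ 2) ^+ 2 / (b / c) ^+ 2.
  apply/eqP; rewrite -subr_eq0; apply/eqP.
  transitivity ((c ^+ 2 - a ^+ 2 - b ^+ 2) * (z ^+ 2 - c ^+ 2 * x ^+ 2) / (b ^+ 2 * c ^+ 2)).
    by field; rewrite hb hc.
  by rewrite cE (_ : _ - _ - _ = 0) ?mul0r//; ring.
rewrite !mulNr -!opprD; congr (- _).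
transitivity ((x ^+ 2 + (z - a * x) ^+ 2 / b ^+ 2) / 2).
  by field; rewrite hb.
by rewrite key; field; rewrite hb hc.
Qed.

Lemma measurable_normal_pdf2 (a b : R) : 0 < b ->
  measurable_fun setT (fun p : measurableTypeR R * measurableTypeR R =>
    normal_pdf (a * p.1) b p.2).
Proof.
move=> b0; under eq_fun do rewrite normal_pdfE ?gt_eqF//.
apply: measurable_funM => //.
apply: (measurableT_comp (@measurable_expR R)).
apply: measurable_funM => //; apply: measurableT_comp => //.
apply: measurable_funX; apply: measurable_funB => //.
by apply: measurable_funM.
Qed.

(** In the joint density of the first variable x and of the sum z, completing the square leaves the
    density of z times a normal density in x, which integrates to 1. *)
Lemma normal_convolution (a b : R) (f : R -> R) : 0 < a -> 0 < b ->
  test_fun f ->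
  (\int[gam]_x \int[gam]_y (f (a * x + b * y))%:E =
   \int[gam]_z (f (Num.sqrt (a ^+ 2 + b ^+ 2) * z))%:E)%E.
Proof.
move=> a0 b0 tf; set c := Num.sqrt _.
have c0 : 0 < c by rewrite sqrtr_gt0 addr_gt0// exprn_gt0.
have cE : c ^+ 2 = a ^+ 2 + b ^+ 2 by rewrite sqr_sqrtr// addr_ge0// sqr_ge0.
have cf := proj1 tf.
have f0 x : 0 <= f x by have /andP[] := proj2 tf x.
have mf : measurable_fun [set: measurableTypeR R] f by exact: test_fun_meas.
under eq_integral => x _ do rewrite (integral_normal_subst (a * x) b0 cf f0).
have -> : (\int[gam]_z (f (c * z))%:E = \int[mu]_z (f z * normal_pdf 0 c z)%:E)%E.
  rewrite -(integral_normal_subst 0 c0 cf f0).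
  by apply: eq_integral => z _; rewrite add0r.
have mpdf2 := measurable_normal_pdf2 a b0.
pose k (p : measurableTypeR R * measurableTypeR R) : \bar R :=
  ((f p.2 * normal_pdf (a * p.1) b p.2)%:E * (normal_pdf 0 1 p.1)%:E)%E.
have mk1 : measurable_fun setT (fun p : measurableTypeR R * measurableTypeR R =>
    (f p.2 * normal_pdf (a * p.1) b p.2)%:E).
  apply/measurable_EFinP; apply: measurable_funM => //.
  exact: measurableT_comp.
have mk : measurable_fun setT k.
  apply: emeasurable_funM => //; apply/measurable_EFinP.
  apply: (@measurableT_comp _ _ _ _ _ _ (normal_pdf 0 1)) => //.
  exact: measurable_normal_pdf.
have k0 p : (0 <= k p)%E.
  by rewrite mule_ge0// lee_fin ?mulr_ge0// normal_pdf_ge0.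
have ge1 p : (0 <= (f p.2 * normal_pdf (a * p.1) b p.2)%:E)%E.
  by rewrite lee_fin mulr_ge0// normal_pdf_ge0.
rewrite integral_normal_law; last 2 first.
- exact: (@measurable_fun_fubini_tonelli_F _ _ _ _ _ mu _ mk1).
- by move=> x; apply: integral_ge0 => z _; exact: (ge1 (x, z)).
transitivity (\int[mu]_x \int[mu]_z k (x, z))%E.
  apply: eq_integral => x _; rewrite -ge0_integralZr//.
  - apply/measurable_EFinP; apply: measurable_funM => //.
    exact: measurable_normal_pdf.
  - by move=> z _; exact: (ge1 (x, z)).
  - by rewrite lee_fin normal_pdf_ge0.
rewrite (@fubini_tonelli _ _ _ _ _ mu mu k)//.
apply: eq_integral => z _.
have e x : k (x, z) = ((f z * normal_pdf 0 c z)%:E *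
    (normal_pdf (a * z / c ^+ 2) (b / c) x)%:E)%E.
  rewrite /k -!EFinM; congr EFin; rewrite -!mulrA; congr (_ * _).
  by rewrite [LHS]mulrC [a * (z / _)]mulrA; exact: (normal_pdf_mul x z a0 b0 c0 cE).
under eq_integral do rewrite e.
rewrite ge0_integralZl//.
- by rewrite integral_normal_pdf mule1.
- by apply/measurable_EFinP; exact: measurable_normal_pdf.
- by move=> x _; rewrite lee_fin normal_pdf_ge0.
- by rewrite lee_fin mulr_ge0// normal_pdf_ge0.
Qed.

End convolution.

(** * Independence of Brownian increments *)

Section sub_sigma_algebra.
Context {R : realType} {d} {Om : measurableType d}.
Implicit Types (G H : set (set Om)) (X Y : Om -> R).

(** Stated through the generated structure, so that the closure properties of measurable functions
    apply to any family [G]. *)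
Definition mg G X := measurable_fun [set: g_sigma_algebraType G] X.

Lemma mgP G X : sigma_algebra setT G -> measurable_wrt G X <-> mg G X.
Proof.
move=> sG; have GE : <<s G >> = G by exact: sigma_algebra_id.
split=> [h _ B mB|h B mB]; first by rewrite setTI; apply: sub_sigma_algebra; exact: h.
by rewrite -GE -[X @^-1` B]setTI; exact: h.
Qed.

Lemma mg_sub G H X : G `<=` <<s H >> -> mg G X -> mg H X.
Proof.
move=> GH h _ B mB; have := h measurableT B mB.
by apply: smallest_sub => //; exact: smallest_sigma_algebra.
Qed.

Lemma mg_meas G X : G `<=` measurable -> mg G X -> measurable_fun setT X.
Proof.
move=> GH h _ B mB; have := h measurableT B mB.
by apply: smallest_sub => //; exact: sigma_algebra_measurable.
Qed.

Lemma mg_indic G A : <<s G >> A -> mg G (\1_A).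
Proof. by move=> GA; exact: (@measurable_indic _ (g_sigma_algebraType G)). Qed.

End sub_sigma_algebra.

Section independence.
Context {R : realType} {d} {Om : measurableType d} (P : probability Om R).
Variables (G : set (set Om)) (Y : Om -> R) (N : probability R R).
Hypotheses (G_meas : G `<=` measurable) (GI : setI_closed G) (GT : G setT).
Hypothesis mY : measurable_fun setT Y.
Hypothesis indep : forall E A, G E -> measurable A ->
  P (E `&` Y @^-1` A) = (P E * N A)%E.

Let sG_meas : <<s G >> `<=` measurable.
Proof. by apply: smallest_sub => //; exact: sigma_algebra_measurable. Qed.

(** As functions of [E], both sides are finite measures, and they agree on the pi-system [G]. *)
Lemma indep_sigma E A : <<s G >> E -> measurable A ->
  P (E `&` Y @^-1` A) = (P E * N A)%E.
Proof.
move=> GE mA.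
have mYA : measurable (Y @^-1` A) by rewrite -[X in measurable X]setTI; exact: mY.
have NA : (0 <= fine (N A))%R by rewrite fine_ge0.
have scE B : mscale (NngNum NA) P B = (P B * N A)%E.
  have NAf : N A \is a fin_num by exact: fin_num_measure.
  by rewrite muleC -[in RHS](fineK NAf).
rewrite -scE; apply: (@g_sigma_algebra_measure_unique _ R Om G G_meas
  (fun=> setT) (fun=> GT) _ (mrestr P mYA) (mscale (NngNum NA) P) GI _ _ E GE).
- by rewrite bigcup_const//; exists 0%N.
- by move=> B GB; rewrite [RHS]scE -indep.
- by move=> _; rewrite (le_lt_trans (probability_le1 _ _)) ?ltry//; exact: measurableI.
Qed.

(** Independence as an image law: w is kept as a point of the space carrying the smaller
    sigma-algebra, so that Fubini on the product computes expectations of [G]-measurable variables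
    combined with [Y]. *)
Lemma indep_law : exists PG : probability (g_sigma_algebraType G) R,
  (forall E, <<s G >> E -> P E = PG E) /\
  (forall A : set (g_sigma_algebraType G * R), measurable A ->
    P [set w | A (w, Y w)] = (PG \x N)%E A).
Proof.
have mid : measurable_fun [set: Om] (fun w => w : g_sigma_algebraType G).
  by move=> _ B mB; rewrite setTI; exact: sG_meas.
have [PG hPG] := exists_law P mid.
exists PG; split => //.
have mTh : measurable_fun [set: Om] (fun w => (w : g_sigma_algebraType G, Y w)).
  exact: measurable_fun_pair.
have [m hm] := exists_law P mTh.
move=> A mA; rewrite (@product_measure_unique _ _ _ _ _ PG N m)//.
  exact: hm.
move=> E B mE mB.
transitivity (P (E `&` Y @^-1` B)); first by apply/esym/hm; exact: measurableX.
transitivity (P E * N B)%E; first exact: indep_sigma.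
by congr (_ * _)%E; exact: hPG.
Qed.

Lemma indep_ex (psi : g_sigma_algebraType G * R -> R) :
  measurable_fun setT psi -> L1 P (fun w => psi (w, Y w)) ->
  \int[P]_w psi (w, Y w) = \int[P]_w \int[N]_y psi (w, y).
Proof.
move=> mpsi hpsi.
have [PG [hPG hlaw]] := indep_law.
have mid : measurable_fun [set: Om] (fun w => w : g_sigma_algebraType G).
  by move=> _ B mB; rewrite setTI; exact: sG_meas.
have mTh : measurable_fun [set: Om] (fun w => (w : g_sigma_algebraType G, Y w)).
  exact: measurable_fun_pair.
have ipsi : (PG \x N)%E.-integrable setT (EFin \o psi).
  by apply/(integrable_law mTh hlaw mpsi).
transitivity (fine (\int[PG]_w (\int[N]_y (psi (w, y))%:E))%E).
  rewrite -(ex_law mTh hlaw mpsi) /Rintegral.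
  by rewrite -(integral12_prod_meas1 ipsi).
have mF : measurable_fun [set: g_sigma_algebraType G]
    (fun w => \int[N]_y psi (w, y)).
  rewrite /Rintegral; apply: measurableT_comp => //.
  exact: (measurable_fubini_F ipsi).
rewrite -(@ex_law _ _ _ _ _ P PG _ mid hPG _ mF) /Rintegral; congr fine.
apply: ae_eq_integral => //.
- exact: (measurable_fubini_F ipsi).
- exact/measurable_EFinP.
- have := ae_integrable1 ipsi; apply: filterS => w h _ /=.
  by rewrite fineK//; exact: integrable_fin_num.
Qed.

Lemma indep_mul (H : Om -> R) (f : R -> R) : mg G H -> L1 P H -> L1 N f ->
  L1 P (fun w => H w * f (Y w)) /\
  \int[P]_w (H w * f (Y w)) = (\int[P]_w H w) * (\int[N]_y f y).
Proof.
move=> gH hH hf.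
have [PG [hPG hlaw]] := indep_law.
have mid : measurable_fun [set: Om] (fun w => w : g_sigma_algebraType G).
  by move=> _ B mB; rewrite setTI; exact: sG_meas.
have mTh : measurable_fun [set: Om] (fun w => (w : g_sigma_algebraType G, Y w)).
  exact: measurable_fun_pair.
pose psi (p : g_sigma_algebraType G * R) := H p.1 * f p.2.
have mpsi : measurable_fun setT psi.
  apply: measurable_funM; first exact: (measurableT_comp gH).
  by apply: measurableT_comp => //; exact: (L1_meas hf).
have iH : PG.-integrable setT (EFin \o H).
  by apply/(@integrable_law _ _ _ _ _ P PG _ mid hPG).
have ipsi : (PG \x N)%E.-integrable setT (EFin \o psi).
  apply/integrable12ltyP; first exact/measurable_EFinP.
  have hf' : L1 N (fun y => `|f y|).
    apply: (L1_le _ hf) => [|y]; last by rewrite normr_id.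
    by apply: measurableT_comp => //; exact: L1_meas hf.
  have e (w : g_sigma_algebraType G) : (\int[N]_y `|(psi (w, y))%:E| =
      `|(H w)%:E| * (\int[N]_y `|f y|)%:E)%E.
    under eq_integral do rewrite /psi /= normrM EFinM.
    rewrite ge0_integralZl//; first by rewrite EFin_ex.
    by apply/measurable_EFinP; exact: L1_meas hf'.
  under eq_integral do rewrite e.
  rewrite ge0_integralZr//.
  - case/integrableP: iH => _ h; apply: lte_mul_pinfty => //.
    + exact: integral_ge0.
    + by rewrite ge0_fin_numE//; exact: integral_ge0.
    + exact: ltry.
  - by apply: measurableT_comp => //; exact/measurable_EFinP.
  - by rewrite lee_fin Rintegral_ge0.
have L : L1 P (fun w => H w * f (Y w)).
  exact: (proj1 (@integrable_law _ _ _ _ _ P _ _ mTh hlaw _ mpsi) ipsi).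
split => //; rewrite (indep_ex mpsi L).
rewrite /psi /=; under eq_Rintegral do rewrite exZ//.
have -> : \int[P]_w (H w * \int[N]_y f y) = \int[P]_w ((\int[N]_y f y) * H w).
  by apply: eq_Rintegral => w _; rewrite mulrC.
by rewrite exZ// mulrC.
Qed.

Lemma indep_comp (H X : Om -> R) (phi : R -> R) C : mg G H -> L1 P H -> mg G X ->
  measurable_fun setT phi -> (forall x, `|phi x| <= C) ->
  \int[P]_w (H w * phi (X w + Y w)) =
  \int[P]_w (H w * \int[N]_y phi (X w + y)).
Proof.
move=> gH hH gX mphi phiC.
pose psi (p : g_sigma_algebraType G * R) := H p.1 * phi (X p.1 + p.2).
have mXY : measurable_fun setT (fun p : g_sigma_algebraType G * R => X p.1 + p.2).
  by apply: measurable_funD => //; exact: (measurableT_comp gX).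
have mpsi : measurable_fun setT psi.
  apply: measurable_funM; first exact: (measurableT_comp gH).
  exact: (measurableT_comp mphi).
have mX : measurable_fun setT X by exact: (mg_meas G_meas gX).
have L : L1 P (fun w => psi (w, Y w)).
  rewrite /psi /=; under eq_fun do rewrite mulrC.
  apply: (@L1_mul_bounded _ _ _ _ _ _ C) => //.
  by apply: (measurableT_comp mphi); exact: measurable_funD.
rewrite (indep_ex mpsi L); apply: eq_Rintegral => w _.
rewrite /psi /= exZ//; apply: (@L1_bounded _ _ _ _ _ C) => //.
by apply: (measurableT_comp mphi); exact: measurable_funD.
Qed.

End independence.

(** * Markov property and immersion for the two Brownian motions *)

Section brownian.
Context {R : realType} {d} {Om : measurableType d} (P : probability Om R).
Variables (T : R) (F : R -> set (set Om)) (W W' : R -> Om -> R).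
Hypothesis hF : complete_filtration P T F.
Hypothesis hW : independent_brownian_motions P T F W W'.

Lemma filtration_sigma t : 0 <= t <= T -> sigma_algebra setT (F t).
Proof. by case: hF => h _ _ _; exact: h. Qed.

Lemma filtration_meas t : 0 <= t <= T -> F t `<=` measurable.
Proof. by case: hF => _ h _ _; exact: h. Qed.

Lemma filtration_mono s t : 0 <= s -> s <= t -> t <= T -> F s `<=` F t.
Proof. by case: hF => _ _ h _; exact: h. Qed.

Lemma filtrationT t : 0 <= t <= T -> F t setT.
Proof.
by move=> tT; have [h0 hC _] := filtration_sigma tT; rewrite -(setD0 setT); exact: hC.
Qed.

Lemma filtrationI t : 0 <= t <= T -> setI_closed (F t).
Proof.
move=> tT A B FA FB; have sF := sigma_algebra_id (filtration_sigma tT).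
by move: FA FB; rewrite -sF; exact: (@measurableI _ (g_sigma_algebraType (F t))).
Qed.

Lemma mg_filtration_mono s t (X : Om -> R) : 0 <= s -> s <= t -> t <= T ->
  mg (F s) X -> mg (F t) X.
Proof.
move=> s0 st tT; apply: mg_sub => A FA; apply: sub_sigma_algebra.
exact: filtration_mono FA.
Qed.

Lemma mg_W t : 0 <= t <= T -> mg (F t) (W t).
Proof.
move=> tT; apply/mgP; first exact: filtration_sigma.
by case: hW => [[h _] _ _ _]; exact: h.
Qed.

Lemma mg_W' t : 0 <= t <= T -> mg (F t) (W' t).
Proof.
move=> tT; apply/mgP; first exact: filtration_sigma.
by case: hW => [[_ h] _ _ _]; exact: h.
Qed.

Lemma meas_F t (X : Om -> R) : 0 <= t <= T -> mg (F t) X -> measurable_fun setT X.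
Proof. by move=> tT; apply: mg_meas; exact: filtration_meas. Qed.

Section increment.
Variables (s t : R).
Hypotheses (s0 : 0 <= s) (st : s < t) (tT : t <= T).
Let sT : 0 <= s <= T. Proof. by rewrite s0 (le_trans (ltW st)). Qed.
Let t0T : 0 <= t <= T. Proof. by rewrite tT (le_trans s0)// ltW. Qed.
Local Notation N := (normal_law (Num.sqrt (t - s))).
Let sd0 : 0 < Num.sqrt (t - s). Proof. by rewrite sqrtr_gt0 subr_gt0. Qed.

Let dW w := W t w - W s w.
Let dW' w := W' t w - W' s w.

Let mdW : measurable_fun setT dW.
Proof.
by apply: measurable_funB; [exact: meas_F (mg_W _)|exact: meas_F (mg_W _)].
Qed.

Let mdW' : measurable_fun setT dW'.
Proof.
by apply: measurable_funB; [exact: meas_F (mg_W' _)|exact: meas_F (mg_W' _)].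
Qed.

Let mpre (f : Om -> R) (A : set R) : measurable_fun setT f -> measurable A -> measurable (f @^-1` A).
Proof. by move=> mf mA; rewrite -[X in measurable X]setTI; exact: mf. Qed.

Let joint E A A' : F s E -> measurable A -> measurable A' ->
  P (E `&` dW @^-1` A `&` dW' @^-1` A') = (P E * N A * N A')%E.
Proof.
move=> FE mA mA'; case: hW => _ _ _ /(_ s t s0 st tT E A A' FE mA mA').
move=> h; apply: (etrans h).
by congr (_ * _ * _)%E; exact/esym/normal_lawE.
Qed.

Lemma indep_W E A : F s E -> measurable A -> P (E `&` dW @^-1` A) = (P E * N A)%E.
Proof.
move=> FE mA; have := joint FE mA measurableT.
by rewrite preimage_setT setIT probability_setT mule1.
Qed.

Lemma indep_W' E A : F s E -> measurable A -> P (E `&` dW' @^-1` A) = (P E * N A)%E.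
Proof.
move=> FE mA; have := joint FE measurableT mA.
by rewrite preimage_setT setIT probability_setT mule1.
Qed.

(** A pi-system generating the information of [F s] together with the increment of [W]. The common
    increment is independent of both at once, so that [W t] may be revealed. *)
Definition with_increment : set (set Om) :=
  [set B | exists2 E, F s E & exists2 A : set R, measurable A & B = E `&` dW @^-1` A].

Lemma indep_W'2 E A : with_increment E -> measurable A ->
  P (E `&` dW' @^-1` A) = (P E * N A)%E.
Proof.
move=> [E' FE' [B mB ->]] mA; rewrite joint//.
by congr (_ * _)%E; apply/esym; exact: indep_W.
Qed.

Lemma with_increment_meas : with_increment `<=` measurable.
Proof.
move=> _ [E FE [A mA ->]]; apply: measurableI; last exact: mpre.
exact: (filtration_meas sT).
Qed.

Lemma with_incrementI : setI_closed with_increment.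
Proof.
move=> _ _ [E FE [A mA ->]] [E' FE' [A' mA' ->]].
exists (E `&` E'); first exact: filtrationI.
by exists (A `&` A'); [exact: measurableI|rewrite preimage_setI setIACA].
Qed.

Lemma with_incrementT : with_increment setT.
Proof.
exists setT; first exact: filtrationT.
by exists setT => //; rewrite preimage_setT setIT.
Qed.

Lemma mg_with_increment (X : Om -> R) : mg (F s) X -> mg with_increment X.
Proof.
apply: mg_sub => A FA; apply: sub_sigma_algebra.
by exists A => //; exists setT => //; rewrite preimage_setT setIT.
Qed.

Lemma mg_with_increment_W : mg with_increment (W t).
Proof.
have -> : W t = (fun w => W s w + dW w) by apply/funext => w; rewrite /dW addrC subrK.
apply: measurable_funD; first by apply: mg_with_increment; exact: mg_W.
move=> _ B mB; rewrite setTI; apply: sub_sigma_algebra.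
by exists setT; [exact: filtrationT|exists B => //; rewrite setTI].
Qed.

Lemma increment_mul H : mg (F s) H -> L1 P H ->
  L1 P (fun w => H w * (W t w - W s w)) /\ \int[P]_w (H w * (W t w - W s w)) = 0.
Proof.
move=> gH hH.
have [h1 h2] := indep_mul (filtration_meas sT) (filtrationI sT) (filtrationT sT)
  mdW indep_W gH hH (L2_L1 (L2_normal_law sd0)).
by split => //; rewrite h2 normal_law_mean// mulr0.
Qed.

Lemma increment'_mul H : mg (F s) H -> L1 P H ->
  L1 P (fun w => H w * (W' t w - W' s w)) /\ \int[P]_w (H w * (W' t w - W' s w)) = 0.
Proof.
move=> gH hH.
have [h1 h2] := indep_mul (filtration_meas sT) (filtrationI sT) (filtrationT sT)
  mdW' indep_W' gH hH (L2_L1 (L2_normal_law sd0)).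
by split => //; rewrite h2 normal_law_mean// mulr0.
Qed.

Lemma L2_increment : L2 P (fun w => W t w - W s w).
Proof.
apply/L2P; split => //.
have [h1 _] := indep_mul (filtration_meas sT) (filtrationI sT) (filtrationT sT)
  mdW indep_W (@measurable_cst _ _ (g_sigma_algebraType (F s)) R setT 1) (L1_cst P 1)
  (L2_sq (L2_normal_law sd0)).
by move: h1; under eq_fun do rewrite mul1r.
Qed.

Lemma L2_increment' : L2 P (fun w => W' t w - W' s w).
Proof.
apply/L2P; split => //.
have [h1 _] := indep_mul (filtration_meas sT) (filtrationI sT) (filtrationT sT)
  mdW' indep_W' (@measurable_cst _ _ (g_sigma_algebraType (F s)) R setT 1) (L1_cst P 1)
  (L2_sq (L2_normal_law sd0)).
by move: h1; under eq_fun do rewrite mul1r.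
Qed.

Lemma increment'_var_gt0 : 0 < \int[P]_w ((W' t w - W' s w) ^+ 2).
Proof.
have [_ h2] := indep_mul (filtration_meas sT) (filtrationI sT) (filtrationT sT)
  mdW' indep_W' (@measurable_cst _ _ (g_sigma_algebraType (F s)) R setT 1) (L1_cst P 1)
  (L2_sq (L2_normal_law sd0)).
move: h2; under eq_Rintegral do rewrite mul1r.
by move=> ->; rewrite ex_cst mul1r; exact: normal_law_var_gt0.
Qed.

(** The function [kappa] is the heat semigroup applied to [phi]: the Markov property of [W] holds
    relative to all of [F], because the increment is independent of [F s]. *)
Lemma markov_W (phi : R -> R) : measurable_fun setT phi ->
  (forall x, `|phi x| <= 1) ->
  exists kappa : R -> R, [/\ measurable_fun setT kappa,
    forall x, `|kappa x| <= 1 &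
    forall H, mg (F s) H -> L1 P H ->
      \int[P]_w (H w * phi (W t w)) = \int[P]_w (H w * kappa (W s w))].
Proof.
move=> mphi phi1.
have mphi' (x : R) : measurable_fun setT (fun y => phi (x + y)).
  by apply: (measurableT_comp mphi); exact: measurable_funD.
have L (x : R) : L1 N (fun y => phi (x + y)) by apply: (@L1_bounded _ _ _ _ _ 1).
exists (fun x => \int[N]_y phi (x + y)); split.
- have i2 : (N \x N)%E.-integrable setT (EFin \o (fun p : R * R => phi (p.1 + p.2))).
    apply: (@L1_bounded _ _ _ (N \x N)%E _ 1) => //.
    by apply: (measurableT_comp mphi); exact: measurable_funD.
  by apply: measurableT_comp => //; exact: (measurable_fubini_F i2).
- move=> x; apply: le_trans (le_normr_Rintegral _ (L x)) _ => //.
  rewrite -[leRHS](ex_cst N); apply: ex_le => //; last exact: L1_cst.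
  by apply: (@L1_bounded _ _ _ _ _ 1) => [|y]; [exact: measurableT_comp|rewrite normr_id].
- move=> H gH hH.
  rewrite -(indep_comp (filtration_meas sT) (filtrationI sT) (filtrationT sT)
    mdW indep_W gH hH (mg_W sT) mphi phi1).
  by apply: eq_Rintegral => w _; rewrite /dW [W s w + _]addrC subrK.
Qed.

(** The common increment has mean zero given [F s] and [W t] together. *)
Lemma markov_increment' (phi : R -> R) H : measurable_fun setT phi ->
  (forall x, `|phi x| <= 1) -> mg (F s) H -> L1 P H ->
  \int[P]_w (H w * (W' t w - W' s w) * phi (W t w)) = 0.
Proof.
move=> mphi phi1 gH hH.
have gphi : mg with_increment (fun w => phi (W t w)).
  by apply: (measurableT_comp mphi); exact: mg_with_increment_W.
have gHphi : mg with_increment (fun w => phi (W t w) * H w).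
  by apply: measurable_funM => //; exact: mg_with_increment.
have hHphi : L1 P (fun w => phi (W t w) * H w).
  by apply: (@L1_mul_bounded _ _ _ _ _ _ 1) => //; exact: (mg_meas with_increment_meas).
have [_] := indep_mul with_increment_meas with_incrementI with_incrementT
  mdW' indep_W'2 gHphi hHphi (L2_L1 (L2_normal_law sd0)).
rewrite normal_law_mean// mulr0 => <-.
by apply: eq_Rintegral => w _; rewrite /dW' mulrC mulrA.
Qed.

End increment.

(** The times are ordered so that the Markov property can be applied backwards from the last one. *)
Fixpoint chain (t : R) (l : seq (R * (R -> R))) : Prop :=
  if l is p :: l' then
    [/\ t <= p.1, p.1 <= T, measurable_fun setT p.2,
        forall x, `|p.2 x| <= 1 & chain p.1 l']
  else True.

Definition cyl (l : seq (R * (R -> R))) (w : Om) : R :=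
  \prod_(p <- l) p.2 (W p.1 w).

(** Immersion: successive conditioning from the last time backwards collapses a future cylinder of
    [W] to a function of [W t]. *)
Lemma chain_immersion l t : 0 <= t <= T -> chain t l ->
  exists psi : R -> R, [/\ measurable_fun setT psi, forall x, `|psi x| <= 1 &
    forall H, mg (F t) H -> L1 P H ->
      \int[P]_w (H w * cyl l w) = \int[P]_w (H w * psi (W t w))].
Proof.
elim: l t => [|[s phi] l IH] t tT /=.
  move=> _; exists (fun=> 1); split => //; first by move=> x; rewrite normr1.
  by move=> H _ _; apply: eq_Rintegral => w _; rewrite /cyl big_nil.
move=> [ts sT mphi phi1 hl].
have [t0 _] := andP tT.
have s0T : 0 <= s <= T by rewrite sT (le_trans t0).
have [psi [mpsi psi1 hpsi]] := IH s s0T hl.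
have mpp : measurable_fun setT (fun x => phi x * psi x) by exact: measurable_funM.
have pp1 x : `|phi x * psi x| <= 1.
  by rewrite normrM -[leRHS]mulr1 ler_pM.
have step H : mg (F t) H -> L1 P H ->
    \int[P]_w (H w * cyl ((s, phi) :: l) w) =
    \int[P]_w (H w * (phi (W s w) * psi (W s w))).
  move=> gH hH.
  have gphi : mg (F s) (fun w => phi (W s w)).
    by apply: (measurableT_comp mphi); exact: mg_W.
  transitivity (\int[P]_w ((phi (W s w) * H w) * cyl l w)).
    apply: eq_Rintegral => w _; rewrite /cyl big_cons /=.
    by rewrite mulrCA mulrA.
  rewrite hpsi.
  - by apply: eq_Rintegral => w _; rewrite mulrAC mulrC.
  - apply: measurable_funM => //; apply: mg_filtration_mono gH => //.
  - apply: (@L1_mul_bounded _ _ _ _ _ _ 1) => //; exact: (meas_F s0T).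
move: ts; rewrite le_eqVlt => /orP[/eqP ts|ts].
  (* If the first time is [t] itself, nothing remains to be integrated out. *)
  by exists (fun x => phi x * psi x); split => // H gH hH; rewrite step// ts.
have [k [mk k1 hk]] := markov_W t0 ts sT mpp pp1.
by exists k; split => // H gH hH; rewrite step// hk.
Qed.

Lemma cyl_bounded l t : 0 <= t -> chain t l ->
  measurable_fun setT (cyl l) /\ forall w, `|cyl l w| <= 1.
Proof.
elim: l t => [|[s phi] l IH] t t0 /=.
  move=> _; split; first by rewrite /cyl; under eq_fun do rewrite big_nil; exact: measurable_cst.
  by move=> w; rewrite /cyl big_nil normr1.
move=> [ts sT mphi phi1 hl].
have s0 : 0 <= s by rewrite (le_trans t0).
have [h1 h2] := IH s s0 hl; split.
  rewrite /cyl; under eq_fun do rewrite big_cons.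
  apply: measurable_funM => //; apply: (measurableT_comp mphi).
  by apply: (meas_F _ (mg_W _)); rewrite s0.
by move=> w; rewrite /cyl big_cons normrM -[leRHS]mulr1 ler_pM//; exact: h2.
Qed.

Lemma chain_increment'_at l r a (chi : R -> R) H : 0 <= r -> r <= a -> a <= T ->
  measurable_fun setT chi -> (forall x, `|chi x| <= 1) -> chain a l ->
  mg (F r) H -> L1 P H ->
  \int[P]_w (H w * (W' a w - W' r w) * chi (W a w) * cyl l w) = 0.
Proof.
move=> r0 + aT mchi chi1 hl gH hH; rewrite le_eqVlt => /orP[/eqP ->|ra].
  rewrite -[RHS](ex_cst P); apply: eq_Rintegral => w _.
  by rewrite subrr mulr0 !mul0r.
have a0T : 0 <= a <= T by rewrite aT (le_trans r0)// ltW.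
have r0T : 0 <= r <= T by rewrite r0 (le_trans (ltW ra)).
have [psi [mpsi psi1 hpsi]] := chain_immersion a0T hl.
have gchi : mg (F a) (fun w => chi (W a w)).
  by apply: (measurableT_comp mchi); exact: mg_W.
have [LH _] := increment'_mul r0 ra aT gH hH.
transitivity (\int[P]_w (chi (W a w) * (H w * (W' a w - W' r w)) * cyl l w)).
  by apply: eq_Rintegral => w _; congr (_ * _); rewrite mulrC.
rewrite hpsi; last 2 first.
- apply: measurable_funM => //; apply: measurable_funM.
    by apply: mg_filtration_mono gH => //; exact: ltW.
  apply: measurable_funB; first exact: mg_W'.
  by apply: (@mg_filtration_mono r) => //; [exact: ltW|exact: mg_W'].
- by apply: (@L1_mul_bounded _ _ _ _ _ _ 1) => //; exact: (meas_F a0T gchi).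
rewrite -[RHS](@markov_increment' _ _ r0 ra aT (fun x => chi x * psi x) H)//.
- by apply: eq_Rintegral => w _; ring.
- exact: measurable_funM.
- by move=> x; rewrite normrM -[leRHS]mulr1 ler_pM.
Qed.

Lemma L1_increment' r a H : 0 <= r -> r <= a -> a <= T -> mg (F r) H -> L1 P H ->
  L1 P (fun w => H w * (W' a w - W' r w)).
Proof.
move=> r0 + aT gH hH; rewrite le_eqVlt => /orP[/eqP ->|ra].
  by under eq_fun do rewrite subrr mulr0; exact: L1_cst.
by have [] := increment'_mul r0 ra aT gH hH.
Qed.

(** The increment is split at the first time s of the list. The part after s is covered by
    induction, with phi(W s) absorbed into [H]; the part before s by [chain_increment'_at]. If s
    lies after r', the latter suffices. *)
Lemma chain_increment' l r r' H : 0 <= r -> r <= r' -> r' <= T -> chain r l ->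
  mg (F r) H -> L1 P H -> \int[P]_w (H w * (W' r' w - W' r w) * cyl l w) = 0.
Proof.
have one1 (x : R) : `|(fun=> 1 : R) x| <= 1 by rewrite normr1.
have at1 l0 r0 a G : 0 <= r0 -> r0 <= a -> a <= T -> chain a l0 -> mg (F r0) G ->
    L1 P G -> \int[P]_w (G w * (W' a w - W' r0 w) * cyl l0 w) = 0.
  move=> h1 h2 h3 h4 h5 h6.
  have := chain_increment'_at h1 h2 h3 (@measurable_cst _ _ R R setT 1) one1 h4 h5 h6.
  by under eq_Rintegral do rewrite mulr1.
elim: l r H => [|[s phi] l IH] r H r0 rr' r'T; first by move=> _; exact: at1.
move=> hsl gH hH; have [/= rs sT mphi phi1 hl] := hsl.
have s0 : 0 <= s by rewrite (le_trans r0).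
have s0T : 0 <= s <= T by rewrite s0.
have r0T : 0 <= r <= T by rewrite r0 (le_trans rr').
have r'0T : 0 <= r' <= T by rewrite r'T (le_trans r0).
have [sr'|r's] := leP s r'; last by apply: at1 => //=; split => //; exact: ltW.
have gphi : mg (F s) (fun w => phi (W s w)).
  by apply: (measurableT_comp mphi); exact: mg_W.
have mphiW := meas_F s0T gphi.
have gHs : mg (F s) H by exact: mg_filtration_mono gH.
have [mcyl cyl1] := cyl_bounded s0 hl.
have gH1 : mg (F s) (fun w => phi (W s w) * H w) by exact: measurable_funM.
have LH1 : L1 P (fun w => phi (W s w) * H w).
  exact: (@L1_mul_bounded _ _ _ _ _ _ 1).
have bnd f : L1 P f -> L1 P (fun w => f w * cyl l w).
  by move=> hf; under eq_fun do rewrite mulrC; exact: (@L1_mul_bounded _ _ _ _ _ _ 1).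
have L2' : L1 P (fun w => H w * (W' s w - W' r w) * phi (W s w)).
  under eq_fun do rewrite mulrC; apply: (@L1_mul_bounded _ _ _ _ _ _ 1) => //.
  exact: L1_increment'.
have e1 := IH s _ s0 sr' r'T hl gH1 LH1.
have e2 := chain_increment'_at r0 rs sT mphi phi1 hl gH hH.
rewrite -[RHS]addr0 -{1}e1 -e2.
rewrite -exD.
- apply: eq_Rintegral => w _; rewrite /cyl big_cons /= -/(cyl l w).
  by ring.
- by apply: bnd; exact: L1_increment'.
- exact: bnd.
Qed.

End brownian.

(** * Conditional expectation as orthogonal projection *)

Section zero_integrals.
Context {R : realType} {d} {Om : measurableType d} (P : probability Om R).

Lemma ex_indic_mul (A : set Om) (f : Om -> R) :
  \int[P]_w (\1_A w * f w) = \int[P]_(w in A) f w.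
Proof.
rewrite [RHS]Rintegral_mkcond; apply: eq_Rintegral => w _.
by rewrite patchE indicE; case: ifPn => _; rewrite ?mul1r ?mul0r.
Qed.

Lemma L1_indic_mul (A : set Om) (f : Om -> R) : measurable A -> L1 P f ->
  L1 P (fun w => \1_A w * f w).
Proof.
move=> mA; apply: (@L1_mul_bounded _ _ _ _ _ _ 1); first exact: measurable_indic.
by move=> w; rewrite indicE; case: (_ \in _); rewrite ?normr1 ?normr0.
Qed.

(** The sets on which [f] integrates to zero form a Dynkin class. *)
Lemma zero_integral_sigma (C : set (set Om)) (f : Om -> R) :
  C `<=` measurable -> setI_closed C -> C setT -> L1 P f ->
  (forall A, C A -> \int[P]_w (\1_A w * f w) = 0) ->
  forall A, <<s C >> A -> \int[P]_w (\1_A w * f w) = 0.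
Proof.
move=> Cm CI CT hf h0.
have sC : <<s C >> `<=` measurable.
  by apply: smallest_sub => //; exact: sigma_algebra_measurable.
apply: (@dynkin_induction _ (g_sigma_algebraType C) C) => //; first exact: h0.
- move=> A CA IA; have mA := sC A CA.
  have e w : \1_(~` A) w * f w = 1 * f w - \1_A w * f w.
    rewrite !indicE in_setC; case: (_ \in _) => /=; ring.
  under eq_Rintegral do rewrite e.
  rewrite exB ?IA ?subr0//; last exact: L1_indic_mul.
    rewrite -[RHS](h0 _ CT); apply: eq_Rintegral => w _.
    by rewrite indicE in_setT.
  by under eq_fun do rewrite mul1r.
- move=> A mA tA IA; rewrite ex_indic_mul /Rintegral integral_bigcup//.
  + rewrite eseries0// => n _ _; have := IA n.
    rewrite ex_indic_mul /Rintegral => e0; rewrite -[LHS]fineK ?e0//.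
    apply: integrable_fin_num => //; first exact: sC (mA n).
    by apply: integrableS hf => //; exact: sC (mA n).
  + by move=> n; exact: sC (mA n).
  + apply: integrableS hf => //; apply: bigcupT_measurable => n; exact: sC (mA n).
Qed.

Lemma L1_nondecreasing (f_ : nat -> Om -> R) (f : Om -> R) (C : R) :
  (forall n, L1 P (f_ n)) -> (forall n w, 0 <= f_ n w) -> measurable_fun setT f ->
  (forall w m n, (m <= n)%N -> f_ m w <= f_ n w) ->
  (forall w, f_ n w @[n --> \oo] --> f w) ->
  (forall n, \int[P]_w f_ n w <= C) -> L1 P f.
Proof.
move=> hf_ f0 mf nd cv hC.
have fge w : 0 <= f w.
  rewrite -(cvg_lim _ (cv w))//; apply: limr_ge; first by apply/cvg_ex; exists (f w).
  exact: nearW.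
apply/integrableP; split; first exact/measurable_EFinP.
have mf_ n : measurable_fun setT (EFin \o f_ n) by apply/measurable_EFinP; exact: L1_meas.
have -> : (\int[P]_w `|(EFin \o f) w| = \int[P]_w (limn (fun n => (f_ n w)%:E)))%E.
  apply: eq_integral => w _; rewrite /= ger0_norm//; apply/esym/cvg_lim => //.
  by apply: cvg_EFin; [exact: nearW|exact: cv].
rewrite (monotone_convergence P measurableT mf_)//; last 2 first.
- by move=> n w _; rewrite lee_fin.
- by move=> w _ a b ab; rewrite lee_fin; exact: nd.
apply: (@le_lt_trans _ _ C%:E); last exact: ltry.
apply: lime_le; last by apply: nearW => n; rewrite -EFin_ex// lee_fin.
apply: ereal_nondecreasing_is_cvgn => a b ab.
by rewrite -!EFin_ex// lee_fin; apply: ex_le => // w; exact: nd.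
Qed.

Section orthogonality.
Context {d'} {E : measurableType d'} (theta : Om -> E).
Hypothesis mtheta : measurable_fun setT theta.
Variable f : Om -> R.
Hypothesis hf : L1 P f.
Hypothesis f0 : forall A, measurable A -> \int[P]_w (\1_A (theta w) * f w) = 0.

Import HBNNSimple.

Let orth_ge0 (eta : E -> R) : measurable_fun setT eta -> (forall y, 0 <= eta y) ->
  L1 P (fun w => f w * eta (theta w)) -> \int[P]_w (f w * eta (theta w)) = 0.
Proof.
move=> meta eta0 hfe.
have mE : measurable_fun setT (EFin \o eta) by exact/measurable_EFinP.
pose h n : E -> R := nnsfun_approx measurableT mE n.
have cv y : h n y @[n --> \oo] --> eta y.
  have := @cvg_nnsfun_approx _ _ _ _ measurableT _ mE _ y I.
  move=> /(_ (fun x _ => eta0 x : (0 <= (EFin \o eta) x)%E)).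
  by move/fine_cvgP => [].
have hle n y : h n y <= eta y.
  rewrite -(cvg_lim _ (cv y))//; apply: nondecreasing_cvgn_le.
    by move=> a b ab; exact/lefP/nd_nnsfun_approx.
  by apply/cvg_ex; exists (eta y).
have mth (A : set E) : measurable A -> measurable (theta @^-1` A).
  by move=> mA; rewrite -[X in measurable X]setTI; exact: mtheta.
have z n : \int[P]_w (f w * h n (theta w)) = 0.
  pose r : seq R := finmap.enum_fset (fset_set (range (h n))).
  have e w : f w * h n (theta w) =
      \sum_(k <- r) k * (\1_(h n @^-1` [set k]) (theta w) * f w).
    rewrite {1}/h fimfunE fsbig_finite//= mulr_sumr; apply: eq_bigr => k _.
    by rewrite mulrCA [f w * _]mulrC.
  under eq_Rintegral do rewrite e.
  have L k : L1 P (fun w => \1_(h n @^-1` [set k]) (theta w) * f w).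
    by apply: (@L1_indic_mul (theta @^-1` (h n @^-1` [set k]))) => //; exact: mth.
  rewrite ex_sum; last by move=> k; exact: L1Z.
  by rewrite big1// => k _; rewrite exZ// f0 ?mulr0.
have := @ex_dct _ _ _ P (fun n w => f w * h n (theta w))
  (fun w => f w * eta (theta w)) (fun w => `|f w * eta (theta w)|).
under [X in X @ _ --> _]eq_fun do rewrite z.
move=> cv0; apply/esym; apply: (cvg_unique _ _ (cv0 _ _ _ _ _)) => //.
- exact: cvg_cst.
- move=> n; apply: measurable_funM; first exact: L1_meas hf.
  exact: measurableT_comp.
- exact: L1_meas hfe.
- apply: (L1_le _ hfe) => [|w]; last by rewrite normr_id.
  by apply: measurableT_comp => //; exact: L1_meas hfe.
- move=> n w; rewrite !normrM ler_wpM2l// ger0_norm ?fun_ge0//.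
  by rewrite ger0_norm.
- by apply: aeW => w; apply: cvgM; [exact: cvg_cst|exact: cv].
Qed.

Lemma orth_measurable (eta : E -> R) : measurable_fun setT eta ->
  L1 P (fun w => f w * eta (theta w)) -> \int[P]_w (f w * eta (theta w)) = 0.
Proof.
move=> meta hfe.
have mp : measurable_fun setT (fun y => Num.max (eta y) 0) by exact: measurable_maxr.
have mn : measurable_fun setT (fun y => Num.max (- eta y) 0).
  by apply: measurable_maxr => //; exact: measurableT_comp.
have mf := L1_meas hf.
have L1p : L1 P (fun w => f w * Num.max (eta (theta w)) 0).
  apply: (L1_le _ hfe) => [|w].
    by apply: measurable_funM => //; exact: (measurableT_comp mp).
  rewrite !normrM ler_wpM2l// ger0_norm ?le_max ?lexx ?orbT//.
  by rewrite ge_max normr_ge0 ler_norm.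
have L1n : L1 P (fun w => f w * Num.max (- eta (theta w)) 0).
  apply: (L1_le _ hfe) => [|w].
    by apply: measurable_funM => //; exact: (measurableT_comp mn).
  rewrite !normrM ler_wpM2l// ger0_norm ?le_max ?lexx ?orbT//.
  by rewrite ge_max normr_ge0 -normrN ler_norm.
transitivity (\int[P]_w (f w * Num.max (eta (theta w)) 0 -
    f w * Num.max (- eta (theta w)) 0)).
  apply: eq_Rintegral => w _; rewrite -mulrBr; congr (_ * _).
  have [x0|x0] := leP 0 (eta (theta w)).
    by rewrite (max_idPr _) ?oppr_le0// subr0.
  by rewrite (max_idPl _) ?oppr_ge0 1?ltW// sub0r opprK.
rewrite exB// (orth_ge0 mp)// ?(orth_ge0 mn)// ?subrr// => y;
  by rewrite le_max lexx orbT.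
Qed.

End orthogonality.

(** * Conditional expectation given a measurable map *)

Section conditional_expectation.
Context {d'} {E : measurableType d'} (theta : Om -> E).
Hypothesis mtheta : measurable_fun setT theta.

Let mth (A : set E) : measurable A -> measurable (theta @^-1` A).
Proof. by move=> mA; rewrite -[X in measurable X]setTI; exact: mtheta. Qed.

(** The Radon-Nikodym derivative is taken on [E], of the image under [theta] of the charge z dP, so
    that the conditional expectation comes directly as a function of [theta]. *)
Lemma cond_exp_L1 (z : Om -> R) : L1 P z -> exists psi : E -> R,
  [/\ measurable_fun setT psi, L1 P (fun w => psi (theta w)) &
   forall A, measurable A -> \int[P]_w (\1_A (theta w) * z w) =
     \int[P]_w (\1_A (theta w) * psi (theta w))].
Proof.
move=> hz.
have [mu hmu] := exists_law P mtheta.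
pose nu0 := pushforward (induced_charge hz) theta : {charge set E -> \bar R}.
pose nu : {charge set E -> \bar R} := nu0 mtheta.
have numu : nu `<< mu.
  apply/null_content_dominatesP => A mA muA.
  apply: null_set_integral; first exact: mth.
    by apply/measurable_EFinP; apply: measurable_funTS; exact: L1_meas hz.
  by rewrite -[RHS]muA; exact: hmu.
have RNf x := Radon_Nikodym_fin_num x numu.
have RNi := Radon_Nikodym_integrable numu.
pose psi y := fine (Radon_Nikodym nu mu y).
have psiE y : (psi y)%:E = Radon_Nikodym nu mu y by rewrite fineK.
have mpsi : measurable_fun setT psi.
  by apply: measurableT_comp => //; exact: (measurable_int mu).
have ipsi : mu.-integrable setT (EFin \o psi).
  by apply: eq_integrable RNi => // y _; rewrite /= psiE.
exists psi; split => //; first exact: (proj1 (integrable_law mtheta hmu mpsi)).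
move=> A mA.
rewrite (ex_indic_mul (theta @^-1` A) z).
have -> : \int[P]_w (\1_A (theta w) * psi (theta w)) = \int[mu]_y (\1_A y * psi y).
  rewrite (ex_law mtheta hmu (f := fun y => \1_A y * psi y))//.
  exact: measurable_funM.
have -> : \int[mu]_y (\1_A y * psi y) = \int[mu]_(y in A) psi y.
  rewrite [RHS]Rintegral_mkcond; apply: eq_Rintegral => w _.
  by rewrite patchE indicE; case: ifPn => _; rewrite ?mul1r ?mul0r.
rewrite /Rintegral; congr fine.
transitivity (nu A); first by [].
rewrite (Radon_Nikodym_integral numu mA).
by apply: eq_integral => y _; rewrite psiE.
Qed.

(** Square integrability of the L1 version: a truncation tested against [z] returns its own square,
    so Cauchy-Schwarz bounds all truncations by the norm of [z]. *)
Lemma cond_exp_L2 (z : Om -> R) : L2 P z -> exists psi : E -> R,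
  [/\ measurable_fun setT psi, L2 P (fun w => psi (theta w)) &
   forall eta : E -> R, measurable_fun setT eta -> L2 P (fun w => eta (theta w)) ->
     \int[P]_w (z w * eta (theta w)) =
     \int[P]_w (psi (theta w) * eta (theta w))].
Proof.
move=> hz.
have [psi [mpsi hpsi hA]] := cond_exp_L1 (L2_L1 hz).
have hD : L1 P (fun w => z w - psi (theta w)) by apply: L1B => //; exact: L2_L1.
have D0 A : measurable A -> \int[P]_w (\1_A (theta w) * (z w - psi (theta w))) = 0.
  move=> mA; under eq_Rintegral do rewrite mulrBr.
  rewrite exB ?hA ?subrr//.
    by apply: (@L1_indic_mul (theta @^-1` A)); [exact: mth|exact: L2_L1].
  by apply: (@L1_indic_mul (theta @^-1` A)); [exact: mth|].
have mpT : measurable_fun setT (fun w => psi (theta w)) by exact: measurableT_comp.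
pose B n : set E := [set y | `|psi y| <= n%:R].
have mB n : measurable (B n).
  rewrite (_ : B n = (fun y => `|psi y|) @^-1` `]-oo, n%:R]%classic).
    rewrite -[X in measurable X]setTI.
    by apply: (measurableT_comp (@normr_measurable R setT) mpsi) => //.
  by apply/seteqP; split => y /=; rewrite /B /= in_itv.
pose trunc n y := \1_(B n) y * psi y.
have mtr n : measurable_fun setT (trunc n) by apply: measurable_funM.
have trb n y : `|trunc n y| <= n%:R.
  rewrite /trunc indicE; case: (boolP (y \in B n)) => [|_] /=; last by rewrite mul0r normr0.
  by rewrite inE mul1r.
have trL2 n : L2 P (fun w => trunc n (theta w)).
  apply: (@L2_bounded _ _ _ _ _ n%:R) => //; exact: measurableT_comp.
have tr2 n y : trunc n y * psi y = trunc n y ^+ 2.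
  rewrite /trunc indicE; case: (_ \in _) => /=; ring.
have bound n : \int[P]_w (trunc n (theta w) ^+ 2) <= \int[P]_w (z w ^+ 2).
  have Lz : L1 P (fun w => z w * trunc n (theta w)) by exact: L2_mul.
  have Lp : L1 P (fun w => psi (theta w) * trunc n (theta w)).
    apply: eq_integrable (L2_sq (trL2 n)) => // w _.
    by rewrite /= mulrC tr2.
  have e : \int[P]_w (z w * trunc n (theta w)) = \int[P]_w (trunc n (theta w) ^+ 2).
    apply/eqP; rewrite -subr_eq0; apply/eqP.
    rewrite -[RHS](@orth_measurable _ _ theta mtheta _ hD D0 (trunc n) (mtr n)).
      have -> : \int[P]_w (trunc n (theta w) ^+ 2) =
          \int[P]_w (psi (theta w) * trunc n (theta w)).
        by apply: eq_Rintegral => w _; rewrite [RHS]mulrC tr2.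
      rewrite -exB//; apply: eq_Rintegral => w _; ring.
    by under eq_fun do rewrite mulrBl; exact: L1B.
  have cs := cauchy_schwarz hz (trL2 n); rewrite e in cs.
  have a0 : 0 <= \int[P]_w (trunc n (theta w) ^+ 2) by apply: ex_ge0 => w; exact: sqr_ge0.
  have b0 : 0 <= \int[P]_w (z w ^+ 2) by apply: ex_ge0 => w; exact: sqr_ge0.
  move: a0; rewrite le_eqVlt => /orP[/eqP <-//|a0].
  by move: cs; rewrite expr2 mulrC ler_pM2r.
have hpsi2 : L2 P (fun w => psi (theta w)).
  apply/L2P; split => //.
  apply: (@L1_nondecreasing (fun n w => trunc n (theta w) ^+ 2) _ (\int[P]_w (z w ^+ 2))).
  - by move=> n; exact: L2_sq.
  - by move=> n w; exact: sqr_ge0.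
  - exact: measurable_funX.
  - move=> w m n mn; rewrite -!tr2 /trunc !indicE.
    case: (boolP (theta w \in B m)) => [|_]; last first.
      by rewrite !mul0r; case: (_ \in _); rewrite ?mul0r// mul1r -expr2 sqr_ge0.
    rewrite inE /B /= => h; rewrite mem_set//.
    by rewrite /= (le_trans h)// ler_nat.
  - move=> w; apply: cvg_near_cst; near=> n.
    rewrite /trunc indicE mem_set ?mul1r//.
    by near: n; exact: nbhs_infty_ger.
  - exact: bound.
exists psi; split => // eta meta heta.
apply/eqP; rewrite -subr_eq0 -exB; [|exact: L2_mul|exact: L2_mul].
rewrite -[X in _ == X](@orth_measurable _ _ theta mtheta _ hD D0 eta meta).
  by apply/eqP; apply: eq_Rintegral => w _; ring.
by apply: L2_mul => //; exact: L2B.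
Unshelve. all: end_near. Qed.

End conditional_expectation.

End zero_integrals.

(** * Products of probability spaces *)

Section ae_bounds.
Context {R : realType} {d} {Om : measurableType d} (P : probability Om R).

Lemma L1_le_ae (f g : Om -> R) : measurable_fun setT f -> L1 P g ->
  {ae P, forall w, `|f w| <= `|g w|} -> L1 P f.
Proof.
move=> mf hg fg; apply/integrableP; split; first exact/measurable_EFinP.
have /integrableP[mg ig] := hg; apply: le_lt_trans ig.
apply: ae_ge0_le_integral => //.
- by apply: measurableT_comp => //; exact/measurable_EFinP.
- exact: measurableT_comp.
- by apply: filterS fg => w h _; rewrite /= lee_fin.
Qed.

End ae_bounds.

Section product_space.
Context {R : realType} {d0} {Om0 : measurableType d0} {dt} {Omt : measurableType dt}.
Variables (P0 : probability Om0 R) (Pt : probability Omt R).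
Local Notation P := ((P0 \x Pt)%E : probability (Om0 * Omt)%type R).

Lemma law_fst A : measurable A -> P (fst @^-1` A) = P0 A.
Proof.
move=> mA; rewrite (_ : fst @^-1` A = A `*` setT); last first.
  by apply/seteqP; split => [w|w []].
apply: (etrans (product_measure1E P0 Pt mA measurableT)).
by rewrite -[RHS]mule1; congr (_ * _)%E; exact: probability_setT.
Qed.

Lemma law_snd A : measurable A -> P (snd @^-1` A) = Pt A.
Proof.
move=> mA; rewrite (_ : snd @^-1` A = setT `*` A); last first.
  by apply/seteqP; split => [w|w []].
apply: (etrans (product_measure1E P0 Pt measurableT mA)).
by rewrite -[RHS]mul1e; congr (_ * _)%E; exact: probability_setT.
Qed.

Lemma ae_fst (Q : Om0 -> Prop) : {ae P0, forall w, Q w} -> {ae P, forall w, Q w.1}.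
Proof.
move=> [N [mN N0 sub]]; exists (fst @^-1` N); split.
- by rewrite -[X in measurable X]setTI; exact: measurable_fst.
- by rewrite -[RHS]N0; exact: law_fst.
- by move=> w; exact: sub.
Qed.

Lemma ae_section (Q : Om0 * Omt -> Prop) : {ae P, forall w, Q w} ->
  {ae P0, forall w0, {ae Pt, forall wt, Q (w0, wt)}}.
Proof.
move=> [N [mN N0 sub]].
have mx : measurable_fun setT (Pt \o xsection N) by exact: measurable_fun_xsection.
have h : (\int[P0]_x (Pt \o xsection N) x = 0)%E by [].
have /(ae_eq_integral_abs P0 measurableT)[+ _] := mx.
case.
  by rewrite -[RHS]h; apply: eq_integral => x _; rewrite gee0_abs.
move=> M [mM M0 subM]; exists M; split => // w0 /= nQ; apply: subM => /= /(_ I) e.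
apply: nQ; exists (xsection N w0); split => //; first exact: measurable_xsection.
by move=> wt /= nq; apply/mem_set/sub.
Qed.

Lemma ex_prod (f : Om0 * Omt -> R) : L1 P f ->
  [/\ measurable_fun setT (fun w0 => \int[Pt]_wt f (w0, wt)),
      L1 P0 (fun w0 => \int[Pt]_wt f (w0, wt)) &
      \int[P]_w f w = \int[P0]_w0 \int[Pt]_wt f (w0, wt)].
Proof.
move=> hf; have i := hf : (P0 \x Pt)%E.-integrable setT (EFin \o f).
have mF := measurable_fubini_F i.
have m : measurable_fun setT (fun w0 => \int[Pt]_wt f (w0, wt)).
  exact: measurableT_comp.
have ae1 : {ae P0, forall w0, fubini_F Pt (EFin \o f) w0 = (\int[Pt]_wt f (w0, wt))%:E}.
  have := ae_integrable1 i; apply: filterS => w0 h.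
  by rewrite EFin_ex.
split => //.
  apply/integrableP; split; first exact/measurable_EFinP.
  have /integrableP[_] := integrable_fubini_F i.
  rewrite (@ae_eq_integral _ _ _ P0 setT (fun w0 => `|(\int[Pt]_wt f (w0, wt))%:E|)%E)//.
  - exact: measurableT_comp.
  - by apply: measurableT_comp => //; exact/measurable_EFinP.
  - by apply: filterS ae1 => w0 -> _.
rewrite /Rintegral -(integral12_prod_meas1 i); congr fine.
apply: ae_eq_integral => //; first exact/measurable_EFinP.
by apply: filterS ae1 => w0 -> _.
Qed.

Lemma L1_fst (f : Om0 -> R) : measurable_fun setT f ->
  L1 P0 f <-> L1 P (fun w => f w.1).
Proof. by move=> mf; exact: (integrable_law measurable_fst law_fst mf). Qed.

Lemma L1_snd (f : Omt -> R) : measurable_fun setT f ->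
  L1 Pt f <-> L1 P (fun w => f w.2).
Proof. by move=> mf; exact: (integrable_law measurable_snd law_snd mf). Qed.

Lemma ex_fst (f : Om0 -> R) : measurable_fun setT f ->
  \int[P]_w f w.1 = \int[P0]_w0 f w0.
Proof. by move=> mf; rewrite (ex_law measurable_fst law_fst mf). Qed.

Lemma ex_snd (f : Omt -> R) : measurable_fun setT f ->
  \int[P]_w f w.2 = \int[Pt]_wt f wt.
Proof. by move=> mf; rewrite (ex_law measurable_snd law_snd mf). Qed.

Lemma meas_fst (f : Om0 -> R) : measurable_fun setT f ->
  measurable_fun setT (fun w : Om0 * Omt => f w.1).
Proof. by move=> mf; exact: (measurableT_comp mf). Qed.

Lemma meas_snd (f : Omt -> R) : measurable_fun setT f ->
  measurable_fun setT (fun w : Om0 * Omt => f w.2).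
Proof. by move=> mf; exact: (measurableT_comp mf). Qed.

Lemma meas_fstV (f : Om0 -> R) :
  measurable_fun setT (fun w : Om0 * Omt => f w.1) -> measurable_fun setT f.
Proof.
by move=> mf; exact: (measurable_fun_pair1 (point : Omt) mf).
Qed.

Lemma meas_sndV (f : Omt -> R) :
  measurable_fun setT (fun w : Om0 * Omt => f w.2) -> measurable_fun setT f.
Proof.
by move=> mf; exact: (measurable_fun_pair2 (point : Om0) mf).
Qed.

Lemma meas_section (f : Om0 * Omt -> R) w0 : measurable_fun setT f ->
  measurable_fun setT (fun wt => f (w0, wt)).
Proof. by move=> mf; exact: measurable_fun_pair2. Qed.

Lemma L2_fst (f : Om0 -> R) : L2 P0 f <-> L2 P (fun w => f w.1).
Proof.
split=> /L2P[mf hf]; apply/L2P.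
  split; first exact: meas_fst.
  by apply/(@L1_fst (fun w => f w ^+ 2)) => //; exact: measurable_funX.
have mf' := meas_fstV mf; split => //.
by apply/(@L1_fst (fun w => f w ^+ 2)) => //; exact: measurable_funX.
Qed.

Lemma L2_snd (f : Omt -> R) : L2 Pt f <-> L2 P (fun w => f w.2).
Proof.
split=> /L2P[mf hf]; apply/L2P.
  split; first exact: meas_snd.
  by apply/(@L1_snd (fun w => f w ^+ 2)) => //; exact: measurable_funX.
have mf' := meas_sndV mf; split => //.
by apply/(@L1_snd (fun w => f w ^+ 2)) => //; exact: measurable_funX.
Qed.

Lemma L1_tensor (f : Om0 -> R) (e : Omt -> R) : L1 P0 f -> L1 Pt e ->
  L1 P (fun w => f w.1 * e w.2) /\
  \int[P]_w (f w.1 * e w.2) = (\int[P0]_w f w) * (\int[Pt]_w e w).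
Proof.
move=> hf he.
have mf := L1_meas hf; have me := L1_meas he.
have m : measurable_fun setT (fun w : Om0 * Omt => f w.1 * e w.2).
  by apply: measurable_funM; [exact: meas_fst|exact: meas_snd].
have he' : L1 Pt (fun y => `|e y|).
  apply: (L1_le _ he) => [|y]; last by rewrite normr_id.
  exact: measurableT_comp.
have L : L1 P (fun w => f w.1 * e w.2).
  apply/(integrable12ltyP); first exact/measurable_EFinP.
  have ee w : (\int[Pt]_y `|(f w * e y)%:E| =
      `|(f w)%:E| * (\int[Pt]_y `|e y|)%:E)%E.
    under eq_integral do rewrite /= normrM EFinM.
    rewrite ge0_integralZl//; first by rewrite EFin_ex.
    by apply/measurable_EFinP; exact: L1_meas he'.
  under eq_integral do rewrite ee.
  rewrite ge0_integralZr//.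
  - case/integrableP: hf => _ h; apply: lte_mul_pinfty => //.
    + exact: integral_ge0.
    + by rewrite ge0_fin_numE//; exact: integral_ge0.
    + exact: ltry.
  - by apply: measurableT_comp => //; exact/measurable_EFinP.
  - by rewrite lee_fin Rintegral_ge0.
split => //; have [_ _ ->] := ex_prod L => /=.
under eq_Rintegral do rewrite exZ// mulrC.
by rewrite exZ// mulrC.
Qed.

Lemma L2_tensor (f : Om0 -> R) (e : Omt -> R) : L2 P0 f -> L2 Pt e ->
  L2 P (fun w => f w.1 * e w.2).
Proof.
move=> hf he; apply/L2P; split.
  by apply: measurable_funM; [exact: meas_fst (L2_meas hf)|exact: meas_snd (L2_meas he)].
under eq_fun do rewrite exprMn.
by have [] := L1_tensor (L2_sq hf) (L2_sq he).
Qed.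

(** For a unit vector [e] of the common noise, this is the coefficient of [h] along [e], random in
    omega^0. *)
Definition partial_ip (h : Om0 * Omt -> R) (e : Omt -> R) (w0 : Om0) : R :=
  \int[Pt]_wt (h (w0, wt) * e wt).

Lemma L2_section h : L2 P h -> {ae P0, forall w0, L2 Pt (fun wt => h (w0, wt))}.
Proof.
move=> hh; have i := L2_sq hh : (P0 \x Pt)%E.-integrable setT (EFin \o (fun w => h w ^+ 2)).
have := ae_integrable1 i; apply: filterS => w0 h2.
by apply/L2P; split => //; apply: meas_section; exact: L2_meas hh.
Qed.

Lemma L2_partial_ip h e : L2 P h -> L2 Pt e -> L2 P0 (partial_ip h e).
Proof.
move=> hh he.
have he2 : L2 P (fun w => e w.2) by exact/L2_snd.
have [m1 _ _] := ex_prod (L2_mul hh he2).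
have [m2 l2 _] := ex_prod (L2_sq hh).
apply/L2P; split => //.
apply: (@L1_le_ae _ _ _ _ _
  (fun w0 => (\int[Pt]_wt (e wt ^+ 2)) * \int[Pt]_wt (h (w0, wt) ^+ 2))).
- exact: measurable_funX.
- exact: L1Z.
- have := L2_section hh; apply: filterS => w0 hw.
  rewrite ger0_norm ?sqr_ge0// ger0_norm; last first.
    by apply: mulr_ge0; apply: ex_ge0 => w; exact: sqr_ge0.
  by rewrite mulrC; exact: cauchy_schwarz.
Qed.

Lemma ex_partial_ip h e (eta : Om0 -> R) : L2 P h -> L2 Pt e -> L2 P0 eta ->
  \int[P]_w (h w * (eta w.1 * e w.2)) = \int[P0]_w (partial_ip h e w * eta w).
Proof.
move=> hh he heta.
have L := L2_mul hh (L2_tensor heta he).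
have [_ _ ->] := ex_prod L.
have m0 : measurable_fun setT (fun w0 => \int[Pt]_wt (h (w0, wt) * (eta w0 * e wt))).
  by have [] := ex_prod L.
apply: ex_ae => //.
  by apply: measurable_funM; [exact/L2_meas/L2_partial_ip|exact: L2_meas heta].
have := L2_section hh; apply: filterS => w0 hw.
rewrite /partial_ip [RHS]mulrC -exZ; last exact: L2_mul.
by apply: eq_Rintegral => wt _; rewrite mulrCA.
Qed.

End product_space.

(** * Idiosyncratic information and projections *)

Section information.
Context {R : realType} (T : R) {d0} {Om0 : measurableType d0}
  {dt} {Omt : measurableType dt}.
Variables (P0 : probability Om0 R) (Pt : probability Omt R).
Local Notation Om := (Om0 * Omt)%type.
Local Notation P := ((P0 \x Pt)%E : probability (Om0 * Omt)%type R).
Variables (F : R -> set (set Om)) (W : R -> Om0 -> R) (B : R -> Omt -> R).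
Variable xi0 : Om0 -> R.
Hypothesis T0 : (0 : R) <= T.
Hypothesis hF : complete_filtration P T F.
Local Notation iW := (fun t (w : Om) => W t w.1).
Local Notation iB := (fun t (w : Om) => B t w.2).
Hypothesis hW : independent_brownian_motions P T F iW iB.
Hypothesis xi_F0 : measurable_wrt (F 0) (fun w : Om => xi0 w.1).

Let T0T : 0 <= T <= T. Proof. by rewrite T0 lexx. Qed.
Let O0T : 0 <= (0 : R) <= T. Proof. by rewrite lexx. Qed.

(* F may be strictly larger than the filtration generated by the noises and
   [xi0], so the idiosyncratic information is measured by these cylinder sets of
   Om0 instead. *)
Definition cylinder (t : R) : set (set Om0) :=
  [set C | exists (n : nat) (tt : nat -> R) (AA : nat -> set R) (A0 : set R),
    [/\ measurable A0, forall i, (i < n)%N -> 0 <= tt i <= t /\ measurable (AA i) &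
      C = [set w | A0 (xi0 w) /\ forall i, (i < n)%N -> AA i (W (tt i) w)]]].

Lemma cylinderT t : cylinder t setT.
Proof.
exists 0%N, (fun=> 0), (fun=> setT), setT; split => //.
by apply/seteqP; split.
Qed.

Lemma cylinderI t : setI_closed (cylinder t).
Proof.
move=> _ _ [n [tt [AA [A0 [mA0 h ->]]]]] [n' [tt' [AA' [A0' [mA0' h' ->]]]]].
exists (n + n')%N, (fun i => if (i < n)%N then tt i else tt' (i - n)%N).
exists (fun i => if (i < n)%N then AA i else AA' (i - n)%N), (A0 `&` A0').
split; first exact: measurableI.
- move=> i iN; case: ifPn => [|ni]; first exact: h.
  by apply: h'; rewrite ltn_subLR// leqNgt.
- apply/seteqP; split => w /=.
    move=> [[h1 h2] [h3 h4]]; split => // i iN; case: ifPn => [|ni]; first exact: h2.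
    by apply: h4; rewrite ltn_subLR// leqNgt.
  move=> [[h1 h3] h2]; split; split => // i iN.
    by have := h2 i (ltn_addr _ iN); rewrite iN.
  have := h2 (n + i)%N; rewrite ltn_add2l => /(_ iN).
  by rewrite ltnNge leq_addr /= addKn.
Qed.

Lemma cylinder_mono s t : s <= t -> cylinder s `<=` cylinder t.
Proof.
move=> st _ [n [tt [AA [A0 [mA0 h ->]]]]]; exists n, tt, AA, A0; split => // i iN.
by have [/andP[-> h1] ?] := h i iN; rewrite (le_trans h1).
Qed.

Lemma cylinder_F t C : 0 <= t <= T -> cylinder t C -> F t (fst @^-1` C).
Proof.
move=> tT [n [tt [AA [A0 [mA0 h ->]]]]].
have [t0 tT'] := andP tT.
elim: n h => [|n IH] h.
  rewrite (_ : _ @^-1` _ = (fun w : Om => xi0 w.1) @^-1` A0); last first.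
    by apply/seteqP; split => w //= [].
  by apply: (filtration_mono hF (lexx 0) t0 tT'); exact: xi_F0.
rewrite (_ : _ @^-1` _ = fst @^-1` [set w | A0 (xi0 w) /\
    forall i, (i < n)%N -> AA i (W (tt i) w)] `&` (iW (tt n)) @^-1` (AA n)); last first.
  apply/seteqP; split => w /=.
    move=> [h1 h2]; split; last exact: h2.
    by split => // i ni; apply: h2; exact: ltnW.
  move=> [[h1 h2] h3]; split => // i; rewrite ltnS leq_eqVlt => /orP[/eqP ->//|].
  exact: h2.
apply: (filtrationI hF tT).
  by apply: IH => i ni; apply: h; exact: ltnW.
have [/andP[n0 nt] mA] := h n (ltnSn n).
apply: (filtration_mono hF n0 nt tT').
have n0T : 0 <= tt n <= T by rewrite n0 (le_trans nt).
by case: hW => [[aW _] _ _ _]; exact: aW.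
Qed.

Lemma sigma_cylinder_F t C : 0 <= t <= T -> <<s cylinder t >> C -> F t (fst @^-1` C).
Proof.
move=> tT; have sF := filtration_sigma hF tT; case: (sF) => F0 FC FU.
suff : <<s cylinder t >> `<=` [set D | F t (fst @^-1` D)] by exact.
apply: smallest_sub.
  split => /=.
  - by rewrite preimage_set0.
  - by move=> A FA; rewrite setTD preimage_setC -setTD; exact: FC.
  - by move=> A FA; rewrite preimage_bigcup; exact: FU.
by move=> A; exact: cylinder_F.
Qed.

Lemma mg_fst t (f : Om0 -> R) : 0 <= t <= T -> mg (cylinder t) f ->
  mg (F t) (fun w : Om => f w.1).
Proof.
move=> tT gf _ A mA; rewrite setTI; apply: sub_sigma_algebra.
apply: (@sigma_cylinder_F _ (f @^-1` A) tT).
by rewrite -[_ @^-1` _]setTI; exact: gf.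
Qed.

Lemma meas_W t : 0 <= t <= T -> measurable_fun setT (W t).
Proof.
by move=> tT; apply: (@meas_fstV _ _ _ _ Omt); exact: (meas_F hF tT (mg_W hF hW tT)).
Qed.

Lemma meas_xi0 : measurable_fun setT xi0.
Proof.
apply: (@meas_fstV _ _ _ _ Omt); apply: (meas_F hF O0T).
by apply/(mgP _ (filtration_sigma hF O0T)); exact: xi_F0.
Qed.

Lemma cylinder_meas t : t <= T -> cylinder t `<=` measurable.
Proof.
move=> tT _ [n [tt [AA [A0 [mA0 h ->]]]]].
have mpre (f : Om0 -> R) A : measurable_fun setT f -> measurable A -> measurable (f @^-1` A).
  by move=> mf mA; rewrite -[X in measurable X]setTI; exact: mf.
elim: n h => [|n IH] h.
  rewrite (_ : [set w | _] = xi0 @^-1` A0); last by apply/seteqP; split => w //= [].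
  exact: mpre meas_xi0 _.
rewrite (_ : [set w | _] = [set w | A0 (xi0 w) /\
    forall i, (i < n)%N -> AA i (W (tt i) w)] `&` (W (tt n)) @^-1` (AA n)); last first.
  apply/seteqP; split => w /=.
    move=> [h1 h2]; split; last exact: h2.
    by split => // i ni; apply: h2; exact: ltnW.
  move=> [[h1 h2] h3]; split => // i; rewrite ltnS leq_eqVlt => /orP[/eqP ->//|].
  exact: h2.
apply: measurableI; first by apply: IH => i ni; apply: h; exact: ltnW.
have [/andP[n0 nt] mA] := h n (ltnSn n).
by apply: mpre => //; apply: meas_W; rewrite n0 (le_trans nt).
Qed.

Lemma mg_cyl_meas t (f : Om0 -> R) : t <= T -> mg (cylinder t) f -> measurable_fun setT f.
Proof. by move=> tT; apply: mg_meas; exact: cylinder_meas. Qed.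

Lemma mg_cyl_mono s t (f : Om0 -> R) : s <= t -> mg (cylinder s) f -> mg (cylinder t) f.
Proof.
by move=> st; apply: mg_sub => A CA; apply: sub_sigma_algebra; exact: cylinder_mono CA.
Qed.

Lemma mg_cyl_W t : 0 <= t -> mg (cylinder t) (W t).
Proof.
move=> t0 _ A mA; rewrite setTI; apply: sub_sigma_algebra.
exists 1%N, (fun=> t), (fun=> A), setT; split => //.
  by move=> i _; rewrite t0 lexx.
by apply/seteqP; split => w /=; [move=> h; split => // i|move=> [_ /(_ 0%N)]; apply].
Qed.

Lemma mg_cyl_xi0 t : mg (cylinder t) xi0.
Proof.
move=> _ A mA; rewrite setTI; apply: sub_sigma_algebra.
exists 0%N, (fun=> t), (fun=> A), A; split => //.
by apply/seteqP; split => w /= => [|[]].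
Qed.

(** The conditions up to [t] stay a cylinder set, which lies in the information at [t]; the later
    ones become indicators, sorted in time as [chain] requires. *)
Lemma cylinder_split t C : 0 <= t <= T -> cylinder T C ->
  exists (C1 : set Om0) (l : seq (R * (R -> R))),
    [/\ cylinder t C1, chain T t l &
      forall w : Om, \1_C w.1 = \1_C1 w.1 * cyl iW l w].
Proof.
move=> /andP[t0 tT] [n [tt [AA [A0 [mA0 h ->]]]]].
pose late := sort (fun i j => tt i <= tt j) [seq i <- iota 0 n | ~~ (tt i <= t)].
pose C1 := [set w | A0 (xi0 w) /\ forall i, (i < n)%N -> tt i <= t -> AA i (W (tt i) w)].
exists C1, [seq (tt i, \1_(AA i)) | i <- late]; split.
(* Conditions after [t] become void conditions at time 0, which keeps the index range. *)
- exists n, (fun i => if tt i <= t then tt i else 0).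
  exists (fun i => if tt i <= t then AA i else setT), A0; split => //.
    move=> i iN; have [/andP[h1 h2] h3] := h i iN.
    by case: ifPn => h4; rewrite ?h1 ?h4// lexx t0.
  apply/seteqP; split => w /= [h1 h2]; split => // i iN.
    by case: ifPn => // h3; exact: h2.
  by move=> h3; have := h2 i iN; rewrite h3.
- have late_mem i : i \in late -> (i < n)%N /\ t <= tt i.
    rewrite mem_sort mem_filter mem_iota add0n -ltNge => /andP[/ltW h1 /andP[_ h2]].
    by split.
  have srt : sorted (fun i j => tt i <= tt j) late.
    by apply: sort_sorted => i j; exact: le_total.
  have gen (s : seq nat) u : (forall i, i \in s -> (i < n)%N /\ u <= tt i) ->
      sorted (fun i j => tt i <= tt j) s ->
      chain T u [seq (tt i, \1_(AA i)) | i <- s].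
    elim: s u => //= i s IH u lm hs; have [iN ti] := lm i (mem_head _ _).
    have [/andP[h1 h2] h3] := h i iN.
    split => //.
    + by move=> x; rewrite indicE; case: (_ \in _); rewrite ?normr1 ?normr0.
    + apply: IH; last exact: path_sorted hs.
      move=> j js; have [jN tj] : (j < n)%N /\ u <= tt j by apply: lm; rewrite inE js orbT.
      split => //; have tr : transitive (fun i j => tt i <= tt j).
        by move=> a b c; exact: le_trans.
      by have /allP h4 := order_path_min tr hs; exact: h4.
  exact: gen.
- move=> w; rewrite /cyl big_map /=.
  rewrite (perm_big _ (permEl (perm_sort _ _))) big_filter.
  have [[h1 h2]|nC] := pselect (A0 (xi0 w.1) /\ forall i, (i < n)%N -> AA i (W (tt i) w.1)).
    rewrite !indicE !mem_set//=; last by split => // i iN _; exact: h2.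
    rewrite big1_seq ?mulr1// => i /andP[_]; rewrite mem_iota add0n => /andP[_ iN].
    by rewrite indicE mem_set//; exact: h2.
  rewrite indicE memNset//=; have [[h1 h2]|nC1] := pselect (C1 w.1); last first.
    by rewrite indicE memNset//= mul0r.
  rewrite [X in _ = _ * X](_ : _ = 0) ?mulr0//; apply/eqP.
  rewrite prodf_seq_eq0; apply: contrapT => /negP /hasPn hn; apply: nC; split => // i iN.
  have [it|it] := boolP (tt i <= t); first exact: h2.
  have hi : i \in iota 0 n by rewrite mem_iota add0n.
  have := hn i hi; rewrite it /= indicE => hA; apply: contrapT => nA.
  by move: hA; rewrite memNset// eqxx.
Qed.

Let cyl0 (l : seq (R * (R -> R))) (w : Om0) : R := \prod_(p <- l) p.2 (W p.1 w).

Let indic_bound (A : set Om0) w : `|\1_A w : R| <= 1.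
Proof. by rewrite indicE; case: (_ \in _); rewrite ?normr1 ?normr0. Qed.

Let sigma_cylinder_meas t A : t <= T -> <<s cylinder t >> A -> measurable A.
Proof.
move=> tT; suff : <<s cylinder t >> `<=` measurable by exact.
apply: smallest_sub; first exact: sigma_algebra_measurable.
exact: cylinder_meas.
Qed.

Lemma cylinder_orth (z : Om0 -> R) : L2 P0 z ->
  (forall C, cylinder T C -> \int[P0]_w (\1_C w * z w) = 0) ->
  forall eta, mg (cylinder T) eta -> L2 P0 eta -> \int[P0]_w (z w * eta w) = 0.
Proof.
move=> hz h0 eta geta heta.
have mid : measurable_fun [set: Om0] (fun w => w : g_sigma_algebraType (cylinder T)).
  by move=> _ A mA; rewrite setTI; exact: sigma_cylinder_meas mA.
apply: (@orth_measurable _ _ _ P0 _ (g_sigma_algebraType (cylinder T)) _ mid z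
  (L2_L1 hz) _ eta geta); last exact: L2_mul.
move=> A mA; apply: (@zero_integral_sigma _ _ _ _ (cylinder T)) => //.
- exact: cylinder_meas.
- exact: cylinderI.
- exact: cylinderT.
- exact: L2_L1.
Qed.

(* Immersion: conditioning a [F t]-measurable variable on the information of
   the idiosyncratic noise up to time T only involves that up to time t. *)
Lemma info_proj t (h : Om -> R) : 0 <= t <= T -> mg (F t) h -> L1 P h ->
  L2 P0 (fun w0 => \int[Pt]_wt h (w0, wt)) ->
  exists c : Om0 -> R, [/\ mg (cylinder t) c, L2 P0 c &
    forall eta, mg (cylinder T) eta -> L2 P0 eta ->
      \int[P0]_w0 ((\int[Pt]_wt h (w0, wt)) * eta w0) = \int[P0]_w (c w * eta w)].
Proof.
move=> tT gh hh; set z := fun w0 => _; move=> hz.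
have [t0 tT'] := andP tT.
have mid : measurable_fun [set: Om0] (fun w => w : g_sigma_algebraType (cylinder t)).
  by move=> _ A mA; rewrite setTI; exact: sigma_cylinder_meas mA.
have [c [gc hc hcE]] := cond_exp_L2 mid hz.
exists c; split => // eta geta heta.
apply/eqP; rewrite -subr_eq0 -exB; [|exact: L2_mul|exact: L2_mul].
apply/eqP; transitivity (\int[P0]_w ((z w - c w) * eta w)).
  by apply: eq_Rintegral => w _; rewrite mulrBl.
apply: cylinder_orth => //; first exact: L2B.
move=> C CC; have mC : measurable C by exact: cylinder_meas CC.
have LC (f : Om0 -> R) : L1 P0 f -> L1 P0 (fun w => \1_C w * f w).
  by move=> hf; exact: L1_indic_mul.
under eq_Rintegral do rewrite mulrBr.
rewrite exB; [|exact/LC/L2_L1|exact/LC/L2_L1].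
apply/eqP; rewrite subr_eq0; apply/eqP.
have [C1 [l [CC1 hl hCE]]] := cylinder_split tT CC.
have mC1 : measurable C1 by exact: cylinder_meas tT' _ CC1.
have [psi [mpsi psi1 hpsi]] := chain_immersion hF hW tT hl.
have gC1 : mg (cylinder t) (\1_C1 : Om0 -> R).
  by apply: mg_indic; exact: sub_sigma_algebra.
have gF1 := mg_fst tT gC1.
have m1 (A : set Om0) : measurable A -> measurable_fun setT (fun w : Om => \1_A w.1 : R).
  by move=> mA; apply: meas_fst; exact: measurable_indic.
have b1 (A : set Om0) (f : Om -> R) : measurable A -> L1 P f -> L1 P (fun w => \1_A w.1 * f w).
  by move=> mA hf; apply: (@L1_mul_bounded _ _ _ _ _ _ 1) => //; exact: m1.
(* Immersion applies to [h] and to [c] alike. The factor that it leaves, 1_C1 psi(W t), belongs to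
   the information at [t], where [c] represents [z]. *)
have key (f : Om -> R) : mg (F t) f -> L1 P f ->
    \int[P]_w (\1_C w.1 * f w) = \int[P]_w (\1_C1 w.1 * f w * psi (W t w.1)).
  move=> gf hf.
  rewrite -(hpsi (fun w => \1_C1 w.1 * f w)).
  - by apply: eq_Rintegral => w _; rewrite hCE; cbv beta; ring.
  - exact: measurable_funM.
  - exact: b1.
have mpW : measurable_fun setT (fun w => psi (W t w)).
  by apply: (measurableT_comp mpsi); exact: meas_W.
have gpsi : mg (cylinder t) (fun w => \1_C1 w * psi (W t w)).
  by apply: measurable_funM => //; apply: (measurableT_comp mpsi); exact: mg_cyl_W.
have mpsiC1 := mg_cyl_meas tT' gpsi.
have psiC1 w : `|\1_C1 w * psi (W t w)| <= 1.
  by rewrite normrM -[leRHS]mulr1 ler_pM.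
have L2psi : L2 P0 (fun w => \1_C1 w * psi (W t w)) by exact: (@L2_bounded _ _ _ _ _ 1).
have L1c : L1 P (fun w => c w.1) by apply/(L1_fst P0 Pt (L2_meas hc)); exact: L2_L1.
transitivity (\int[P]_w (\1_C w.1 * h w)).
  have [_ _ ->] := ex_prod (b1 C h mC hh).
  apply: ex_ae.
  - apply: measurable_funM; [exact: measurable_indic|exact: L2_meas hz].
  - by have [] := ex_prod (b1 C h mC hh).
  - have := ae_integrable1 (hh : (P0 \x Pt)%E.-integrable setT (EFin \o h)).
    by apply: filterS => w0 hw; rewrite /= exZ.
rewrite key//.
transitivity (\int[P0]_w (z w * (\1_C1 w * psi (W t w)))).
  have LL : L1 P (fun w => (\1_C1 w.1 * psi (W t w.1)) * h w).
    apply: (@L1_mul_bounded _ _ _ P (fun w => \1_C1 w.1 * psi (W t w.1)) h 1) => //.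
    exact: (measurableT_comp mpsiC1).
  transitivity (\int[P]_w ((\1_C1 w.1 * psi (W t w.1)) * h w)).
    by apply: eq_Rintegral => w _; ring.
  have [mm _ ->] := ex_prod LL.
  apply: ex_ae => //.
  - by apply: measurable_funM; [exact: L2_meas hz|].
  - have := ae_integrable1 (hh : (P0 \x Pt)%E.-integrable setT (EFin \o h)).
    by apply: filterS => w0 hw; rewrite /= exZ// mulrC.
rewrite (hcE (fun w => \1_C1 w * psi (W t w)))//.
transitivity (\int[P]_w (\1_C1 w.1 * c w.1 * psi (W t w.1))).
  rewrite (ex_fst P0 Pt (f := fun w => \1_C1 w * c w * psi (W t w))).
    by apply: eq_Rintegral => w _; ring.
  apply: measurable_funM => //; apply: measurable_funM; last exact: L2_meas hc.
  exact: measurable_indic.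
rewrite -(key (fun w => c w.1))//; last exact: mg_fst.
rewrite (ex_fst P0 Pt (f := fun w => \1_C w * c w))//.
by apply: measurable_funM; [exact: measurable_indic|exact: L2_meas hc].
Qed.

(** By [chain_increment'], an [F r]-measurable variable has no component along a later common
    increment, even when the whole path of [W] is known. *)
Lemma info_increment r r' (h : Om -> R) : 0 <= r -> r <= r' -> r' <= T ->
  mg (F r) h -> L1 P h -> L2 P0 (fun w0 => \int[Pt]_wt (h (w0, wt) * (B r' wt - B r wt))) ->
  forall eta, mg (cylinder T) eta -> L2 P0 eta ->
    \int[P0]_w0 ((\int[Pt]_wt (h (w0, wt) * (B r' wt - B r wt))) * eta w0) = 0.
Proof.
move=> r0 rr' r'T gh hh; set z := fun w0 => _; move=> hz.
apply: cylinder_orth => // C CC.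
have mC : measurable C by apply: cylinder_meas CC; exact: lexx.
have rT : 0 <= r <= T by rewrite r0 (le_trans rr').
have [C1 [l [CC1 hl hCE]]] := cylinder_split rT CC.
have mC1 : measurable C1 by apply: cylinder_meas CC1; case/andP: rT.
have gC1 : mg (cylinder r) (\1_C1 : Om0 -> R).
  by apply: mg_indic; exact: sub_sigma_algebra.
have gF1 := mg_fst rT gC1.
have m1 (A : set Om0) : measurable A -> measurable_fun setT (fun w : Om => \1_A w.1 : R).
  by move=> mA; apply: meas_fst; exact: measurable_indic.
have b1 (A : set Om0) (f : Om -> R) : measurable A -> L1 P f -> L1 P (fun w => \1_A w.1 * f w).
  by move=> mA hf; apply: (@L1_mul_bounded _ _ _ _ _ _ 1) => //; exact: m1.
have hB := L1_increment' hF hW r0 rr' r'T gh hh.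
transitivity (\int[P]_w (\1_C w.1 * (h w * (B r' w.2 - B r w.2)))).
  have [_ _ ->] := ex_prod (b1 C _ mC hB).
  apply: ex_ae.
  - by apply: measurable_funM; [exact: measurable_indic|exact: L2_meas hz].
  - by have [] := ex_prod (b1 C _ mC hB).
  - have := ae_integrable1 (hB : (P0 \x Pt)%E.-integrable setT (EFin \o _)).
    by apply: filterS => w0 hw; rewrite /= exZ.
rewrite -(chain_increment' hF hW r0 rr' r'T hl (H := fun w => \1_C1 w.1 * h w)).
- by apply: eq_Rintegral => w _; rewrite hCE; cbv beta; ring.
- exact: measurable_funM.
- exact: b1.
Qed.

End information.

(** * Projection onto the increments along a grid *)

Section grid_projection.
Context {R : realType} (T : R) {d0} {Om0 : measurableType d0}
  {dt} {Omt : measurableType dt}.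
Variables (P0 : probability Om0 R) (Pt : probability Omt R).
Local Notation Om := (Om0 * Omt)%type.
Local Notation P := ((P0 \x Pt)%E : probability (Om0 * Omt)%type R).
Variables (F : R -> set (set Om)) (W : R -> Om0 -> R) (B : R -> Omt -> R).
Variable xi0 : Om0 -> R.
Hypothesis T_gt0 : (0 : R) < T.
Hypothesis hF : complete_filtration P T F.
Local Notation iW := (fun t (w : Om) => W t w.1).
Local Notation iB := (fun t (w : Om) => B t w.2).
Hypothesis hW : independent_brownian_motions P T F iW iB.
Hypothesis xi_F0 : measurable_wrt (F 0) (fun w : Om => xi0 w.1).
Local Notation cyl0 := (cylinder W xi0).

Let T0 : (0 : R) <= T. Proof. exact: ltW. Qed.
Let T0T : 0 <= T <= T. Proof. by rewrite T0 lexx. Qed.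

(** The residual is orthogonal to the information up to T although [c] only uses that up to [t]:
    this is the immersion of [info_proj]. *)
Lemma idio_proj t (h : Om -> R) : 0 <= t <= T -> mg (F t) h -> L2 P h ->
  exists c : Om0 -> R, [/\ mg (cyl0 t) c, L2 P0 c &
    forall eta, mg (cyl0 T) eta -> L2 P0 eta ->
      \int[P]_w ((h w - c w.1) * eta w.1) = 0].
Proof.
move=> tT gh hh.
have h1 := L2_cst Pt 1.
have hz : L2 P0 (fun w0 => \int[Pt]_wt h (w0, wt)).
  have := L2_partial_ip hh h1; rewrite /partial_ip.
  by under eq_fun do under eq_Rintegral do rewrite mulr1.
have [c [gc hc hcE]] := info_proj T0 hF hW xi_F0 tT gh (L2_L1 hh) hz.
exists c; split => // eta geta heta.
have heta' : L2 P (fun w => eta w.1) by apply: (proj1 (L2_fst P0 Pt _)).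
have hc' : L2 P (fun w => c w.1) by apply: (proj1 (L2_fst P0 Pt _)).
under eq_Rintegral do rewrite mulrBl.
rewrite exB; [|exact: L2_mul|exact: L2_mul].
rewrite (ex_fst P0 Pt (f := fun w => c w * eta w)); last exact: L1_meas (L2_mul hc heta).
rewrite -hcE//; apply/eqP; rewrite subr_eq0; apply/eqP.
have := ex_partial_ip hh h1 heta.
under eq_Rintegral do rewrite mulr1.
move=> ->; apply: eq_Rintegral => w _; congr (_ * _); rewrite /partial_ip.
by apply: eq_Rintegral => wt _; rewrite mulr1.
Qed.

Variable N : nat.
Hypothesis N_gt0 : (0 < N)%N.

Definition tk (k : nat) : R := k%:R * (T / N%:R).

Let step0 : 0 < T / N%:R. Proof. by rewrite divr_gt0// ltr0n. Qed.

Lemma tk0 : tk 0 = 0. Proof. by rewrite /tk mul0r. Qed.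

Lemma tkN : tk N = T.
Proof. by rewrite /tk mulrC divfK// pnatr_eq0 -lt0n. Qed.

Lemma tk_le i j : (i <= j)%N -> tk i <= tk j.
Proof. by move=> ij; rewrite /tk ler_wpM2r ?ler_nat// ltW. Qed.

Lemma tk_ltS i : tk i < tk i.+1.
Proof. by rewrite /tk ltr_pM2r// ltr_nat. Qed.

Lemma tk_itv k : (k <= N)%N -> 0 <= tk k <= T.
Proof. by move=> kN; rewrite -tkN -tk0 !tk_le. Qed.

Let dB k wt := B (tk k.+1) wt - B (tk k) wt.

Let bnd k : (k < N)%N -> [/\ 0 <= tk k, tk k < tk k.+1, tk k.+1 <= T & 0 <= tk k.+1 <= T].
Proof.
move=> kN; have /andP[h1 h2] := tk_itv (ltnW kN); have /andP[h3 h4] := tk_itv kN.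
by split => //; [exact: tk_ltS|rewrite h3 h4].
Qed.

Lemma L2_dB k : (k < N)%N -> L2 Pt (dB k).
Proof.
move=> kN; have [h1 h2 h3 h4] := bnd kN.
by apply/(@L2_snd _ _ _ _ _ P0); exact: (L2_increment' hF hW h1 h2 h3).
Qed.

(** An L2 norm, which normalizes [incr] without computing the variance of the increment. *)
Definition sdB k : R := Num.sqrt (\int[Pt]_wt (dB k wt ^+ 2)).

Lemma sdB_gt0 k : (k < N)%N -> 0 < sdB k.
Proof.
move=> kN; have [h1 h2 h3 h4] := bnd kN.
have := increment'_var_gt0 hF hW h1 h2 h3.
rewrite (ex_snd P0 Pt (f := fun wt => dB k wt ^+ 2)) ?sqrtr_gt0//.
by apply: measurable_funX; exact: L2_meas (L2_dB kN).
Qed.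

Definition incr k wt : R := (sdB k)^-1 * dB k wt.

Lemma L2_incr k : (k < N)%N -> L2 Pt (incr k).
Proof. by move=> kN; apply: L2Z; exact: L2_dB. Qed.

Lemma incr_sq k : (k < N)%N -> \int[Pt]_wt (incr k wt * incr k wt) = 1.
Proof.
move=> kN; have s0 := sdB_gt0 kN.
transitivity (\int[Pt]_wt ((sdB k)^-2 * dB k wt ^+ 2)).
  by apply: eq_Rintegral => wt _; rewrite -expr2 exprMn exprVn.
rewrite exZ; last exact: L2_sq (L2_dB kN).
rewrite -[X in _ * X]sqr_sqrtr; last by apply: ex_ge0 => w; exact: sqr_ge0.
by rewrite -/(sdB k) mulVf// expf_neq0// gt_eqF.
Qed.

Lemma mg_dB k : (k < N)%N -> mg (F (tk k.+1)) (fun w : Om => dB k w.2).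
Proof.
move=> kN; have [h1 h2 h3 h4] := bnd kN.
apply: measurable_funB; first exact: (mg_W' hF hW h4).
apply: (mg_filtration_mono hF h1 (ltW h2) h3).
by apply: (mg_W' hF hW); rewrite h1 (le_trans (ltW h2)).
Qed.

Lemma mg_incr k m : (k < m)%N -> (m <= N)%N -> mg (F (tk m)) (fun w : Om => incr k w.2).
Proof.
move=> km mN; have kN := leq_trans km mN; have [h1 h2 h3 h4] := bnd kN.
apply: (mg_filtration_mono hF (proj1 (andP h4)) (tk_le km)).
  by have /andP[] := tk_itv mN.
by apply: measurable_funM => //; exact: mg_dB.
Qed.

Lemma incr_orth_lt i j : (i < j)%N -> (j < N)%N ->
  \int[Pt]_wt (incr i wt * incr j wt) = 0.
Proof.
move=> ij jN; have [h1 h2 h3 h4] := bnd jN.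
have iN := ltn_trans ij jN.
have gi : mg (F (tk j)) (fun w : Om => incr i w.2) by apply: mg_incr => //; exact: ltnW.
have Li : L1 P (fun w : Om => incr i w.2) by apply: L2_L1; apply: (proj1 (L2_snd P0 Pt _)); exact: L2_incr.
have [_ e0] := increment'_mul hF hW h1 h2 h3 gi Li.
transitivity (\int[Pt]_wt ((sdB j)^-1 * (incr i wt * dB j wt))).
  by apply: eq_Rintegral => wt _; rewrite /incr; ring.
have LL := L2_mul (L2_incr iN) (L2_dB jN).
rewrite exZ//.
by rewrite -(ex_snd P0 Pt (f := fun wt => incr i wt * dB j wt)) ?e0 ?mulr0//; exact: L1_meas LL.
Qed.

Lemma incr_orth i j : (i < N)%N -> (j < N)%N ->
  \int[Pt]_wt (incr i wt * incr j wt) = (i == j)%:R.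
Proof.
move=> iN jN; have [ij|ij|->] := ltngtP i j.
- by rewrite incr_orth_lt.
- under eq_Rintegral do rewrite mulrC.
  by rewrite incr_orth_lt.
- by rewrite incr_sq.
Qed.

(** First chaos of the common noise along the grid, with coefficients random in omega^0. *)
Definition chaos (m : nat) (c : nat -> Om0 -> R) (w : Om) : R :=
  \sum_(i < m) c i w.1 * incr i w.2.

Lemma L2_chaos m c : (m <= N)%N -> (forall j, (j < m)%N -> L2 P0 (c j)) -> L2 P (chaos m c).
Proof.
move=> mN hc; apply: L2_sum => -[i im] /=.
by apply: L2_tensor; [exact: hc|apply: L2_incr; exact: leq_trans mN].
Qed.

Lemma mg_chaos m c : (m <= N)%N -> (forall j, (j < m)%N -> mg (cyl0 (tk m)) (c j)) ->
  mg (F (tk m)) (chaos m c).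
Proof.
move=> mN gc; apply: (@measurable_sum _ (g_sigma_algebraType (F (tk m)))) => -[i im] /=.
apply: measurable_funM; last exact: mg_incr.
exact: (mg_fst hF hW xi_F0 (tk_itv mN) (gc i im)).
Qed.

(** The increments are orthonormal, so the coefficient along the j-th is [info_proj] of h times it.
    For j >= m the coefficient of [h] vanishes by [info_increment], so m terms already give the
    projection onto all N directions. *)
Lemma grid_proj m (h : Om -> R) : (m <= N)%N -> mg (F (tk m)) h -> L2 P h ->
  exists c : nat -> Om0 -> R,
    (forall j, (j < m)%N -> mg (cyl0 (tk m)) (c j) /\ L2 P0 (c j)) /\
    forall j eta, (j < N)%N -> mg (cyl0 T) eta -> L2 P0 eta ->
      \int[P]_w ((h w - chaos m c w) * (eta w.1 * incr j w.2)) = 0.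
Proof.
move=> mN gh hh; have tmT := tk_itv mN.
have [c hc] : exists c : nat -> Om0 -> R, forall j, (j < m)%N ->
    [/\ mg (cyl0 (tk m)) (c j), L2 P0 (c j) & forall eta, mg (cyl0 T) eta -> L2 P0 eta ->
      \int[P0]_w (partial_ip Pt h (incr j) w * eta w) = \int[P0]_w (c j w * eta w)].
  suff : forall j, exists c : Om0 -> R, (j < m)%N -> [/\ mg (cyl0 (tk m)) c, L2 P0 c &
    forall eta, mg (cyl0 T) eta -> L2 P0 eta ->
      \int[P0]_w (partial_ip Pt h (incr j) w * eta w) = \int[P0]_w (c w * eta w)].
    by move=> /choice[c hc]; exists c.
  move=> j.
  have [jm|mj] := ltnP j m; last by exists (fun=> 0).
  have jN := leq_trans jm mN.
  have gj := mg_incr jm mN.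
  have Lj : L2 P (fun w : Om => incr j w.2) by apply: (proj1 (L2_snd P0 Pt _)); exact: L2_incr.
  have [c [gc Lc hc]] := info_proj T0 hF hW xi_F0 tmT
    (measurable_funM gh gj : mg (F (tk m)) (fun w => h w * incr j w.2))
    (L2_mul hh Lj) (L2_partial_ip hh (L2_incr jN)).
  by exists c => _; split.
exists c; split; first by move=> j jm; have [] := hc j jm.
move=> j eta jN geta heta.
have Lcj i : (i < m)%N -> L2 P0 (c i) by move=> im; have [] := hc i im.
have Lej := L2_tensor heta (L2_incr jN).
under eq_Rintegral do rewrite mulrBl.
rewrite exB; [|exact: L2_mul|exact: L2_mul (L2_chaos mN Lcj) _].
rewrite ex_partial_ip//; last exact: L2_incr.
have Lt i : (i < m)%N -> L1 P0 (fun w => c i w * eta w) by move=> im; apply: L2_mul => //; exact: Lcj.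
have Ltt i : (i < N)%N -> L1 Pt (fun w => incr i w * incr j w).
  by move=> iN; apply: L2_mul; exact: L2_incr.
have -> : \int[P]_w (chaos m c w * (eta w.1 * incr j w.2)) =
    \sum_(i < m) (\int[P0]_w (c i w * eta w)) * (nat_of_ord i == j)%:R.
  transitivity (\int[P]_w \sum_(i < m) ((c i w.1 * eta w.1) * (incr i w.2 * incr j w.2))).
    by apply: eq_Rintegral => w _; rewrite /chaos mulr_suml; apply: eq_bigr => i _; ring.
  rewrite ex_sum; last first.
    move=> [i im] /=; have [] := L1_tensor (Lt i im) (Ltt i (leq_trans im mN)).
    exact.
  apply: eq_bigr => -[i im] _ /=.
  by rewrite (proj2 (L1_tensor (Lt i im) (Ltt i (leq_trans im mN)))) incr_orth// (leq_trans im).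
have [jm|mj] := ltnP j m.
  rewrite (bigD1 (Ordinal jm))//= eqxx mulr1 big1 ?addr0; last first.
    move=> i; rewrite -val_eqE /= => /negbTE ->; by rewrite mulr0.
  by have [_ _ ->] := hc j jm; rewrite ?subrr.
rewrite big1 ?subr0; last first.
  by move=> [i im] _ /=; rewrite ltn_eqF ?mulr0//; exact: leq_trans mj.
have [h1 h2 h3 h4] := bnd jN.
have /andP[tm0 tmT'] := tmT.
have tm_j := tk_le mj.
have gh' : mg (F (tk j)) h by exact: (mg_filtration_mono hF tm0 tm_j (le_trans (ltW h2) h3)).
have := info_increment T0 hF hW xi_F0 h1 (ltW h2) h3 gh' (L2_L1 hh)
  (L2_partial_ip hh (L2_dB jN)) geta heta => e0.
have Lp := L2_mul (L2_partial_ip hh (L2_dB jN)) heta.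
(* The normalization leaves the expectation only on those sections where [h] is square integrable,
   hence an almost sure equality. *)
transitivity (\int[P0]_w ((sdB j)^-1 * (partial_ip Pt h (dB j) w * eta w))).
  apply: ex_ae.
  - exact: L1_meas (L2_mul (L2_partial_ip hh (L2_incr jN)) heta).
  - exact: L1_meas (L1Z _ Lp).
  - have := L2_section hh; apply: filterS => w0 hw; rewrite mulrA; congr (_ * _).
    rewrite /partial_ip -exZ; last exact: L2_mul hw (L2_dB jN).
    by apply: eq_Rintegral => wt _; rewrite /incr; ring.
by rewrite exZ// e0 mulr0.
Qed.

End grid_projection.

(** * Time integrals, Ito integrals and forward-backward systems *)

Section time_law.
Context {R : realType} (T : R).
Hypothesis T_gt0 : (0 : R) < T.
Local Notation lam := (@lebesgue_measure R).

Lemma time_law_subproof : exists mu : probability R R,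
  forall A, measurable A -> uniform_prob T_gt0 A = mu A.
Proof.
have mid : measurable_fun [set: measurableTypeR R] (fun x : measurableTypeR R => x : R).
  by move=> _ B mB; rewrite setTI.
exact: (@exists_law R _ _ _ _ (uniform_prob T_gt0) _ mid).
Qed.

(* Up to the factor T, time integrals are expectations under the uniform law. *)
Definition time_law : probability R R := sval (cid time_law_subproof).

Lemma ge0_integral_time_law (f : R -> \bar R) : measurable_fun setT f ->
  (forall s, 0 <= f s)%E ->
  (\int[time_law]_s f s = T^-1%:E * \int[lam]_(s in `[0%R, T]) f s)%E.
Proof.
move=> mf f0.
have mid : measurable_fun [set: measurableTypeR R] (fun x : measurableTypeR R => x : R).
  by move=> _ B mB; rewrite setTI.
rewrite (@ge0_integral_law R _ _ _ _ (uniform_prob T_gt0) time_law _ mid)//.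
  by rewrite integral_uniform// subr0.
by rewrite /time_law; case: cid.
Qed.

Lemma integral_time_law (f : R -> R) : measurable_fun setT f ->
  \int[lam]_(s in `[0%R, T]) f s = T * \int[time_law]_s f s.
Proof.
move=> mf.
have mE : measurable_fun setT (EFin \o f) by exact/measurable_EFinP.
have e : (\int[time_law]_s (f s)%:E =
    T^-1%:E * \int[lam]_(s in `[0%R, T]) (f s)%:E)%E.
  rewrite integralE [in RHS]integralE.
  rewrite (ge0_integral_time_law (measurable_funepos mE)); last first.
    by move=> y; exact: funepos_ge0.
  rewrite (ge0_integral_time_law (measurable_funeneg mE)); last first.
    by move=> y; exact: funeneg_ge0.
  have c0 : (0%:E < T^-1%:E :> \bar R)%E by rewrite lte_fin invr_gt0.
  have cB (a b : \bar R) : (T^-1%:E * a - T^-1%:E * b = T^-1%:E * (a - b))%E.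
    case: a b => [a| |] [b| |]; rewrite ?gt0_muley ?gt0_muleNy//=.
    by rewrite -!EFinM -!EFinB -mulrBr.
  exact: cB.
rewrite /Rintegral e.
have Tn0 : T != 0 by rewrite gt_eqF.
case: (\int[lam]_(s in `[0%R, T]) (f s)%:E)%E => [r| |].
- by rewrite -EFinM /= mulrA mulfV// mul1r.
- by rewrite gt0_muley ?lte_fin ?invr_gt0//= mulr0.
- by rewrite gt0_muleNy ?lte_fin ?invr_gt0//= mulr0.
Qed.

Lemma time_law_cell a b : 0 <= a -> a <= b -> b <= T ->
  \int[time_law]_s \1_(`[a, b[%classic) s = (b - a) / T.
Proof.
move=> a0 ab bT.
have mE : measurable_fun setT (EFin \o (\1_(`[a, b[%classic) : R -> R)).
  by apply/measurable_EFinP; exact: measurable_indic.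
rewrite /Rintegral (ge0_integral_time_law mE); last by move=> s; rewrite lee_fin.
rewrite integral_indic// setIidl; last first.
  move=> s /=; rewrite !in_itv/= => /andP[h1 h2].
  by rewrite (le_trans a0 h1) (le_trans (ltW h2) bT).
transitivity (fine (T^-1%:E * (b - a)%:E)%E); last by rewrite -EFinM /= mulrC.
congr (fine (_ * _)%E); apply: (etrans (lebesgue_measure_itv _)).
rewrite /= lte_fin; move: ab; rewrite le_eqVlt => /orP[/eqP ->|ab].
  by rewrite ltxx subrr.
by rewrite ab -EFinD.
Qed.

End time_law.

Section time_process.
Context {R : realType} (T : R) {d} {Om : measurableType d} (P : probability Om R).
Hypothesis T_gt0 : (0 : R) < T.
Local Notation lam := (@lebesgue_measure R).
Local Notation mu := (time_law T_gt0).
Variable Y : R -> Om -> R.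
Hypothesis mY : measurable_fun (`[0, T]%classic `*` [set: Om]) (fun p : R * Om => Y p.1 p.2).
Hypothesis iY : (\int[P]_w \int[lam]_(s in `[0%R, T]) ((Y s w) ^+ 2)%:E < +oo)%E.

(** Extension by zero, which turns time integrals over [0, T] into expectations of a process jointly
    measurable on the whole line. *)
Definition cutoff (s : R) (w : Om) : R := \1_(`[0, T]%classic) s * Y s w.

Lemma cutoff_in s w : 0 <= s <= T -> cutoff s w = Y s w.
Proof. by move=> sT; rewrite /cutoff indicE mem_set ?mul1r//= in_itv. Qed.

Lemma cutoff_out s w : ~ (0 <= s <= T) -> cutoff s w = 0.
Proof. by move=> sT; rewrite /cutoff indicE memNset ?mul0r//= in_itv. Qed.

Let D := `[0, T]%classic `*` [set: Om].
Let mD : measurable D. Proof. exact: measurableX. Qed.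

Lemma measurable_cutoff : measurable_fun setT (fun p : R * Om => cutoff p.1 p.2).
Proof.
rewrite (_ : (fun p => _) = (fun p : R * Om => Y p.1 p.2) \_ D); last first.
  apply/funext => -[s w]; rewrite patchE /cutoff /=.
  case: ifPn => [/set_mem [/= h _]|h]; first by rewrite indicE mem_set ?mul1r.
  rewrite indicE memNset ?mul0r// => h'; move: h; rewrite mem_set//.
exact: (proj1 (measurable_restrictT _ mD) mY).
Qed.

Lemma measurable_cutoff' : measurable_fun setT (fun p : Om * R => cutoff p.2 p.1).
Proof. exact: (measurableT_comp measurable_cutoff (@measurable_swap _ _ _ _)). Qed.

Lemma ex_cutoff w : \int[lam]_(s in `[0%R, T]) Y s w = T * \int[mu]_s cutoff s w.
Proof.
rewrite -integral_time_law; last exact: measurable_fun_pair1 measurable_cutoff.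
apply: eq_Rintegral => s; rewrite inE/= in_itv/= => sT.
by rewrite cutoff_in.
Qed.

Lemma L2_cutoff : L2 (P \x mu)%E (fun p : Om * R => cutoff p.2 p.1).
Proof.
have mY2 : measurable_fun setT (fun p : Om * R => cutoff p.2 p.1 ^+ 2).
  by apply: measurable_funX; exact: measurable_cutoff'.
apply/L2P; split; first exact: measurable_cutoff'.
apply/integrable12ltyP; first exact/measurable_EFinP.
have e w : (\int[mu]_s `|(cutoff s w ^+ 2)%:E| =
    T^-1%:E * \int[lam]_(s in `[0%R, T]) ((Y s w) ^+ 2)%:E)%E.
  rewrite (ge0_integral_time_law T_gt0); last 2 first.
  - apply: measurableT_comp => //; apply/measurable_EFinP.
    exact: (measurable_fun_pair2 w mY2).
  - by move=> s; exact: abse_ge0.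
  congr (_ * _)%E; apply: eq_integral => s; rewrite inE/= in_itv/= => sT.
  by rewrite ger0_norm ?sqr_ge0// cutoff_in.
under eq_integral do rewrite e.
have mF : measurable_fun setT (fun w => \int[lam]_(s in `[0%R, T]) ((Y s w) ^+ 2)%:E)%E.
  rewrite (_ : (fun w => _) = (fun w => T%:E * \int[mu]_s (cutoff s w ^+ 2)%:E)%E).
    apply: emeasurable_funM => //.
    have mE : measurable_fun setT (fun p : Om * R => (cutoff p.2 p.1 ^+ 2)%:E).
      exact/measurable_EFinP.
    apply: (@measurable_fun_fubini_tonelli_F _ _ _ _ _ mu _ mE) => p.
    by rewrite lee_fin sqr_ge0.
  apply/funext => w; have := e w.
  rewrite (_ : (\int[mu]_s `|(cutoff s w ^+ 2)%:E|)%E = (\int[mu]_s (cutoff s w ^+ 2)%:E)%E).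
    move=> ->; rewrite muleA -EFinM mulfV ?mul1e// gt_eqF//.
  by apply: eq_integral => s _; rewrite gee0_abs// lee_fin sqr_ge0.
rewrite ge0_integralZl//.
- apply: lte_mul_pinfty => //; first by rewrite lee_fin invr_ge0 ltW.
- by move=> w _; apply: integral_ge0 => s _; rewrite lee_fin sqr_ge0.
- by rewrite lee_fin invr_ge0 ltW.
Qed.

Lemma time_fubini (Z : Om -> R) : L2 P Z ->
  [/\ L2 P (fun w => \int[lam]_(s in `[0%R, T]) Y s w),
      L1 mu (fun s => \int[P]_w (cutoff s w * Z w)) &
      \int[P]_w ((\int[lam]_(s in `[0%R, T]) Y s w) * Z w) =
      T * \int[mu]_s \int[P]_w (cutoff s w * Z w)].
Proof.
move=> hZ; have L := L2_cutoff.
have h1 := L2_cst mu 1.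
have hI : L2 P (fun w => \int[mu]_s cutoff s w).
  have := L2_partial_ip L h1; rewrite /partial_ip.
  by under eq_fun do under eq_Rintegral do rewrite mulr1.
have LZ : L1 (P \x mu)%E (fun p : Om * R => cutoff p.2 p.1 * Z p.1).
  exact: L2_mul L (proj1 (L2_fst P mu _) hZ).
have LZ' : L1 (mu \x P)%E (fun p : R * Om => cutoff p.1 p.2 * Z p.2).
  have mZ : measurable_fun setT (fun p : R * Om => cutoff p.1 p.2 * Z p.2).
    apply: measurable_funM; first exact: measurable_cutoff.
    exact: (measurableT_comp (L2_meas hZ) measurable_snd).
  apply/integrable21ltyP; first exact/measurable_EFinP.
  have mZ' : measurable_fun setT (fun p : Om * R => cutoff p.2 p.1 * Z p.1).
    exact: L1_meas LZ.
  by move/integrable12ltyP : LZ; apply; exact/measurable_EFinP.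
have [_ h2 h3] := ex_prod LZ'.
split => //.
- by under eq_fun do rewrite ex_cutoff; exact: L2Z.
- under eq_Rintegral do rewrite ex_cutoff -mulrA.
  rewrite exZ; last exact: L2_mul.
  congr (_ * _).
  have := ex_partial_ip L h1 hZ; rewrite /partial_ip.
  under [X in _ = X -> _]eq_Rintegral do under eq_Rintegral do rewrite mulr1.
  under [X in X = _ -> _]eq_Rintegral do rewrite mulr1.
  have LZ1 : (P \x mu)%E.-integrable setT (EFin \o (fun p : Om * R => cutoff p.2 p.1 * Z p.1)).
    exact: LZ.
  move=> <-; rewrite -h3.
  rewrite /Rintegral -(integral21_prod_meas1 LZ') -(integral12_prod_meas1 LZ1).
  by [].
Qed.

Lemma L2_at_some_time : (forall s, 0 <= s <= T -> measurable_fun setT (Y s)) ->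
  exists2 s, 0 <= s <= T & L2 P (Y s).
Proof.
move=> mYs.
have L : L1 (P \x mu)%E (fun p : Om * R => cutoff p.2 p.1 ^+ 2) := L2_sq L2_cutoff.
have h := ae_integrable2 (L : (P \x mu)%E.-integrable setT (EFin \o _)).
apply: contrapT => nex; apply: (@ae_contradiction _ _ _ mu).
have hT : {ae mu, forall s, 0 <= s <= T}.
  exists (~` `[0, T]%classic); split.
  - exact: measurableC.
  - have mE : measurable_fun setT (EFin \o (\1_(~` `[0, T]%classic) : R -> R)).
      by apply/measurable_EFinP; apply: measurable_indic; exact: measurableC.
    have mC : measurable (~` `[0, T]%classic : set R) by exact: measurableC.
    have e0 : (\int[mu]_s (\1_(~` `[0%R, T]%classic) s)%:E = mu (~` `[0%R, T]%classic))%E.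
      by rewrite integral_indic// setIT.
    apply: (etrans (esym e0)).
    rewrite (ge0_integral_time_law T_gt0 mE); last by move=> s; rewrite lee_fin.
    by rewrite integral_indic ?setICl ?measure0 ?mule0.
  - by move=> s /= hs; apply: contra_not hs; rewrite in_itv.
near=> s; apply: nex; exists s; first exact: (near hT s).
apply/L2P; split; first by apply: mYs; exact: (near hT s).
have hs : 0 <= s <= T by exact: (near hT s).
have hs2 : P.-integrable setT (EFin \o (fun w => cutoff s w ^+ 2)).
  exact: (near h s).
by apply: eq_integrable hs2 => // w _ /=; rewrite cutoff_in.
Unshelve. all: end_near. Qed.

End time_process.

Section norm2_limits.
Context {R : realType} {d} {Om : measurableType d} (P : probability Om R).

Lemma norm2_lt (f : Om -> R) (e : R) : measurable_fun setT f -> 0 < e ->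
  (norm2 P f < e%:E)%E -> L2 P f /\ Num.sqrt (\int[P]_w (f w ^+ 2)) < e.
Proof.
move=> mf e0 h.
have hf : L2 P f by split => //; rewrite (lt_trans h)// ltry.
by split => //; move: h; rewrite norm2_sqrt// lte_fin.
Qed.

Lemma cvg0_lt (u : nat -> \bar R) (e : R) : 0 < e -> u n @[n --> \oo] --> 0%E ->
  \forall n \near \oo, (u n < e%:E)%E.
Proof.
move=> e0 hu; apply: (hu [set x | (x < e%:E)%E]).
by apply: open_nbhs_nbhs; split; [exact: open_ereal_lt_ereal|rewrite /= lte_fin].
Qed.

End norm2_limits.

(** * Martingale property of Ito integrals *)

Section ito_integral.
Context {R : realType} {d} {Om : measurableType d} (P : probability Om R).
Variables (T : R) (F : R -> set (set Om)) (M : R -> Om -> R).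
Hypothesis hF : complete_filtration P T F.
Hypothesis L2M : forall s t, 0 <= s -> s <= t -> t <= T -> L2 P (fun w => M t w - M s w).
Hypothesis zM : forall s t (H : Om -> R), 0 <= s -> s <= t -> t <= T ->
  mg (F s) H -> L1 P H -> \int[P]_w (H w * (M t w - M s w)) = 0.

Section simple.
Variable H : simple_integrand T F.
Local Notation n := (si_n H).
Local Notation tt := (si_t H).
Local Notation hh := (si_h H).

Lemma si_t_le i j : (i <= j)%N -> (j <= n)%N -> tt i <= tt j.
Proof.
elim: j => [|j IH]; first by rewrite leqn0 => /eqP ->.
rewrite leq_eqVlt => /orP[/eqP ->//|ij] jn.
by apply: le_trans (IH ij (ltnW jn)) _; exact: si_mono.
Qed.

Lemma si_t_itv i : (i <= n)%N -> 0 <= tt i <= T.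
Proof.
move=> i_n; rewrite (le_trans (si_ge0 H))/= ?si_t_le//.
by apply: le_trans (si_leT H); exact: si_t_le.
Qed.

Lemma si_h_mg i : (i < n)%N -> mg (F (tt i)) (hh i).
Proof.
move=> i_n; have iT := si_t_itv (ltnW i_n).
by apply/(mgP _ (filtration_sigma hF iT)); exact: si_meas.
Qed.

Lemma si_term_L2 i t : (i < n)%N -> 0 <= t <= T ->
  L2 P (fun w => hh i w * (M (Num.min (tt i.+1) t) w - M (Num.min (tt i) t) w)).
Proof.
move=> i_n /andP[t0 tT]; have [C hC] := si_bounded i_n.
have iT := si_t_itv (ltnW i_n); have /andP[i1 i2] := iT.
have /andP[i3 i4] := si_t_itv i_n.
apply: (@L2_mul_bounded _ _ _ _ _ _ C) => //; first exact: (meas_F hF iT (si_h_mg i_n)).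
apply: L2M.
- by rewrite le_min i1.
- by rewrite le_min !ge_min si_mono ?lexx ?orbT.
- by rewrite ge_min i4.
Qed.

Lemma si_integral_L2 t : 0 <= t <= T -> L2 P (si_integral H M t).
Proof. by move=> tT; apply: L2_sum => -[i i_n] /=; exact: si_term_L2. Qed.

(** Termwise, the part of the interval lying in ]s, t] carries an increment of [M] whose coefficient
    is known at the left end of that part. *)
Lemma si_martingale s t h : 0 <= s -> s <= t -> t <= T -> mg (F s) h -> L2 P h ->
  \int[P]_w ((si_integral H M t w - si_integral H M s w) * h w) = 0.
Proof.
move=> s0 st tT gh Lh.
have tT' : 0 <= t <= T by rewrite (le_trans s0).
have sT' : 0 <= s <= T by rewrite s0 (le_trans st).
pose D i w := (hh i w * (M (Num.min (tt i.+1) t) w - M (Num.min (tt i) t) w) -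
  hh i w * (M (Num.min (tt i.+1) s) w - M (Num.min (tt i) s) w)) * h w.
transitivity (\int[P]_w (\sum_(i < n) D i w)).
  by apply: eq_Rintegral => w _; rewrite /si_integral -sumrB mulr_suml.
have LD i : (i < n)%N -> L1 P (D i).
  by move=> i_n; apply: L2_mul => //; apply: L2B; exact: si_term_L2.
rewrite ex_sum; last by move=> [i i_n]; exact: LD.
apply: big1 => -[i i_n] _ /=.
have iT := si_t_itv (ltnW i_n); have /andP[i1 i2] := iT.
have /andP[i3 i4] := si_t_itv i_n.
have ii := si_mono i_n; have [C hC] := si_bounded i_n.
have mh := meas_F hF iT (si_h_mg i_n).
have zero (f : Om -> R) : (forall w, f w = 0) -> \int[P]_w f w = 0.
  by move=> h0; rewrite -[RHS](ex_cst P); apply: eq_Rintegral => w _.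
have [bs|sb] := leP (tt i.+1) s.
  apply: zero => w; rewrite /D.
  have as_ := le_trans ii bs.
  rewrite !min_l//; first by rewrite subrr mul0r.
  - exact: le_trans as_ st.
  - exact: le_trans bs st.
have hmin : s <= Num.min (tt i.+1) t by rewrite le_min (ltW sb).
have hminT : Num.min (tt i.+1) t <= T by rewrite ge_min i4.
(* If the interval straddles [s], the remaining increment starts at [s]; otherwise it starts at
   [tt i], where [h] is already known. *)
have [as_|sa] := leP (tt i) s.
  have ghh : mg (F s) (fun w => hh i w * h w).
    apply: measurable_funM => //.
    by apply: (mg_filtration_mono hF i1 as_ _ (si_h_mg i_n)); case/andP: sT'.
  have Lhh : L1 P (fun w => hh i w * h w).
    by apply: (@L1_mul_bounded _ _ _ _ _ _ C) => //; exact: L2_L1.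
  rewrite -(zM s0 hmin hminT ghh Lhh); apply: eq_Rintegral => w _; rewrite /D.
  have ms : Num.min (tt i.+1) s = s by rewrite min_r// ltW.
  have ma : Num.min (tt i) s = tt i by rewrite min_l.
  have mat : Num.min (tt i) t = tt i by rewrite min_l// (le_trans as_).
  by rewrite ms ma mat; ring.
have [at_|ta] := leP (tt i) t; last first.
  apply: zero => w; rewrite /D.
  have h1 : s < tt i.+1 := sb.
  rewrite (min_r (ltW sb)) (min_r (ltW sa)) (min_r (ltW ta)).
  by rewrite min_r ?(le_trans (ltW ta))//; ring.
have ghh : mg (F (tt i)) (fun w => hh i w * h w).
  apply: measurable_funM; first exact: si_h_mg.
  exact: (mg_filtration_mono hF s0 (ltW sa) i2 gh).
have Lhh : L1 P (fun w => hh i w * h w).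
  by apply: (@L1_mul_bounded _ _ _ _ _ _ C) => //; exact: L2_L1.
have hmin2 : tt i <= Num.min (tt i.+1) t by rewrite le_min ii.
rewrite -(zM i1 hmin2 hminT ghh Lhh); apply: eq_Rintegral => w _; rewrite /D.
have ms : Num.min (tt i.+1) s = s by rewrite min_r// ltW.
have ma : Num.min (tt i) s = s by rewrite min_r// ltW.
have mat : Num.min (tt i) t = tt i by rewrite min_l.
by rewrite ms ma mat; ring.
Qed.

End simple.

(** Orthogonality of increments to the past is a statement on inner products, preserved by L2 limits
    of the simple integrals. *)
Lemma ito_martingale Q J : is_ito_integral P T F Q M J ->
  (forall t, 0 <= t <= T -> mg (F t) (J t) /\ L2 P (J t)) /\
  forall s t h, 0 <= s -> s <= t -> t <= T -> mg (F s) h -> L2 P h ->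
    \int[P]_w ((J t w - J s w) * h w) = 0.
Proof.
move=> [aJ [H [_ cvJ]]].
have gJ t : 0 <= t <= T -> mg (F t) (J t).
  by move=> tT; apply/(mgP _ (filtration_sigma hF tT)); exact: aJ.
have app t e : 0 <= t <= T -> 0 < e -> \forall k \near \oo,
    L2 P (fun w => si_integral (H k) M t w - J t w) /\
    Num.sqrt (\int[P]_w ((si_integral (H k) M t w - J t w) ^+ 2)) < e.
  move=> tT e0.
  have : \forall k \near \oo, (norm2 P (fun w => si_integral (H k) M t w - J t w)%R < e%:E)%E.
    by apply: cvg0_lt => //; exact: cvJ.
  apply: filterS => k hk; apply: norm2_lt => //.
  by apply: measurable_funB; [exact: L2_meas (si_integral_L2 _ tT)|exact: (meas_F hF tT (gJ t tT))].
have LJ t : 0 <= t <= T -> L2 P (J t).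
  move=> tT; have [k _ /(_ k (leqnn k)) [hk _]] := app t 1 tT ltr01.
  have -> : J t = (fun w => si_integral (H k) M t w - (si_integral (H k) M t w - J t w)).
    by apply/funext => w; rewrite subKr.
  by apply: L2B => //; exact: si_integral_L2.
split; first by move=> t tT; split; [exact: gJ|exact: LJ].
move=> s t h s0 st tT gh Lh.
have tT' : 0 <= t <= T by rewrite (le_trans s0).
have sT' : 0 <= s <= T by rewrite s0 (le_trans st).
apply/eqP; rewrite -normr_eq0 -[_ == _]negbK; apply/negP => nz.
set I := `|_| in nz.
have I0 : 0 < I by rewrite lt_neqAle eq_sym nz normr_ge0.
set nh := Num.sqrt (\int[P]_w (h w ^+ 2)).
have nh0 : 0 <= nh by exact: sqrtr_ge0.
(* Two errors of size e |h| must add up to less than [I]; the added 1 covers the case |h| = 0. *)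
pose e := I / (2 * (nh + 1)).
have e0 : 0 < e by rewrite divr_gt0// mulr_gt0// ltr_wpDl.
have [k [[ht ht'] [hs hs']]] : exists k,
    (L2 P (fun w => si_integral (H k) M t w - J t w) /\
     Num.sqrt (\int[P]_w ((si_integral (H k) M t w - J t w) ^+ 2)) < e) /\
    (L2 P (fun w => si_integral (H k) M s w - J s w) /\
     Num.sqrt (\int[P]_w ((si_integral (H k) M s w - J s w) ^+ 2)) < e).
  have := filterI (app t e tT' e0) (app s e sT' e0).
  by case=> k _ /(_ k (leqnn k)) h0; exists k.
have ct := cauchy_schwarz_sqrt ht Lh; have cs := cauchy_schwarz_sqrt hs Lh.
rewrite -/nh in ct cs.
have z := si_martingale (H k) s0 st tT gh Lh.
have Lt := si_integral_L2 (H k) tT'; have Ls := si_integral_L2 (H k) sT'.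
have : I <= `|\int[P]_w ((si_integral (H k) M t w - J t w) * h w)| +
            `|\int[P]_w ((si_integral (H k) M s w - J s w) * h w)|.
  apply: le_trans (ler_normB _ _).
  rewrite -exB; [|exact: L2_mul|exact: L2_mul].
  rewrite /I -normrN -exN; last by apply: L2_mul => //; apply: L2B; exact: LJ.
  rewrite -[X in `|X|]add0r -{1}z -exD; last 2 first.
  - by apply: L2_mul => //; apply: L2B.
  - by apply: L1N; apply: L2_mul => //; apply: L2B; exact: LJ.
  by rewrite le_eqVlt; apply/orP; left; apply/eqP; congr (`|_|);
    apply: eq_Rintegral => w _; ring.
move=> hI.
have : I < I.
  apply: le_lt_trans hI _.
  have b1 : `|\int[P]_w ((si_integral (H k) M t w - J t w) * h w)| <= e * nh.
    by apply: le_trans ct _; rewrite ler_wpM2r// ltW.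
  have b2 : `|\int[P]_w ((si_integral (H k) M s w - J s w) * h w)| <= e * nh.
    by apply: le_trans cs _; rewrite ler_wpM2r// ltW.
  apply: le_lt_trans (lerD b1 b2) _.
  rewrite -mulrDr /e mulrAC ltr_pdivrMr ?mulr_gt0 ?ltr_wpDl//.
  by rewrite ltr_pM2l//; lra.
by rewrite ltxx.
Qed.

End ito_integral.

(** * Consequences of the forward-backward equations *)

Section fbsde.
Context {R : realType} {d} {Om : measurableType d} (P : probability Om R).
Variables (T : R) (F : R -> set (set Om)) (W W' : R -> Om -> R).
Hypothesis T_gt0 : (0 : R) < T.
Hypothesis hF : complete_filtration P T F.
Hypothesis hW : independent_brownian_motions P T F W W'.
Variables (x0 : Om -> R) (N : R -> Om -> R) (G : Om -> R) (X Y Z Z' : R -> Om -> R).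
Hypothesis hS : fbsde_solution P T F W W' x0 N G X Y Z Z'.
Local Notation mu := (time_law T_gt0).
Local Notation cY := (cutoff T Y).

Let T0 : (0 : R) <= T. Proof. exact: ltW. Qed.

Lemma fbsde_mgX t : 0 <= t <= T -> mg (F t) (X t).
Proof.
move=> tT; case: hS => [[[aX _ _] _ _ _] _ _ _ _].
by apply/(mgP _ (filtration_sigma hF tT)); exact: aX.
Qed.

Lemma fbsde_mgY t : 0 <= t <= T -> mg (F t) (Y t).
Proof.
move=> tT; case: hS => [[_ [aY _ _] _ _] _ _ _ _].
by apply/(mgP _ (filtration_sigma hF tT)); exact: aY.
Qed.

Lemma fbsde_measY t : 0 <= t <= T -> measurable_fun setT (Y t).
Proof. by move=> tT; exact: (meas_F hF tT (fbsde_mgY tT)). Qed.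

Lemma fbsde_process : measurable_fun (`[0, T]%classic `*` [set: Om])
    (fun p : R * Om => Y p.1 p.2) /\
  (\int[P]_w \int[lebesgue_measure]_(s in `[0%R, T]) ((Y s w) ^+ 2)%:E < +oo)%E.
Proof.
case: hS => [[_ [_ mY iY] _ _] _ _ _ _]; split; first exact: mY.
have e : dist_dtdP P T Y (fun _ _ => 0) =
    (\int[P]_w \int[lebesgue_measure]_(s in `[0%R, T]) ((Y s w) ^+ 2)%:E)%E.
  by apply: eq_integral => w _; apply: eq_integral => s _; rewrite subr0.
by rewrite -e.
Qed.

Let increments (V : R -> Om -> R) :
  (forall s t, 0 <= s -> s < t -> t <= T -> L2 P (fun w => V t w - V s w)) ->
  forall s t, 0 <= s -> s <= t -> t <= T -> L2 P (fun w => V t w - V s w).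
Proof.
move=> h s t s0; rewrite le_eqVlt => /orP[/eqP ->|st] tT; last exact: h.
by under eq_fun do rewrite subrr; exact: L2_cst.
Qed.

Let zeros (V : R -> Om -> R) :
  (forall s t (H : Om -> R), 0 <= s -> s < t -> t <= T -> mg (F s) H -> L1 P H ->
     \int[P]_w (H w * (V t w - V s w)) = 0) ->
  forall s t (H : Om -> R), 0 <= s -> s <= t -> t <= T -> mg (F s) H -> L1 P H ->
     \int[P]_w (H w * (V t w - V s w)) = 0.
Proof.
move=> h s t H s0; rewrite le_eqVlt => /orP[/eqP ->|st] tT gH hH; last exact: h.
by rewrite -[RHS](ex_cst P); apply: eq_Rintegral => w _; rewrite subrr mulr0.
Qed.

Let Y_decomp : exists J : R -> Om -> R,
  [/\ forall t, 0 <= t <= T -> L2 P (J t),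
      forall s t h, 0 <= s -> s <= t -> t <= T -> mg (F s) h -> L2 P h ->
        \int[P]_w ((J t w - J s w) * h w) = 0 &
      forall t, 0 <= t <= T -> {ae P, forall w, Y t w = Y 0 w + J t w}].
Proof.
case: hS => _ _ _ [J [J' [hJ hJ' hY]]] _.
have [J1 J2] := ito_martingale hF
  (increments (fun s t a b c => L2_increment hF hW a b c))
  (zeros (fun s t H a b c g h => proj2 (increment_mul hF hW a b c g h))) hJ.
have [J1' J2'] := ito_martingale hF
  (increments (fun s t a b c => L2_increment' hF hW a b c))
  (zeros (fun s t H a b c g h => proj2 (increment'_mul hF hW a b c g h))) hJ'.
exists (fun t w => J t w + J' t w); split.
- by move=> t tT; apply: L2D; [have [] := J1 t tT|have [] := J1' t tT].
- move=> s t h s0 st tT gh Lh.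
  have tT' : 0 <= t <= T by rewrite (le_trans s0).
  have sT' : 0 <= s <= T by rewrite s0 (le_trans st).
  have [_ j1] := J1 t tT'; have [_ j2] := J1 s sT'.
  have [_ j1'] := J1' t tT'; have [_ j2'] := J1' s sT'.
  have l1 := L2_mul (L2B j1 j2) Lh; have l2 := L2_mul (L2B j1' j2') Lh.
  rewrite -[RHS]addr0 -{1}(J2 s t h s0 st tT gh Lh) -(J2' s t h s0 st tT gh Lh).
  by rewrite -exD//; apply: eq_Rintegral => w _; ring.
- by move=> t tT; have := hY t tT; apply: filterS => w ->; rewrite addrA.
Qed.

(** Square integrability in dt dP provides one good time. The martingale part is square integrable
    at all times and carries the property back to time 0, then to [t]. *)
Lemma fbsde_L2Y t : 0 <= t <= T -> L2 P (Y t).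
Proof.
have [J [LJ _ hY]] := Y_decomp.
have O0T : 0 <= (0 : R) <= T by rewrite lexx.
have LY0 : L2 P (Y 0).
  have [mY iY] := fbsde_process.
  have [s sT Ls] := L2_at_some_time T_gt0 mY iY fbsde_measY.
  apply: (@L2_ae _ _ _ _ (fun w => Y s w - J s w)); first exact: fbsde_measY.
    by have := hY s sT; apply: filterS => w ->; rewrite addrK.
  by apply: L2B => //; exact: LJ.
move=> tT; apply: (@L2_ae _ _ _ _ (fun w => Y 0 w + J t w)); first exact: fbsde_measY.
  by have := hY t tT; apply: filterS => w ->.
by apply: L2D => //; exact: LJ.
Qed.

Lemma fbsde_martingale s t h : 0 <= s -> s <= t -> t <= T -> mg (F s) h -> L2 P h ->
  \int[P]_w (Y t w * h w) = \int[P]_w (Y s w * h w).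
Proof.
move=> s0 st tT gh Lh; have [J [LJ hJ hY]] := Y_decomp.
have tT' : 0 <= t <= T by rewrite (le_trans s0).
have sT' : 0 <= s <= T by rewrite s0 (le_trans st).
have Lt := fbsde_L2Y tT'; have Ls := fbsde_L2Y sT'.
have l := L2_mul (L2B (LJ t tT') (LJ s sT')) Lh.
apply/eqP; rewrite -subr_eq0 -exB; [|exact: L2_mul|exact: L2_mul].
apply/eqP; rewrite -[RHS](hJ s t h s0 st tT gh Lh); apply: ex_ae.
- exact: L1_meas (L1B (L2_mul Lt Lh) (L2_mul Ls Lh)).
- exact: L1_meas l.
- have h1 := hY t tT'; have h2 := hY s sT'.
  by apply: filterS2 h1 h2 => w -> ->; ring.
Qed.

(** The weak form of the forward equation at time T: the drift enters through a time integral of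
    inner products, to which the martingale property of [Y] can be applied. *)
Lemma fbsde_forward : L2 P x0 -> L2 P (N T) ->
  L2 P (X T) /\ forall V, L2 P V ->
    L1 mu (fun s => \int[P]_w (cY s w * V w)) /\
    \int[P]_w (X T w * V w) = \int[P]_w ((x0 w + N T w) * V w) -
      T * \int[mu]_s \int[P]_w (cY s w * V w).
Proof.
move=> Lx LN; have TT : 0 <= T <= T by rewrite T0 lexx.
have [mY iY] := fbsde_process.
have mXT : measurable_fun setT (X T) by exact: (meas_F hF TT (fbsde_mgX TT)).
have hX : {ae P, forall w, x0 w + N T w -
    \int[lebesgue_measure]_(s in `[0%R, T]) Y s w = X T w}.
  case: hS => _ _ /(_ T TT) + _ _; apply: filterS => w ->; ring.
have [LI _ _] := time_fubini T_gt0 mY iY (L2_cst P 0).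
have LX : L2 P (X T).
  by apply: (L2_ae mXT hX); apply: L2B => //; exact: L2D.
split => // V LV.
have [_ l e] := time_fubini T_gt0 mY iY LV.
split => //; rewrite -e.
rewrite -exB; [|exact: L2_mul (L2D Lx LN) LV|exact: L2_mul].
apply: ex_ae.
- exact: L1_meas (L2_mul LX LV).
- exact: L1_meas (L1B (L2_mul (L2D Lx LN) LV) (L2_mul LI LV)).
- by apply: filterS hX => w <-; ring.
Qed.

End fbsde.

(** * The terminal state of the 0-MFG system *)

Section ae_tools.
Context {R : realType} {d} {Om : measurableType d} (P : probability Om R).

Lemma ae_const (Q : Prop) : {ae P, forall w : Om, Q} -> Q.
Proof.
move=> h; apply: contrapT => nQ; apply: (@ae_contradiction _ _ _ P).
by apply: filterS h.
Qed.

Lemma ex_mul_eq0 (f g : Om -> R) : L2 P f -> L2 P g ->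
  \int[P]_w (f w ^+ 2) = 0 -> \int[P]_w (f w * g w) = 0.
Proof.
move=> hf hg f0; have := cauchy_schwarz hf hg; rewrite f0 mul0r.
move=> h; apply/eqP; rewrite -sqrf_eq0 eq_le h sqr_ge0//.
Qed.

End ae_tools.

Section state_measurability.
Context {R : realType} (T : R) {d0} {Om0 : measurableType d0}
  {dt} {Omt : measurableType dt}.
Variables (P0 : probability Om0 R) (Pt : probability Omt R).
Local Notation Om := (Om0 * Omt)%type.
Local Notation P := ((P0 \x Pt)%E : probability (Om0 * Omt)%type R).
Variables (F : R -> set (set Om)) (W : R -> Om0 -> R) (B : R -> Omt -> R).
Variable xi0 : Om0 -> R.
Hypothesis T_gt0 : (0 : R) < T.
Hypothesis hF : complete_filtration P T F.
Local Notation iW := (fun t (w : Om) => W t w.1).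
Local Notation iB := (fun t (w : Om) => B t w.2).
Hypothesis hW : independent_brownian_motions P T F iW iB.
Hypothesis xi_F0 : measurable_wrt (F 0) (fun w : Om => xi0 w.1).
Local Notation cyl0 := (cylinder W xi0).
Let T0 : (0 : R) <= T. Proof. exact: ltW. Qed.
Let T0T : 0 <= T <= T. Proof. by rewrite T0 lexx. Qed.

Lemma ae_fstV (Q : Om0 -> Prop) : {ae P, forall w : Om, Q w.1} -> {ae P0, forall w, Q w}.
Proof.
move=> h; have /ae_section h1 := h.
by apply: filterS h1 => w0 h2; apply: (@ae_const _ _ _ Pt).
Qed.

Lemma ae_sndV (Q : Omt -> Prop) : {ae P, forall w : Om, Q w.2} -> {ae Pt, forall w, Q w}.
Proof.
move=> h; have /ae_section h1 := h.
by apply: (@ae_const _ _ _ P0); apply: filterS h1.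
Qed.

Lemma L2_W_T : L2 P0 (W T).
Proof.
have L := L2_increment hF hW (lexx 0) T_gt0 (lexx T).
have mWT := meas_W hF hW T0T.
apply/(L2_fst P0 Pt); apply: (L2_ae _ _ L).
  exact: (measurableT_comp mWT measurable_fst).
case: hW => _ _ + _; apply: filterS => w /= [e _]; by rewrite e subr0.
Qed.

Lemma L2_B_T : L2 Pt (B T).
Proof.
have L := L2_increment' hF hW (lexx 0) T_gt0 (lexx T).
apply/(L2_snd P0 Pt); apply: (L2_ae _ _ L).
  exact: (meas_F hF T0T (mg_W' hF hW T0T)).
case: hW => _ _ + _; apply: filterS => w /= [_ e]; by rewrite e subr0.
Qed.

Variables (phi : R -> R) (C : R).
Hypothesis phi_mono : forall x y, 0 <= (phi x - phi y) * (x - y).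
Hypothesis mphi : measurable_fun setT phi.
Hypothesis phi_lin : forall x, `|phi x| <= C * (1 + `|x|).

Lemma L2_phi d (E : measurableType d) (m : probability E R) (f : E -> R) :
  L2 m f -> L2 m (fun w => phi (f w)).
Proof.
move=> hf; have hf' : L2 m (fun w => `|f w|).
  apply: (L2_le _ hf) => [|w]; last by rewrite normr_id.
  by apply: measurableT_comp => //; exact: L2_meas hf.
apply: (@L2_le _ _ _ _ _ (fun w => C * (1 + `|f w|))).
- by apply: (measurableT_comp mphi); exact: L2_meas hf.
- by apply: L2Z; apply: L2D => //; exact: L2_cst.
- by move=> w; apply: le_trans (phi_lin _) (ler_norm _).
Qed.

Variables (sigma : R) (X0 : R -> Om0 -> R) (Y Z Z' : R -> Om -> R) (G : Om -> R).
Hypothesis xi_L2 : L2 P0 xi0.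
Hypothesis hS : fbsde_solution P T F iW iB (fun w => xi0 w.1)
  (fun t w => sigma * W t w.1) G (fun t w => X0 t w.1) Y Z Z'.
Hypothesis hG : {ae P, forall w, G w = phi (X0 T w.1)}.

(* The terminal state of the 0-MFG system is a function of the initial state
   and the idiosyncratic noise: conditioning on these is a contraction that
   does not increase the convex cost. *)
Lemma state_measurable : exists c : Om0 -> R,
  [/\ mg (cyl0 T) c, L2 P0 c & {ae P0, forall w, X0 T w = c w}].
Proof.
pose mu := time_law T_gt0.
have LN : L2 P (fun w => sigma * W T w.1).
  by apply: (L2Z _ (f := fun w : Om => W T w.1)); apply/(L2_fst P0 Pt); exact: L2_W_T.
have Lx : L2 P (fun w => xi0 w.1) by apply/(L2_fst P0 Pt).
have [LX hX] := fbsde_forward T_gt0 hF hS Lx LN.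
have LYs s : 0 <= s <= T -> L2 P (Y s) := fbsde_L2Y T_gt0 hF hW hS (t := s).
have gYs s : 0 <= s <= T -> mg (F s) (Y s) := fbsde_mgY hF hS (t := s).
have LYT := LYs T T0T.
have YTE : {ae P, forall w, phi (X0 T w.1) = Y T w}.
  by case: hS => _ _ _ _ h; apply: filterS2 h hG => w -> ->.
have [c [gc Lc hc]] := idio_proj T_gt0 hF hW xi_F0 T0T (fbsde_mgX hF hS T0T) LX.
have [cY [gcY LcY hcY]] := idio_proj T_gt0 hF hW xi_F0 T0T (gYs T T0T) LYT.
have l1 (f : Om0 -> R) : L2 P0 f -> L2 P (fun w => f w.1) by move=> hf; apply/(L2_fst P0 Pt).
pose D (w : Om) := X0 T w.1 - c w.1.
pose DY (w : Om) := Y T w - cY w.1.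
have LD : L2 P D by apply: L2B => //; exact: l1.
have LDY : L2 P DY by apply: L2B => //; exact: l1.
have orthD eta : mg (cyl0 T) eta -> L2 P0 eta -> \int[P]_w (D w * eta w.1) = 0 := hc eta.
have orthDY eta : mg (cyl0 T) eta -> L2 P0 eta -> \int[P]_w (DY w * eta w.1) = 0 := hcY eta.
have gphi : mg (cyl0 T) (fun w => phi (c w)) by exact: (measurableT_comp mphi gc).
have Lphic := L2_phi Lc.
(* Both sides equal E[D DY], as each residual is orthogonal to the projection of the other
   variable. *)
have Ydx : \int[P]_w (Y T w * D w) = \int[P]_w (X0 T w.1 * DY w).
  have e1 : \int[P]_w (D w * cY w.1) = 0 by exact: orthD.
  have e2 : \int[P]_w (DY w * c w.1) = 0 by exact: orthDY.
  rewrite -[LHS]subr0 -e1 -[RHS]subr0 -e2 -!exB; try (by apply: L2_mul => //; exact: l1).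
  by apply: eq_Rintegral => w _; rewrite /D /DY; ring.
(* phi(c) is idiosyncratic, hence orthogonal to [D], and may be subtracted from Y_T = phi(X_T);
   monotonicity of [phi] then applies. *)
have pos : 0 <= \int[P]_w (Y T w * D w).
  have e : \int[P]_w (Y T w * D w) = \int[P]_w (Y T w * D w - D w * phi (c w.1)).
    rewrite exB; [|exact: L2_mul|exact: L2_mul LD (l1 _ Lphic)].
    by rewrite (orthD _ gphi Lphic) subr0.
  have mm : measurable_fun setT (fun w => (phi (X0 T w.1) - phi (c w.1)) * D w).
    apply: measurable_funM; last exact: L2_meas LD.
    by apply: measurable_funB; [exact: L2_meas (L2_phi LX)|exact: L2_meas (l1 _ Lphic)].
  rewrite e; have -> : \int[P]_w (Y T w * D w - D w * phi (c w.1)) =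
      \int[P]_w ((phi (X0 T w.1) - phi (c w.1)) * D w).
    apply: ex_ae => //.
    - exact: L1_meas (L1B (L2_mul LYT LD) (L2_mul LD (l1 _ Lphic))).
    - by apply: filterS YTE => w <-; ring.
  by apply: ex_ge0 => w; exact: phi_mono.
have orth0 (f g : Om -> R) (cc : Om0 -> R) : L2 P f -> L2 P g -> L2 P0 cc ->
    \int[P]_w (g w * cc w.1) = 0 ->
    \int[P]_w (f w * g w) = \int[P]_w ((f w - cc w.1) * g w).
  move=> hf hg hcc e; have hcc' := l1 _ hcc.
  rewrite -[LHS]subr0 -e -exB; [|exact: L2_mul|exact: L2_mul].
  by apply: eq_Rintegral => w _; ring.
have [lY eY] := hX DY LDY.
have Weta : \int[P]_w ((xi0 w.1 + sigma * W T w.1) * DY w) = 0 /\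
    \int[P]_w ((xi0 w.1 + sigma * W T w.1) * D w) = 0.
  have ge : mg (cyl0 T) (fun w => xi0 w + sigma * W T w).
    apply: measurable_funD; first exact: mg_cyl_xi0.
    by apply: measurable_funM => //; exact: mg_cyl_W.
  have Le : L2 P0 (fun w => xi0 w + sigma * W T w).
    by apply: L2D => //; apply: L2Z; exact: L2_W_T.
  split.
    by rewrite -[RHS](orthDY _ ge Le); apply: eq_Rintegral => w _; rewrite mulrC.
  by rewrite -[RHS](orthD _ ge Le); apply: eq_Rintegral => w _; rewrite mulrC.
have [Weta1 Weta2] := Weta.
(* The residual Y_s - c_s is [F s]-measurable by immersion, so the martingale property reduces its
   pairing with Y_T to a square. *)
have proj s : 0 <= s <= T -> exists cs : Om0 -> R,
    [/\ L2 P0 cs, mg (cyl0 T) cs,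
        \int[P]_w (Y s w * DY w) = \int[P]_w ((Y s w - cs w.1) ^+ 2)
      & \int[P]_w (Y s w * D w) = \int[P]_w ((Y s w - cs w.1) * D w)].
  move=> sT; have [s0 sT'] := andP sT.
  have [cs [gcs Lcs hcs]] := idio_proj T_gt0 hF hW xi_F0 sT (gYs s sT) (LYs s sT).
  have gcsT : mg (cyl0 T) cs by exact: mg_cyl_mono gcs.
  have Lcs' := l1 _ Lcs.
  have LDs : L2 P (fun w => Y s w - cs w.1) by apply: L2B => //; exact: LYs.
  have gDs : mg (F s) (fun w => Y s w - cs w.1).
    by apply: measurable_funB; [exact: gYs|exact: (mg_fst hF hW xi_F0 sT gcs)].
  exists cs; split => //; last by apply: orth0 => //; [exact: LYs|exact: orthD].
  rewrite (orth0 _ _ cs (LYs s sT) LDY Lcs (orthDY _ gcsT Lcs)).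
  transitivity (\int[P]_w (Y T w * (Y s w - cs w.1))).
    rewrite -[LHS]addr0 -(hcs cY gcY LcY) -exD; last 2 first.
    - exact: L2_mul.
    - by apply: L2_mul => //; exact: l1.
    by apply: eq_Rintegral => w _; rewrite /DY; ring.
  rewrite (fbsde_martingale T_gt0 hF hW hS s0 sT' (lexx T) gDs LDs).
  rewrite -[LHS]subr0 -(hcs cs gcsT Lcs) -exB; last 2 first.
  - by apply: L2_mul => //; exact: LYs.
  - exact: L2_mul.
  by apply: eq_Rintegral => w _; ring.
have cutE s (V : Om -> R) : 0 <= s <= T ->
    \int[P]_w (cutoff T Y s w * V w) = \int[P]_w (Y s w * V w).
  by move=> sT; apply: eq_Rintegral => w _; rewrite cutoff_in.
have cut0 s (V : Om -> R) : ~ (0 <= s <= T) -> \int[P]_w (cutoff T Y s w * V w) = 0.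
  move=> sT; rewrite -[RHS](ex_cst P); apply: eq_Rintegral => w _.
  by rewrite cutoff_out ?mul0r.
have g0 s : 0 <= \int[P]_w (cutoff T Y s w * DY w).
  have [sT|sT] := pselect (0 <= s <= T); last by rewrite cut0.
  have [cs [_ _ e _]] := proj s sT.
  by rewrite cutE// e; apply: ex_ge0 => w; exact: sqr_ge0.
(* The forward equation makes this time integral of squares equal to - E[X_T DY] / T <= 0, so it
   vanishes. *)
have int0 : \int[mu]_s \int[P]_w (cutoff T Y s w * DY w) = 0.
  apply/eqP; rewrite eq_le; apply/andP; split; last by apply: ex_ge0.
  move: pos; rewrite Ydx eY Weta1 sub0r oppr_ge0.
  by rewrite pmulr_rle0.
have ae0 := ex_eq0 lY g0 int0.
have [lX eX] := hX D LD.
(* Since Y_s = c_s for almost every s, the drift is orthogonal to [D], like the initial state and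
   the noise. Thus [D] is orthogonal to X_T and to [c], hence to itself. *)
have XD0 : \int[P]_w (X0 T w.1 * D w) = 0.
  rewrite eX Weta2 sub0r.
  rewrite (@ex_ae _ _ _ mu _ (fun=> 0)).
  - by rewrite ex_cst mulr0 oppr0.
  - exact: L1_meas lX.
  - exact: measurable_cst.
  - apply: filterS ae0 => s e0.
    have [sT|sT] := pselect (0 <= s <= T); last by rewrite cut0.
    have [cs [Lcs _ e1 e2]] := proj s sT.
    rewrite cutE// e2; apply: ex_mul_eq0 => //; last by rewrite -e1 -cutE.
    by apply: L2B; [exact: LYs|exact: l1].
exists c; split => //; apply: ae_fstV.
have : \int[P]_w (D w ^+ 2) = 0.
  rewrite -[RHS]subr0 -{1}XD0 -(orthD c gc Lc) -exB; [|exact: L2_mul|].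
    by apply: eq_Rintegral => w _; rewrite /D; ring.
  by apply: L2_mul => //; exact: l1.
move=> /(ex_sq_eq0 LD); apply: filterS => w /eqP; rewrite subr_eq0 => /eqP.
exact.
Qed.

End state_measurability.

(** * Wasserstein distance and conditional laws *)

Section real_laws.
Context {R : realType}.

(** A countable generator, so that equalities holding almost surely on each set hold
    simultaneously. *)
Definition rational_rays : set (set R) := [set A | exists q : rat, A = `]-oo, (ratr q)[%classic].

Lemma measurable_rational_rays : (measurable : set (set R)) = <<s rational_rays >>.
Proof.
apply: etrans (RGenInftyO.measurableE R) _; apply/seteqP; split.
  apply: smallest_sub; first exact: smallest_sigma_algebra.
  move=> A [x ->].
  have -> : `]-oo, x[%classic = \bigcup_(q : rat)
      (if (ratr q < x)%R then `]-oo, (ratr q)[%classic else set0).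
    apply/seteqP; split => y /=; rewrite in_itv/=.
      move=> /rat_in_itvoo[q]; rewrite in_itv/= => /andP[yq qx].
      by exists q => //; rewrite qx/= in_itv.
    by move=> [q _]; case: ifPn => //= qx; rewrite in_itv/= => /lt_trans; exact.
  apply: (@bigcupT_measurable_rat _ (g_sigma_algebraType rational_rays)) => q.
  case: ifPn => _; last exact: measurable0.
  by apply: sub_sigma_algebra; exists q.
apply: smallest_sub; first exact: smallest_sigma_algebra.
by move=> A [q ->]; apply: sub_sigma_algebra; exists (ratr q).
Qed.

Lemma prob_determined_rays (m1 m2 : probability R R) :
  (forall q : rat, m1 `]-oo, (ratr q)[%classic = m2 `]-oo, (ratr q)[%classic) ->
  forall A, measurable A -> m1 A = m2 A.
Proof.
move=> h A mA.
apply: (measure_unique rational_rays (fun n : nat => `]-oo, (ratr n%:R)[%classic)) => //.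
- exact: measurable_rational_rays.
- move=> X Y [x ->] [y ->]; exists (Num.min x y).
  apply/seteqP; split => z /=; rewrite !in_itv/=.
    by case=> zx zy; rewrite minEle; case: ifP.
  have [xy|yx] := leP x y => h1; split => //.
    by apply: lt_le_trans h1 _; rewrite ler_rat.
  by apply: lt_trans h1 _; rewrite ltr_rat.
- by move=> n; exists n%:R.
- apply/seteqP; split => // x _; exists (Num.truncn x).+1 => //=.
  by rewrite in_itv/= ratr_nat truncnS_gt.
- by move=> X [q ->]; exact: h.
- by move=> n; rewrite (le_lt_trans (probability_le1 _ _))// ltry.
Qed.

Lemma exists_P2_law d (E : measurableType d) (P : probability E R) (X : E -> R) :
  L2 P X -> exists m : P2 R, has_law P X m.
Proof.
move=> hX; have [m hm] := exists_law P (L2_meas hX).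
have m2 : (\int[m]_x (x ^+ 2)%:E < +oo)%E.
  rewrite (ge0_integral_law (L2_meas hX) hm).
  - by rewrite -EFin_ex ?ltry//; exact: L2_sq.
  - by apply/measurable_EFinP; exact: measurable_funX.
  - by move=> y; rewrite lee_fin sqr_ge0.
by exists (MkP2 m2).
Qed.

(** The law of the pair (X, Y) is one of the couplings in the infimum. *)
Lemma W2_le d (E : measurableType d) (P : probability E R) (X Y : E -> R) (m m' : P2 R) :
  measurable_fun setT X -> measurable_fun setT Y -> L2 P (fun w => X w - Y w) ->
  has_law P X m -> has_law P Y m' ->
  W2 m m' <= Num.sqrt (\int[P]_w ((X w - Y w) ^+ 2)).
Proof.
move=> mX mY LXY hX hY.
have mXY : measurable_fun setT (fun w => (X w, Y w)) by exact: measurable_fun_pair.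
have [gam hgam] := exists_law P mXY.
have cg : coupling m m' gam.
  split=> A mA.
  - by rewrite -hgam -?hX// -[X in measurable X]setTI; exact: measurable_fst.
  - by rewrite -hgam -?hY// -[X in measurable X]setTI; exact: measurable_snd.
apply: ler_wsqrtr; rewrite -lee_fin (EFin_ex (L2_sq LXY)).
have e : (\int[gam]_z ((z.1 - z.2) ^+ 2)%:E = \int[P]_w ((X w - Y w) ^+ 2)%:E)%E.
  rewrite (ge0_integral_law mXY hgam)//.
  - apply/measurable_EFinP; apply: measurable_funX.
    by apply: measurable_funB; [exact: measurable_fst|exact: measurable_snd].
  - by move=> z; rewrite lee_fin sqr_ge0.
have ge0 (y : \bar R) : [set (\int[gam]_z ((z.1 - z.2) ^+ 2)%:E)%E | gam in coupling m m'] y ->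
    (0 <= y)%E.
  by move=> [ga _ <-]; apply: integral_ge0 => z _; rewrite lee_fin sqr_ge0.
have inf_le : (ereal_inf [set (\int[gam]_z ((z.1 - z.2) ^+ 2)%:E)%E | gam in coupling m m']
    <= \int[P]_w ((X w - Y w) ^+ 2)%:E)%E.
  by rewrite -e; apply: ereal_inf_lbound; exists gam.
rewrite fineK// ge0_fin_numE.
- by apply: le_lt_trans inf_le _; rewrite -EFin_ex ?ltry//; exact: L2_sq.
- by apply: le_ereal_inf_tmp => y; exact: ge0.
Qed.

Lemma W2_eq0 (m m' : P2 R) : (forall A, measurable A -> m A = m' A) -> W2 m m' = 0.
Proof.
move=> h; apply/eqP; rewrite eq_le sqrtr_ge0 andbT.
have L0 : L2 m (fun x : R => x - x).
  by under eq_fun do rewrite subrr; exact: L2_cst.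
apply: le_trans (@W2_le _ _ m id id m m' _ _ L0 _ _) _ => //.
under eq_Rintegral do rewrite subrr expr0n/=.
by rewrite (ex_cst m) sqrtr0.
Qed.

End real_laws.

(** * Conditional law of an idiosyncratic variable given the common noise *)

Section conditional_law.
Context {R : realType} {d0} {Om0 : measurableType d0} {dt} {Omt : measurableType dt}.
Variables (P0 : probability Om0 R) (Pt : probability Omt R).
Local Notation Om := (Om0 * Omt)%type.
Local Notation P := ((P0 \x Pt)%E : probability (Om0 * Omt)%type R).

(** [X] lives on the first factor and the conditioning on the second, so the conditional law is the
    law. This is obtained for each Borel set, then for all of them through the rational rays. *)
Lemma conditional_law_indep (Gt : set (set Omt)) (X : Om0 -> R) (mu : Om -> P2 R) (m : P2 R) :
  Gt `<=` measurable -> measurable_fun setT X ->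
  is_conditional_law P [set snd @^-1` A | A in Gt] (fun w => X w.1) mu ->
  has_law P0 X m -> {ae P, forall w, forall A, measurable A -> mu w A = m A}.
Proof.
move=> hG mX [mmu hmu] hX.
pose H := [set snd @^-1` A | A in Gt] : set (set Om).
have HM : H `<=` measurable.
  move=> _ [A /hG mA <-]; rewrite -[X in measurable X]setTI; exact: measurable_snd.
have one (B : set R) : measurable B -> {ae P, forall w, mu w B = m B}.
  move=> mB; pose f (w : Om) : R := fine (mu w B).
  have fE w : mu w B = (f w)%:E by rewrite /f fineK// fin_num_measure.
  pose c : R := fine (m B).
  have cE : m B = c%:E by rewrite /c fineK// fin_num_measure.
  have mf : measurable_fun setT f.
    move=> _ A mA; rewrite setTI; apply: HM; exact: mmu.
  have Lf : L1 P f.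
    apply: (@L1_bounded _ _ _ _ _ 1) => // w.
    rewrite ger0_norm ?fine_ge0//.
    by rewrite -lee_fin -fE probability_le1.
  have L (a : R) : L1 P (fun w => a * (f w - c)) by apply: L1Z; apply: L1B => //; exact: L1_cst.
  have int0 A : H A -> \int[P]_w (\1_A w * (f w - c)) = 0.
    move=> HA; have mA := HM A HA.
    under eq_Rintegral do rewrite mulrBr.
    rewrite exB; [|exact: L1_indic_mul|by apply: L1_indic_mul => //; exact: L1_cst].
    under [X in _ - X]eq_Rintegral do rewrite mulrC.
    rewrite exZ; last exact: L1_indic.
    rewrite ex_indic// ex_indic_mul /Rintegral.
    have -> : (\int[P]_(w in A) (f w)%:E = P (A `&` (fun w => X w.1) @^-1` B))%E.
      by rewrite hmu//; apply: eq_integral => w _; rewrite fE.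
    case: HA => A' GA' AE; have mA' := hG A' GA'.
    have -> : P (A `&` (fun w => X w.1) @^-1` B) = (m B * Pt A')%E.
      have mXB : measurable (X @^-1` B) by rewrite -[Y in measurable Y]setTI; exact: mX.
      have -> : A `&` (fun w : Om => X w.1) @^-1` B = (X @^-1` B) `*` A'.
        by rewrite -AE; apply/seteqP; split => w /= [].
      by rewrite /= product_measure1E//; congr (_ * _)%E; exact: hX.
    have -> : P A = Pt A'.
      have -> : A = setT `*` A' by rewrite -AE; apply/seteqP; split => w //= [].
      by rewrite /= product_measure1E// -[RHS]mul1e; congr (_ * _)%E; exact: probability_setT.
    by rewrite cE fineM ?fin_num_measure//= subrr.
  (* The set where a (f - c) is positive belongs to [H], and f - c integrates to zero over it; a = 1
     and a = -1 together give f = c. *)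
  have half (a : R) : {ae P, forall w, a * (f w - c) <= 0}.
    pose A := [set w : Om | 0 < a * (f w - c)].
    have HA : H A.
      have mh : measurable_fun setT (fun x : R => a * (x - c)).
        by apply: measurable_funM => //; exact: measurable_funB.
      have : measurable [set x : R | 0 < a * (x - c)].
        rewrite (_ : [set x : R | _] = (fun x : R => a * (x - c)) @^-1` `]0, +oo[%classic).
          by rewrite -[Y in measurable Y]setTI; apply: mh.
        by apply/seteqP; split => x /=; rewrite in_itv/= andbT.
      exact: (mmu B mB).
    have := @ex_eq0 _ _ _ P (fun w => \1_A w * (a * (f w - c))).
    have -> : \int[P]_w (\1_A w * (a * (f w - c))) = 0.
      under eq_Rintegral do rewrite mulrCA.
      rewrite exZ ?int0 ?mulr0//.
      apply: L1_indic_mul; first exact: HM.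
      by apply: L1B => //; exact: L1_cst.
    move=> h; have : {ae P, forall w, \1_A w * (a * (f w - c)) = 0}.
      apply: h => //; first by apply: L1_indic_mul => //; exact: HM.
      move=> w; rewrite indicE; case: (boolP (w \in A)) => [|_]; last by rewrite mul0r.
      by rewrite inE mul1r => /ltW.
    apply: filterS => w; rewrite indicE; case: (boolP (w \in A)) => [_|].
      by rewrite mul1r => ->.
    by rewrite notin_setE /A/= => /negP; rewrite -leNgt.
  have := half 1; have := half (-1); apply: filterS2 => w.
  rewrite mulN1r mul1r oppr_le0 subr_ge0 subr_le0 => h1 h2.
  by rewrite fE cE; congr (_%:E); apply/eqP; rewrite eq_le h1 h2.
have : {ae P, forall w, forall q : rat, mu w `]-oo, (ratr q)[%classic = m `]-oo, (ratr q)[%classic}.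
  have : {ae P, forall w, forall n : nat, if unpickle n is Some q then
      mu w `]-oo, (ratr q)[%classic = m `]-oo, (ratr q)[%classic else True}.
    apply/ae_foralln => n; case: (unpickle n) => [q|]; first exact: one.
    exact: aeW.
  by apply: filterS => w h q; have := h (pickle (q : rat)); rewrite pickleK.
by apply: filterS => w h; exact: prob_determined_rays.
Qed.

End conditional_law.

(** * Second-order form of weak monotonicity *)

Lemma lipschitz_continuous_fun (R : realType) (f : R -> R) (K : R) :
  (forall x y, `|f x - f y| <= K * `|x - y|) -> continuous f.
Proof.
move=> h x; have K0 : 0 <= K.
  by have := le_trans (normr_ge0 _) (h 1 0); rewrite subr0 normr1 mulr1.
apply/cvgrPdist_lt => e e0; near=> y.
apply: le_lt_trans (h _ _) _.
apply: (@le_lt_trans _ _ ((K + 1) * `|x - y|)).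
  by rewrite ler_wpM2r// lerDl.
rewrite -ltr_pdivlMl; last by rewrite ltr_wpDl.
near: y; apply: (@cvgr_dist_lt _ _ _ (nbhs x) _ id x); first exact: cvg_id.
by rewrite mulr_gt0// invr_gt0 ltr_wpDl.
Unshelve. all: end_near. Qed.

Section second_order.
Context {R : realType} {dh} {Th : measurableType dh} (Ph : probability Th R).
Variables (g : R -> P2 R -> R) (D : R -> P2 R -> R -> R) (K : R).
Hypothesis g_lip : lipschitz_dx g K.
Hypothesis g_mono : monotone_dx g.
Hypothesis g_lip_law : lipschitz_dx_law g K.
Hypothesis g_weak_mono : weakly_monotone_dx g.
Hypothesis g_dxx : forall x m, derivable (fun y => dx g y m) x 1.
Hypothesis g_D : forall x m, is_measure_derivative Ph (dx g x) m (D x m).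
Hypothesis dxx_lip : forall x x' m m',
  `|dxx g x m - dxx g x' m'| <= K * (`|x - x'| + W2 m m').

Let lip x x' m : `|dx g x m - dx g x' m| <= K * `|x - x'|.
Proof. have [_ h] := g_lip; exact: h. Qed.

Lemma lipschitz_dx_ge0 (m : P2 R) : 0 <= K.
Proof.
by have := le_trans (normr_ge0 _) (lip 1 0 m); rewrite subr0 normr1 mulr1.
Qed.

Lemma measurable_dx m : measurable_fun setT (fun x => dx g x m).
Proof.
by apply: continuous_measurable_fun; apply: (@lipschitz_continuous_fun _ _ K) => x y; exact: lip.
Qed.

Lemma measurable_dxx m : measurable_fun setT (fun x => dxx g x m).
Proof.
apply: continuous_measurable_fun; apply: (@lipschitz_continuous_fun _ _ K) => x y.
by have := dxx_lip x y m m; rewrite W2_eq0// addr0.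
Qed.

Lemma dxx_ge0 x m : 0 <= dxx g x m.
Proof.
rewrite /dxx.
have hd : derivable (fun y => dx g y m) x 1 by exact: g_dxx.
have := hd; rewrite /derivable => hc; rewrite derive1E /derive.
apply: limr_ge => //; near=> h.
have h0 : h != 0 by near: h; exact: nbhs_dnbhs_neq.
have h1 := g_mono (h%:A + x) x m; rewrite addrK in h1.
have hA : h%:A = h :> R by exact: mulr1.
have -> : h^-1 *: (((dx g)^~ m \o shift x) h%:A - dx g x m) =
    h ^- 2 * ((dx g (h%:A + x) m - dx g x m) * h%:A).
  transitivity (h^-1 * (dx g (h%:A + x) m - dx g x m)); first by [].
  by rewrite hA; field.
by rewrite mulr_ge0// invr_ge0 sqr_ge0.
Unshelve. all: end_near. Qed.

Lemma dx_increment x p m : exists2 c, `|c - x| <= `|p| &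
  dx g (x + p) m - dx g x m = dxx g c m * p.
Proof.
have cont : continuous (fun y => dx g y m).
  by apply: (@lipschitz_continuous_fun _ _ K) => u v; exact: lip.
have isd (y : R) : is_derive y (1 : R) (fun y : R => dx g y m) (dxx g y m).
  by rewrite /dxx derive1E; apply: derivableP; exact: g_dxx.
have [p0|p0] := leP 0 p.
  have le : x <= x + p by rewrite lerDl.
  have [c /[!in_itv]/= /andP[c1 c2] e] := MVT_segment le (fun y _ => isd y)
    (continuous_subspaceT cont).
  exists c; last by rewrite e addrAC subrr add0r.
  by rewrite !ger0_norm ?subr_ge0// lerBlDl.
have le : x + p <= x by rewrite gerDl ltW.
have [c /[!in_itv]/= /andP[c1 c2] e] := MVT_segment le (fun y _ => isd y)
  (continuous_subspaceT cont).
exists c; last by apply: oppr_inj; rewrite opprB e; ring.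
by rewrite ler0_norm ?subr_le0// ltr0_norm//; move: c1 c2; lra.
Qed.

Variables (m : P2 R) (psi : R -> R).
Hypothesis hpsi : L2 m psi.

(* The second-order part of weak monotonicity: expand it along the coupling of
   [X + eps psi(X)] with [X]. *)
Lemma weak_monotone_second_order :
  [/\ measurable_fun setT (fun x => \int[m]_y (D x m y * psi y)),
      exists C, forall x, `|\int[m]_y (D x m y * psi y)| <= C &
      0 <= \int[m]_x ((dxx g x m * psi x + \int[m]_y (D x m y * psi y)) * psi x)].
Proof.
have K0 := lipschitz_dx_ge0 m.
have [X LX hX] : exists2 X : Th -> R, L2 Ph X & has_law Ph X m.
  by have [[X [l []]]] := g_D 0 m; exists X.
have mX := L2_meas LX; have mpsi := L2_meas hpsi.
pose p w := psi (X w).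
have LD x : L2 m (D x m) by have [] := g_D x m.
have exX (f : R -> R) : measurable_fun setT f -> \int[m]_y f y = \int[Ph]_w f (X w).
  by move=> mf; exact: (ex_law mX hX mf).
have L2X (f : R -> R) : L2 m f -> L2 Ph (fun w => f (X w)).
  move=> hf; have mf := L2_meas hf; apply/L2P; split; first exact: (measurableT_comp mf mX).
  apply/(integrable_law mX hX (f := fun y => f y ^+ 2)); first exact: measurable_funX.
  exact: L2_sq.
have Lp : L2 Ph p by exact: L2X.
pose N := Num.sqrt (\int[Ph]_w (p w ^+ 2)).
have N0 : 0 <= N by exact: sqrtr_ge0.
pose H x := \int[m]_y (D x m y * psi y).
have HE x : H x = \int[Ph]_w (D x m (X w) * p w).
  by rewrite /H exX//; apply: measurable_funM => //; exact: L2_meas (LD x).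
pose eps n : R := n.+1%:R^-1.
have eps_gt0 n : 0 < eps n by rewrite invr_gt0.
have eps_cvg : eps @ \oo --> 0 by exact: cvg_harmonic.
have LY n : L2 Ph (fun w => eps n * p w) by exact: L2Z.
have LXY n : L2 Ph (fun w => X w + eps n * p w) by exact: L2D.
have [me hme] : exists me : nat -> P2 R, forall n, has_law Ph (fun w => X w + eps n * p w) (me n).
  suff : forall n, exists mm, has_law Ph (fun w => X w + eps n * p w) mm.
    by move=> /choice[me hme]; exists me.
  by move=> n; exact: exists_P2_law (LXY n).
have normY n : Num.sqrt (\int[Ph]_w ((eps n * p w) ^+ 2)) = eps n * N.
  under eq_Rintegral do rewrite exprMn.
  rewrite exZ; last exact: L2_sq.
  by rewrite sqrtrM ?sqr_ge0// sqrtr_sqr gtr0_norm.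
have W2me n : W2 (me n) m <= eps n * N.
  rewrite -normY; have e : (fun w => X w + eps n * p w - X w) = (fun w => eps n * p w).
    by apply/funext => w; rewrite addrAC subrr add0r.
  have L : L2 Ph (fun w => X w + eps n * p w - X w) by rewrite e.
  apply: le_trans (W2_le (L2_meas (LXY n)) mX L (hme n) hX) _.
  by under eq_Rintegral do rewrite addrAC subrr add0r.
(* The quotient in the measure argument alone. It is bounded by K |p|, because W2 moves by at most
   eps |p|, and tends to [H] by differentiability; hence [H] inherits measurability and the
   bound. *)
pose quo n x := (dx g x (me n) - dx g x m) / eps n.
have quo_le n x : `|quo n x| <= K * N.
  rewrite normrM normfV (gtr0_norm (eps_gt0 n)) ler_pdivrMr// -mulrA [N * _]mulrC.
  by apply: le_trans (g_lip_law x (me n) m) _; rewrite ler_wpM2l.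
have quo_cvg x : quo n x @[n --> \oo] --> H x.
  apply/cvgrPdist_le => e e0.
  have eN0 : 0 < e / (N + 1) by rewrite divr_gt0// ltr_wpDl.
  have [_ _ /(_ X LX hX _ eN0)[del del0 hdel]] := g_D x m.
  near=> n.
  have small : (norm2 Ph (fun w => eps n * p w)%R <= del%:E)%E.
    rewrite norm2_sqrt// normY lee_fin.
    have : eps n <= del / (N + 1).
      near: n; apply: (cvgr_le _ eps_cvg); by rewrite divr_gt0// ltr_wpDl.
    rewrite ler_pdivlMr ?ltr_wpDl// => /(le_trans _); apply.
    by rewrite (ler_wpM2l (ltW (eps_gt0 n)))// lerDl.
  have := hdel _ (me n) (LY n) small (hme n).
  rewrite norm2_sqrt// normY -EFinM lee_fin.
  have -> : \int[Ph]_w (D x m (X w) * (eps n * p w)) = eps n * H x.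
    rewrite HE -exZ; last exact: L2_mul (L2X _ (LD x)) Lp.
    by apply: eq_Rintegral => w _; rewrite mulrCA.
  move=> h1; rewrite distrC.
  have -> : quo n x - H x = (dx g x (me n) - dx g x m - eps n * H x) / eps n.
    by rewrite /quo; field; rewrite gt_eqF.
  rewrite normrM normfV (gtr0_norm (eps_gt0 n)) ler_pdivrMr//.
  apply: le_trans h1 _; rewrite [_ / _ * _]mulrC mulrA -mulrA [_ * (e / _)]mulrC.
  have : e / (N + 1) * N <= e.
    by rewrite mulrAC ler_pdivrMr ?ltr_wpDl// (ler_wpM2l (ltW e0))// lerDl.
  by move=> h2; rewrite mulrCA mulrC; have := ler_wpM2r (ltW (eps_gt0 n)) h2; rewrite -!mulrA ![N * _]mulrC.
have mH : measurable_fun setT H.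
  apply: (@measurable_fun_cvg _ _ _ _ quo) => [n|x _]; last exact: quo_cvg.
  by apply: measurable_funM => //; apply: measurable_funB; exact: measurable_dx.
have H_le x : `|H x| <= K * N.
  apply: (cvgr_to_le (cvg_norm (quo_cvg x))).
  by apply: nearW => n; exact: quo_le.
split => //; first by exists (K * N).
(* The quotient in both arguments. Weak monotonicity for this coupling reads eps^2 E[q p] >= 0, and
   dominated convergence carries the sign to the limit. *)
pose q n w := (dx g (X w + eps n * p w) (me n) - dx g (X w) m) / eps n.
have mq n : measurable_fun setT (q n).
  apply: measurable_funM => //; apply: measurable_funB.
    exact: (measurableT_comp (measurable_dx (me n)) (L2_meas (LXY n))).
  exact: (measurableT_comp (measurable_dx m) mX).
have q_le n w : `|q n w| <= K * `|p w| + K * N.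
  have -> : q n w = (dx g (X w + eps n * p w) (me n) - dx g (X w) (me n)) / eps n
      + quo n (X w) by rewrite /q /quo; field; rewrite gt_eqF.
  apply: le_trans (ler_normD _ _) _; apply: lerD => //.
  rewrite normrM normfV (gtr0_norm (eps_gt0 n)) ler_pdivrMr//.
  apply: le_trans (lip _ _ _) _.
  by rewrite addrAC subrr add0r normrM (gtr0_norm (eps_gt0 n)) [eps n * _]mulrC mulrA.
have q_cvg w : q n w @[n --> \oo] --> dxx g (X w) m * p w + H (X w).
  have -> : (fun n => q n w) =
     (fun n => (dx g (X w + eps n * p w) (me n) - dx g (X w) (me n)) / eps n + quo n (X w)).
    by apply/funext => n; rewrite /q /quo; field; rewrite gt_eqF.
  apply: cvgD; last exact: quo_cvg.
  pose C := K * (`|p w| + N) * `|p w|.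
  have C0 : 0 <= C by rewrite !mulr_ge0// addr_ge0.
  apply/cvgrPdist_le => e e0; near=> n.
  (* The state increment is evaluated at the measure [me n], so the mean value point and the measure
     both move; the Lipschitz bound on [dxx] controls both errors by a multiple of eps. *)
  have [c hc ->] := dx_increment (X w) (eps n * p w) (me n).
  have -> : dxx g c (me n) * (eps n * p w) / eps n = dxx g c (me n) * p w.
    by rewrite [eps n * _]mulrC mulrA mulfK// gt_eqF.
  rewrite -mulrBl normrM distrC.
  have h1 : `|dxx g c (me n) - dxx g (X w) m| <= K * (`|p w| + N) * eps n.
    apply: le_trans (dxx_lip _ _ _ _) _; rewrite -mulrA ler_wpM2l// mulrDl lerD//.
      by rewrite (le_trans hc)// normrM (gtr0_norm (eps_gt0 n)) mulrC.
    by rewrite mulrC.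
  apply: le_trans (ler_wpM2r (normr_ge0 _) h1) _.
  rewrite mulrAC -/C.
  have : eps n <= e / (C + 1).
    by near: n; apply: (cvgr_le _ eps_cvg); rewrite divr_gt0// ltr_wpDl.
  move=> /(ler_wpM2l C0) /le_trans; apply.
  by rewrite mulrCA (ler_piMr (ltW e0))// ler_pdivrMr ?ltr_wpDl// mul1r lerDl.
have qp_ge0 n : 0 <= \int[Ph]_w (q n w * p w).
  have mXX : measurable_fun setT (fun w => (X w + eps n * p w, X w)).
    exact: (measurable_fun_pair (L2_meas (LXY n)) mX).
  have [gam hgam] := exists_law Ph mXX.
  have cg : coupling (me n) m gam.
    split=> A mA.
    - transitivity (Ph ((fun w => X w + eps n * p w) @^-1` A)); last exact: hme.
      by rewrite -hgam// -[Y in measurable Y]setTI; exact: measurable_fst.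
    - transitivity (Ph (X @^-1` A)); last exact: hX.
      by rewrite -hgam// -[Y in measurable Y]setTI; exact: measurable_snd.
  have := g_weak_mono cg.
  rewrite (integral_law mXX hgam); last first.
    apply/measurable_EFinP; apply: measurable_funM.
      by apply: measurable_funB; apply: (measurableT_comp (measurable_dx _));
        [exact: measurable_fst|exact: measurable_snd].
    by apply: measurable_funB; [exact: measurable_fst|exact: measurable_snd].
  move=> /fine_ge0; rewrite -/(Rintegral _ _ _) => h.
  rewrite -(pmulr_rge0 _ (exprn_gt0 2 (eps_gt0 n))) -exZ.
    apply: le_trans h _; rewrite le_eqVlt; apply/orP; left; apply/eqP.
    apply: eq_Rintegral => w _ /=; rewrite /q; field; by rewrite gt_eqF.
  apply: L2_mul => //; apply: (@L2_le _ _ _ _ _ (fun w => K * `|p w| + K * N)) => //.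
    apply: L2D; last exact: L2_cst.
    apply: L2Z; apply: (L2_le _ Lp) => [|w]; last by rewrite normr_id.
    by apply: measurableT_comp => //; exact: L2_meas Lp.
  by move=> w; apply: le_trans (q_le n w) (ler_norm _).
have Lb : L1 Ph (fun w => (K * `|p w| + K * N) * `|p w|).
  have Lap : L2 Ph (fun w => `|p w|).
    apply: (L2_le _ Lp) => [|w]; last by rewrite normr_id.
    by apply: measurableT_comp => //; exact: L2_meas Lp.
  by apply: L2_mul => //; apply: L2D; [exact: L2Z|exact: L2_cst].
have mlim : measurable_fun setT (fun x => (dxx g x m * psi x + H x) * psi x).
  apply: measurable_funM => //; apply: measurable_funD => //.
  by apply: measurable_funM => //; exact: measurable_dxx.
rewrite (exX _ mlim).
apply: (cvgr_to_ge (@ex_dct _ _ _ Ph (fun n w => q n w * p w) _ _ _ _ Lb _ _)).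
- by move=> n; apply: measurable_funM => //; exact: L2_meas Lp.
- exact: (measurableT_comp mlim mX).
- by move=> n w; rewrite normrM ler_wpM2r.
- by apply: aeW => w; apply: cvgM; [exact: q_cvg|exact: cvg_cst].
- by apply: nearW => n; exact: qp_ge0.
Unshelve. all: end_near. Qed.

End second_order.

(** * The terminal operator of the variational system *)

Section terminal_operator.
Context {R : realType} {dh} {Th : measurableType dh} (Ph : probability Th R).
Context {d0} {Om0 : measurableType d0} (P0 : probability Om0 R).
Variables (g : R -> P2 R -> R) (D : R -> P2 R -> R -> R) (K : R).
Hypothesis g_lip : lipschitz_dx g K.
Hypothesis g_mono : monotone_dx g.
Hypothesis g_lip_law : lipschitz_dx_law g K.
Hypothesis g_weak_mono : weakly_monotone_dx g.
Hypothesis g_dxx : forall x m, derivable (fun y => dx g y m) x 1.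
Hypothesis g_D : forall x m, is_measure_derivative Ph (dx g x) m (D x m).
Hypothesis dxx_le : forall x m, `|dxx g x m| <= K.
Hypothesis dxx_lip : forall x x' m m',
  `|dxx g x m - dxx g x' m'| <= K * (`|x - x'| + W2 m m').
Variables (X : Om0 -> R) (m : P2 R).
Hypothesis mX : measurable_fun setT X.
Hypothesis hX : has_law P0 X m.

(** The mean-field term of the terminal condition at a frozen path of the common noise. *)
Definition law_operator (f : Om0 -> R) (w : Om0) : R :=
  \int[P0]_v (D (X w) m (X v) * f v).

Let L2X (f : R -> R) : L2 m f -> L2 P0 (fun w => f (X w)).
Proof.
move=> hf; have mf := L2_meas hf; apply/L2P; split; first exact: (measurableT_comp mf mX).
apply/(integrable_law mX hX (f := fun y => f y ^+ 2)); first exact: measurable_funX.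
exact: L2_sq.
Qed.

Let LD x : L2 P0 (fun v => D x m (X v)).
Proof. by apply: L2X; have [] := g_D x m. Qed.

Lemma law_operatorD f h w : L2 P0 f -> L2 P0 h ->
  law_operator (fun v => f v + h v) w = law_operator f w + law_operator h w.
Proof.
move=> hf hh; rewrite -exD; [|exact: L2_mul|exact: L2_mul].
by apply: eq_Rintegral => v _; rewrite mulrDr.
Qed.

Lemma law_operatorZ f a w : L2 P0 f ->
  law_operator (fun v => a * f v) w = a * law_operator f w.
Proof.
move=> hf; rewrite -exZ; last exact: L2_mul.
by apply: eq_Rintegral => v _; rewrite mulrCA.
Qed.

(** The operator sees [f] only through its conditional expectation psi(X), to which the second-order
    inequality applies. The rest f - psi(X) contributes its square weighted by [dxx], which is
    nonnegative, and the cross terms drop out. That the image is a function of [X] is what preserves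
    idiosyncratic information. *)
Lemma law_operator_spec f : L2 P0 f ->
  (exists H : R -> R, [/\ measurable_fun setT H, exists C, forall x, `|H x| <= C &
     forall w, law_operator f w = H (X w)]) /\
  0 <= \int[P0]_w ((dxx g (X w) m * f w + law_operator f w) * f w).
Proof.
move=> hf; have [psi [mpsi Lpsi hpsi]] := cond_exp_L2 mX hf.
have Lpsi' : L2 m psi.
  apply/L2P; split => //; apply/(integrable_law mX hX (f := fun y => psi y ^+ 2)).
    exact: measurable_funX.
  exact: L2_sq Lpsi.
have [mH [C HC] pos] := weak_monotone_second_order g_lip g_lip_law g_weak_mono
  g_dxx g_D dxx_lip Lpsi'.
set H := (fun x => \int[m]_y _) in mH HC pos.
have HE w : law_operator f w = H (X w).
  have [_ LDm _] := g_D (X w) m; have mD := L2_meas LDm.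
  rewrite /law_operator /H (ex_law mX hX); last exact: measurable_funM.
  under eq_Rintegral do rewrite mulrC.
  under [RHS]eq_Rintegral do rewrite mulrC.
  exact: hpsi.
split; first by exists H; split => //; exists C.
have ma : measurable_fun setT (fun x => dxx g x m).
  exact: measurable_dxx dxx_lip m.
have maX : measurable_fun setT (fun w => dxx g (X w) m) by exact: (measurableT_comp ma mX).
have mHX : measurable_fun setT (fun w => H (X w)) by exact: (measurableT_comp mH mX).
have La (h : Om0 -> R) : L2 P0 h -> L2 P0 (fun w => dxx g (X w) m * h w).
  move=> hh; apply: (@L2_mul_bounded _ _ _ P0 _ _ K) => // w.
have LH : L2 P0 (fun w => H (X w)) by exact: (L2_bounded P0 mHX (fun w => HC (X w))).
have e1 : \int[P0]_w (f w * (dxx g (X w) m * psi (X w))) =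
    \int[P0]_w (psi (X w) * (dxx g (X w) m * psi (X w))).
  apply: (hpsi (fun x => dxx g x m * psi x)); first exact: measurable_funM.
  exact: La.
have e2 : \int[P0]_w (f w * H (X w)) = \int[P0]_w (psi (X w) * H (X w)) by exact: hpsi.
have Ld : L2 P0 (fun w => f w - psi (X w)) by exact: L2B.
have sq : 0 <= \int[P0]_w (dxx g (X w) m * (f w - psi (X w)) * (f w - psi (X w))).
  apply: ex_ge0 => w; rewrite -mulrA mulr_ge0//; last exact: sqr_ge0.
  exact: dxx_ge0.
have l1 := L2_mul (La _ hf) hf.
have l2 := L2_mul hf (La _ Lpsi).
have l3 := L2_mul Lpsi (La _ Lpsi).
have l4 := L2_mul hf LH.
have l5 := L2_mul Lpsi LH.
have eL : \int[P0]_w ((dxx g (X w) m * f w + law_operator f w) * f w) =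
    \int[P0]_w (dxx g (X w) m * f w * f w) + \int[P0]_w (f w * H (X w)).
  by rewrite -exD//; apply: eq_Rintegral => w _; rewrite HE; ring.
have eR : \int[m]_x ((dxx g x m * psi x + H x) * psi x) =
    \int[P0]_w (psi (X w) * (dxx g (X w) m * psi (X w))) + \int[P0]_w (psi (X w) * H (X w)).
  rewrite (ex_law mX hX) -?exD//; first by apply: eq_Rintegral => w _; ring.
  by apply: measurable_funM => //; apply: measurable_funD => //; exact: measurable_funM.
have eS : \int[P0]_w (dxx g (X w) m * (f w - psi (X w)) * (f w - psi (X w))) =
    \int[P0]_w (dxx g (X w) m * f w * f w) - 2 * \int[P0]_w (f w * (dxx g (X w) m * psi (X w)))
    + \int[P0]_w (psi (X w) * (dxx g (X w) m * psi (X w))).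
  rewrite -exZ// -exB//; last exact: L1Z.
  rewrite -exD//; last by apply: L1B => //; exact: L1Z.
  by apply: eq_Rintegral => w _; ring.
rewrite eL e2; move: pos sq; rewrite eR eS e1; lra.
Qed.

End terminal_operator.

(** * The conditionally nonlinear part of the variational system *)

Section second_sections.
Context {R : realType} {d0} {Om0 : measurableType d0} {dt} {Omt : measurableType dt}.
Variables (P0 : probability Om0 R) (Pt : probability Omt R).
Local Notation P := ((P0 \x Pt)%E : probability (Om0 * Omt)%type R).

Lemma ex_prod2 (f : Om0 * Omt -> R) : L1 P f ->
  measurable_fun setT (fun wt => \int[P0]_w0 f (w0, wt)) /\
  \int[P]_w f w = \int[Pt]_wt \int[P0]_w0 f (w0, wt).
Proof.
move=> hf; have i := hf : (P0 \x Pt)%E.-integrable setT (EFin \o f).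
have mG := measurable_fubini_G i.
have m : measurable_fun setT (fun wt => \int[P0]_w0 f (w0, wt)).
  exact: measurableT_comp.
have ae1 : {ae Pt, forall wt, fubini_G P0 (EFin \o f) wt = (\int[P0]_w0 f (w0, wt))%:E}.
  have := ae_integrable2 i; apply: filterS => wt h.
  by rewrite EFin_ex.
split => //.
rewrite /Rintegral -(integral21_prod_meas1 i); congr fine.
apply: ae_eq_integral => //; first exact/measurable_EFinP.
by apply: filterS ae1 => wt -> _.
Qed.

Lemma ae_section2 (Q : Om0 * Omt -> Prop) : {ae P, forall w, Q w} ->
  {ae Pt, forall wt, {ae P0, forall w0, Q (w0, wt)}}.
Proof.
move=> [N [mN N0 sub]]; have LN := L1_indic P mN.
have [mL e] := ex_prod2 LN.
have e0 : \int[Pt]_wt \int[P0]_w0 \1_N (w0, wt) = 0 :> R.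
  by rewrite -e ex_indic// N0.
have i0 w : 0 <= \1_N w :> R by rewrite indicE.
have L : L1 Pt (fun wt => \int[P0]_w0 \1_N (w0, wt)).
  apply: (L1_bounded _ mL (C := 1)) => wt; rewrite ger0_norm; last by apply: ex_ge0.
  have mN' : measurable_fun setT (fun w0 => \1_N (w0, wt) : R).
    by apply: measurableT_comp (measurable_pair2 wt); exact: measurable_indic.
  rewrite -[leRHS](ex_cst P0); apply: ex_le => [||w0]; last first.
  - by rewrite indicE; case: (_ \in _).
  - exact: L1_cst.
  - apply: (L1_bounded _ mN' (C := 1)) => w0.
    by rewrite indicE; case: (_ \in _); rewrite ?normr0 ?normr1.
have ae2 := @ae_integrable2 _ _ _ _ _ P0 Pt _ LN.
have := ex_eq0 L (fun wt => ex_ge0 _ (fun w0 => i0 (w0, wt))) e0.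
apply: filterS2 ae2 => wt h1 h2.
have := ex_eq0 h1 (fun w0 => i0 (w0, wt)) h2.
apply: filterS => w0; rewrite indicE.
by case: (boolP ((w0, wt) \in N)) => [_ /eqP|]; rewrite ?oner_eq0// notin_setE => /(contra_notP (sub _)).
Qed.

Lemma L2_section2 h : L2 P h -> {ae Pt, forall wt, L2 P0 (fun w0 => h (w0, wt))}.
Proof.
move=> hh; have i := L2_sq hh : (P0 \x Pt)%E.-integrable setT (EFin \o (fun w => h w ^+ 2)).
have := ae_integrable2 i; apply: filterS => wt h2.
apply/L2P; split => //.
exact: measurableT_comp (L2_meas hh) (measurable_pair2 wt).
Qed.

Lemma ex_ge0_ae d (E : measurableType d) (m : probability E R) (f : E -> R) :
  measurable_fun setT f -> {ae m, forall w, 0 <= f w} -> 0 <= \int[m]_w f w.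
Proof.
move=> mf f0; rewrite (@ex_ae _ _ _ _ _ (fun w => Num.max (f w) 0))//.
- by apply: ex_ge0 => w; rewrite le_max lexx orbT.
- exact: measurable_maxr.
- by apply: filterS f0 => w h; rewrite (max_idPl _).
Qed.

End second_sections.

Section ip_tools.
Context {R : realType} {d} {Om : measurableType d} (P : probability Om R).

(** Young's inequality, from E[(lam x + y)^2] >= 0, with a weight left free for balancing. *)
Lemma ex_mul_lower (x y : Om -> R) (lam : R) : 0 < lam -> L2 P x -> L2 P y ->
  - (lam * \int[P]_w (x w ^+ 2) + \int[P]_w (y w ^+ 2) / lam) / 2 <= \int[P]_w (x w * y w).
Proof.
move=> l0 hx hy; have h1 := L2_mul hx hy; have h2 := L2_sq hx; have h3 := L2_sq hy.
have : 0 <= \int[P]_w ((lam * x w + y w) ^+ 2) by apply: ex_ge0 => w; exact: sqr_ge0.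
have -> : \int[P]_w ((lam * x w + y w) ^+ 2) =
    lam ^+ 2 * \int[P]_w (x w ^+ 2) + 2 * lam * \int[P]_w (x w * y w) + \int[P]_w (y w ^+ 2).
  have k1 := L1Z (lam ^+ 2) h2; have k2 := L1Z (2 * lam) h1.
  rewrite -(exZ (lam ^+ 2) h2) -(exZ (2 * lam) h1) -(exD k1 k2) -(exD (L1D k1 k2) h3).
  by apply: eq_Rintegral => w _; ring.
set a := \int[P]_w (x w ^+ 2); set b := \int[P]_w (y w ^+ 2); set c := \int[P]_w (x w * y w).
move=> h; rewrite -subr_ge0.
have -> : c - - (lam * a + b / lam) / 2 = (lam ^+ 2 * a + 2 * lam * c + b) / (2 * lam).
  by field; rewrite gt_eqF.
by rewrite divr_ge0// mulr_ge0// ltW.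
Qed.

End ip_tools.

(** * Step functions on the grid *)

Section cells.
Context {R : realType} (T : R).
Hypothesis T_gt0 : (0 : R) < T.
Variable N : nat.
Hypothesis N_gt0 : (0 < N)%N.
Local Notation t_ := (tk T N).

Definition cell (s : R) : nat := Num.truncn (s / (T / N%:R)).

Definition step (b : nat -> R) (s : R) : R :=
  \sum_(k < N) b k * \1_(`[t_ k, t_ k.+1[%classic) s.

Lemma cellP s : 0 <= s < T -> (cell s < N)%N /\ t_ (cell s) <= s < t_ (cell s).+1.
Proof.
move=> /andP[s0 sT]; have N0 : (0 : R) < N%:R by rewrite ltr0n.
have d0 : 0 < T / N%:R by rewrite divr_gt0.
have kb : t_ (cell s) <= s < t_ (cell s).+1.
  rewrite /tk -ler_pdivlMr// -ltr_pdivrMr//.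
  by apply: truncn_itv; rewrite divr_ge0// ltW.
split => //; have /andP[h1 _] := kb.
rewrite ltnNge; apply/negP => /(tk_le T_gt0 N_gt0); rewrite tkN// => h2.
by have := lt_le_trans sT (le_trans h2 h1); rewrite ltxx.
Qed.

Lemma step_in b s : 0 <= s < T -> step b s = b (cell s).
Proof.
move=> sT; have [kN /andP[k1 k2]] := cellP sT.
rewrite /step (bigD1 (Ordinal kN))//= big1 ?addr0; last first.
  move=> [j jN]; rewrite -val_eqE /= => jk; rewrite indicE memNset ?mulr0// => /=.
  rewrite in_itv/= => /andP[j1 j2]; move/negP: jk; apply.
  have [jk|jk|_ //] := ltngtP j (cell s).
    have := tk_le T_gt0 N_gt0 jk => h.
    by have := lt_le_trans j2 (le_trans h k1); rewrite ltxx.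
  have := tk_le T_gt0 N_gt0 jk => h.
  by have := lt_le_trans k2 (le_trans h j1); rewrite ltxx.
by rewrite indicE mem_set ?mulr1 /= ?in_itv//= k1.
Qed.

Lemma step_out b s : ~ (0 <= s < T) -> step b s = 0.
Proof.
move=> sout; apply: big1.
move=> [k kN] _ /=; rewrite indicE memNset ?mulr0// => /=.
rewrite in_itv/= => /andP[h1 h2]; apply: sout.
have /andP[h3 _] := tk_itv T_gt0 N_gt0 (ltnW kN).
have /andP[_ h4] := tk_itv T_gt0 N_gt0 kN.
by rewrite (le_trans h3)// (lt_le_trans h2).
Qed.

Let L1_cell (b : nat -> R) (k : 'I_N) : L1 (time_law T_gt0)
  (fun s => b k * \1_(`[t_ k, t_ k.+1[%classic) s).
Proof. by apply: L1Z; apply: L1_indic; exact: measurable_itv. Qed.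

Lemma L1_step b : L1 (time_law T_gt0) (step b).
Proof. by apply: L1_sum => k; exact: L1_cell. Qed.

Lemma step_integral b : \int[time_law T_gt0]_s step b s = (\sum_(k < N) b k) / N%:R.
Proof.
have N0 : (0 : R) < N%:R by rewrite ltr0n.
rewrite ex_sum; last by move=> k; exact: L1_cell.
rewrite mulr_suml; apply: eq_bigr => -[k kN] _ /=.
rewrite exZ; last by apply: L1_indic; exact: measurable_itv.
have /andP[h1 _] := tk_itv T_gt0 N_gt0 (ltnW kN).
have /andP[_ h2] := tk_itv T_gt0 N_gt0 kN.
rewrite time_law_cell//; last exact/ltW/tk_ltS.
congr (_ * _); rewrite /tk -mulrBl -natr1 addrAC subrr add0r mul1r.
by field; rewrite !gt_eqF.
Qed.

(** A lower Riemann sum: each cell has mass 1 / N under the uniform law. *)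
Lemma cell_sum (b : nat -> R) (phi : R -> R) : L1 (time_law T_gt0) phi ->
  (forall k s, (k < N)%N -> t_ k <= s < t_ k.+1 -> b k <= phi s) ->
  (forall s, ~ (0 <= s < T) -> 0 <= phi s) ->
  (\sum_(k < N) b k) / N%:R <= \int[time_law T_gt0]_s phi s.
Proof.
move=> hphi cell_le out; rewrite -step_integral.
apply: ex_le => //; first exact: L1_step.
move=> s; have [sT|sout] := pselect (0 <= s < T); last by rewrite step_out//; exact: out.
by have [kN ks] := cellP sT; rewrite step_in//; exact: cell_le.
Qed.

End cells.

(** * Energy estimate for the defect *)

Section grid_defect.
Context {R : realType} (T : R) {d0} {Om0 : measurableType d0}
  {dt} {Omt : measurableType dt}.
Variables (P0 : probability Om0 R) (Pt : probability Omt R).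
Local Notation Om := (Om0 * Omt)%type.
Local Notation P := ((P0 \x Pt)%E : probability (Om0 * Omt)%type R).
Variables (F : R -> set (set Om)) (W : R -> Om0 -> R) (B : R -> Omt -> R).
Variable xi0 : Om0 -> R.
Hypothesis T_gt0 : (0 : R) < T.
Hypothesis hF : complete_filtration P T F.
Local Notation iW := (fun t (w : Om) => W t w.1).
Local Notation iB := (fun t (w : Om) => B t w.2).
Hypothesis hW : independent_brownian_motions P T F iW iB.
Hypothesis xi_F0 : measurable_wrt (F 0) (fun w : Om => xi0 w.1).
Local Notation cyl0 := (cylinder W xi0).
Let T0 : (0 : R) <= T. Proof. exact: ltW. Qed.
Let T0T : 0 <= T <= T. Proof. by rewrite T0 lexx. Qed.

Variables (a : Om0 -> R) (C : R) (L : (Om0 -> R) -> Om0 -> R).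
Hypothesis ma : measurable_fun setT a.
Hypothesis a_le : forall w, `|a w| <= C.
Hypothesis a_info : exists2 a', mg (cyl0 T) a' & {ae P0, forall w, a w = a' w}.
Hypothesis LD : forall f h w, L2 P0 f -> L2 P0 h ->
  L (fun v => f v + h v) w = L f w + L h w.
Hypothesis LZ : forall f b w, L2 P0 f -> L (fun v => b * f v) w = b * L f w.
Hypothesis L2L : forall f, L2 P0 f -> L2 P0 (L f).
Hypothesis L_info : forall f, L2 P0 f ->
  exists2 e, mg (cyl0 T) e & {ae P0, forall w, L f w = e w}.
Hypothesis L_pos : forall f, L2 P0 f -> 0 <= \int[P0]_w ((a w * f w + L f w) * f w).

Variables (U V Q Q' : R -> Om -> R).
Hypothesis hS : fbsde_solution P T F iW iB (fun=> 0) iB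
  (fun w => a w.1 * U T w + L (fun v => U T (v, w.2)) w.1) U V Q Q'.

Let LV s : 0 <= s <= T -> L2 P (V s).
Proof. move=> sT; exact: (fbsde_L2Y T_gt0 hF hW hS sT). Qed.

Let gV s : 0 <= s <= T -> mg (F s) (V s).
Proof. move=> sT; exact: (fbsde_mgY hF hS sT). Qed.

Let LBT : L2 P (iB T).
Proof. by apply/(L2_snd P0 Pt); exact: L2_B_T T_gt0 hF hW. Qed.

Let l1 (f : Om0 -> R) : L2 P0 f -> L2 P (fun w => f w.1).
Proof. by move=> hf; apply/(L2_fst P0 Pt). Qed.

Let L_sum n (e : nat -> R) (c : nat -> Om0 -> R) w : (forall j, (j < n)%N -> L2 P0 (c j)) ->
  L (fun v => \sum_(i < n) c i v * e i) w = \sum_(i < n) L (c i) w * e i.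
Proof.
elim: n => [|n IH] hc.
  rewrite big_ord0 -[RHS](mul0r (L (fun=> 0) w)) -LZ; last exact: L2_cst.
  by congr L; apply/funext => v; rewrite big_ord0 mul0r.
have hc' j : (j < n)%N -> L2 P0 (c j) by move=> jn; apply: hc; exact: leqW.
rewrite big_ord_recr/= -IH// [X in _ + X]mulrC -LZ; last exact: hc.
rewrite -LD.
- by congr L; apply/funext => v; rewrite big_ord_recr/= [X in _ + X]mulrC.
- apply: L2_sum => -[i im] /=.
  under eq_fun do rewrite mulrC.
  by apply: L2Z; exact: hc'.
- by apply: L2Z; exact: hc.
Qed.

(** Martingale increments are orthogonal to the past. *)
Let mart s t : 0 <= s -> s <= t -> t <= T ->
  \int[P]_w ((V t w - V s w) ^+ 2) = \int[P]_w (V t w ^+ 2) - \int[P]_w (V s w ^+ 2).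
Proof.
move=> s0 st tT.
have sT' : 0 <= s <= T by rewrite s0 (le_trans st).
have tT' : 0 <= t <= T by rewrite tT (le_trans s0).
have e := fbsde_martingale T_gt0 hF hW hS s0 st tT (gV sT') (LV sT').
have h1 := L2_sq (LV tT'); have h2 := L2_sq (LV sT'); have h3 := L2_mul (LV tT') (LV sT').
have -> : \int[P]_w (V s w ^+ 2) = 2 * \int[P]_w (V t w * V s w) - \int[P]_w (V s w ^+ 2).
  by rewrite e; under [X in 2 * X - _]eq_Rintegral do rewrite -expr2; ring.
rewrite -(exZ 2 h3) -(exB (L1Z 2 h3) h2) -(exB h1 (L1B (L1Z 2 h3) h2)).
by apply: eq_Rintegral => w _; ring.
Qed.

Variable N : nat.
Hypothesis N_gt0 : (0 < N)%N.
Local Notation t_ := (tk T N).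
Local Notation e_ := (incr T Pt B N).
Local Notation chaos_ := (chaos T Pt B N).

(** The coefficients are idiosyncratic up to null sets only, which is all that [a] and [L]
    provide. *)
Let chaos_orth h m c : (m <= N)%N -> L2 P h ->
  (forall j eta, (j < N)%N -> mg (cyl0 T) eta -> L2 P0 eta ->
     \int[P]_w (h w * (eta w.1 * e_ j w.2)) = 0) ->
  (forall j, (j < m)%N -> L2 P0 (c j) /\
     exists2 c', mg (cyl0 T) c' & {ae P0, forall w, c j w = c' w}) ->
  \int[P]_w (h w * chaos_ m c w) = 0.
Proof.
move=> mN hh horth hc.
have Le j : (j < N)%N -> L2 Pt (e_ j) by exact: (L2_incr T_gt0 hF hW N_gt0).
transitivity (\int[P]_w \sum_(i < m) (h w * (c i w.1 * e_ i w.2))).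
  by apply: eq_Rintegral => w _; rewrite mulr_sumr.
rewrite ex_sum; last first.
  move=> [i im] /=; apply: L2_mul => //.
  by apply: L2_tensor; [have [] := hc i im|apply: Le; exact: leq_trans mN].
apply: big1 => -[i im] _ /=; have iN := leq_trans im mN.
have [Lc [c' gc' cc']] := hc i im.
have mc' : measurable_fun setT c' by exact: (mg_cyl_meas T0 hF hW xi_F0 (lexx T) gc').
have Lc' : L2 P0 c' by exact: L2_ae cc' Lc.
rewrite -(horth i c' iN gc' Lc'); apply: ex_ae.
- exact: L1_meas (L2_mul hh (L2_tensor Lc (Le i iN))).
- exact: L1_meas (L2_mul hh (L2_tensor Lc' (Le i iN))).
- by have := ae_fst Pt cc'; apply: filterS => w ->.
Qed.

(* Write D for the projection onto the orthogonal complement of the variables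
   [sum_j c_j incr_j] with [c_j] idiosyncratic information.  It commutes with the
   terminal operator, so monotonicity gives 0 <= E[DU_T DV_T], while the forward
   equation turns this into minus the time integral of E[V_s DV_T].  At grid
   times the integrand is |DV_{t_k}|^2, which is nondecreasing in k; between them
   it is controlled by the increments of E[V_s^2]. *)
Lemma grid_defect k : (k <= N)%N -> exists c : nat -> Om0 -> R,
  [/\ forall j, (j < k)%N -> L2 P0 (c j), L2 P (fun w => V (t_ k) w - chaos_ k c w) &
  (N - k)%:R * \int[P]_w ((V (t_ k) w - chaos_ k c w) ^+ 2)
    <= Num.sqrt N%:R * \int[P]_w (V T w ^+ 2)].
Proof.
have tT j : (j <= N)%N -> 0 <= t_ j <= T by exact: (tk_itv T_gt0 N_gt0).
have tN : t_ N = T by exact: tkN.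
have le_t i j : (i <= j)%N -> t_ i <= t_ j by exact: (tk_le T_gt0 N_gt0).
have [c hc] : exists c : nat -> nat -> Om0 -> R, forall m, (m <= N)%N ->
    (forall j, (j < m)%N -> mg (cyl0 (t_ m)) (c m j) /\ L2 P0 (c m j)) /\
    forall j eta, (j < N)%N -> mg (cyl0 T) eta -> L2 P0 eta ->
      \int[P]_w ((V (t_ m) w - chaos_ m (c m) w) * (eta w.1 * e_ j w.2)) = 0.
  suff : forall m, exists c : nat -> Om0 -> R, (m <= N)%N ->
    (forall j, (j < m)%N -> mg (cyl0 (t_ m)) (c j) /\ L2 P0 (c j)) /\
    forall j eta, (j < N)%N -> mg (cyl0 T) eta -> L2 P0 eta ->
      \int[P]_w ((V (t_ m) w - chaos_ m c w) * (eta w.1 * e_ j w.2)) = 0.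
    by move=> /choice[c hc]; exists c.
  move=> m; have [mN|/negP mN] := boolP (m <= N)%N; last by exists (fun _ _ => 0).
  have [c hc] := grid_proj T_gt0 hF hW xi_F0 N_gt0 mN (gV (tT m mN)) (LV (tT m mN)).
  by exists c.
have L2c m j : (m <= N)%N -> (j < m)%N -> L2 P0 (c m j).
  by move=> mN jm; have [h _] := hc m mN; have [] := h j jm.
have LC m : (m <= N)%N -> L2 P (chaos_ m (c m)).
  by move=> mN; apply: (L2_chaos T_gt0 hF hW N_gt0 mN) => j; exact: L2c.
pose DV m (w : Om) := V (t_ m) w - chaos_ m (c m) w.
have LDV m : (m <= N)%N -> L2 P (DV m).
  by move=> mN; apply: L2B; [exact: LV (tT m mN)|exact: LC].
have gDV m : (m <= N)%N -> mg (F (t_ m)) (DV m).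
  move=> mN; apply: measurable_funB; first exact: gV (tT m mN).
  apply: (mg_chaos T_gt0 hF hW xi_F0 N_gt0 mN) => j jm.
  by have [h _] := hc m mN; have [] := h j jm.
have orth m m' : (m <= N)%N -> (m' <= N)%N ->
    \int[P]_w (DV m w * chaos_ m' (c m') w) = 0.
  move=> mN mN'; apply: (chaos_orth mN' (LDV m mN)); first by have [_] := hc m mN.
  move=> j jm; have [h _] := hc m' mN'; have [gj Lj] := h j jm; split => //.
  exists (c m' j); last exact: aeW.
  have /andP[_ h1] := tT m' mN'.
  exact: (mg_cyl_mono h1 gj).
pose dd m := \int[P]_w (DV m w ^+ 2).
pose q m := \int[P]_w (V (t_ m) w ^+ 2).
have VD i j : (i <= N)%N -> (j <= N)%N ->
    \int[P]_w (V (t_ i) w * DV j w) = \int[P]_w (DV i w * DV j w).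
  move=> iN jN; have Li := LV (tT i iN); have Lj := LDV j jN.
  rewrite -[LHS]subr0 -{1}(orth j i jN iN) -(exB (L2_mul Li Lj) (L2_mul Lj (LC i iN))).
  by apply: eq_Rintegral => w _; rewrite /DV; ring.
(* The defect is a martingale along the grid: by orthogonality V may be replaced by its defect on
   either side, and [DV i] is known at t_i. *)
have VDle i j : (i <= j)%N -> (j <= N)%N ->
    \int[P]_w (V (t_ i) w * DV j w) = dd i.
  move=> ij jN; have iN := leq_trans ij jN; rewrite VD//.
  under eq_Rintegral do rewrite mulrC.
  rewrite -VD//.
  have [/andP[i0 _] /andP[_ jT]] := (tT i iN, tT j jN).
  rewrite (fbsde_martingale T_gt0 hF hW hS i0 (le_t i j ij) jT (gDV i iN) (LDV i iN)).
  by rewrite VD//; apply: eq_Rintegral => w _; rewrite expr2.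
have dd_ge0 i : 0 <= dd i by apply: ex_ge0 => w; exact: sqr_ge0.
have dd_mono i j : (i <= j)%N -> (j <= N)%N -> dd i <= dd j.
  move=> ij jN; have iN := leq_trans ij jN.
  have := VDle i j ij jN; rewrite VD// => e.
  have h1 := L2_sq (LDV j jN); have h2 := L2_sq (LDV i iN).
  have h3 := L2_mul (LDV i iN) (LDV j jN).
  rewrite -subr_ge0.
  have -> : dd j - dd i = \int[P]_w ((DV j w - DV i w) ^+ 2).
    have -> : dd j - dd i = dd j - (2 * dd i - dd i) by ring.
    rewrite -{1}e -(exZ 2 h3) -(exB (L1Z 2 h3) h2) -(exB h1 (L1B (L1Z 2 h3) h2)).
    by apply: eq_Rintegral => w _; ring.
  by apply: ex_ge0 => w; exact: sqr_ge0.
have ddN_le : dd N <= q N.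
  have e := VDle N N (leqnn N) (leqnn N).
  have h1 := L2_sq (LV (tT N (leqnn N))); have h2 := L2_sq (LDV N (leqnn N)).
  have h3 := L2_mul (LV (tT N (leqnn N))) (LDV N (leqnn N)).
  rewrite -subr_ge0.
  have -> : q N - dd N = \int[P]_w ((V (t_ N) w - DV N w) ^+ 2).
    have -> : q N - dd N = q N - (2 * dd N - dd N) by ring.
    rewrite -{1}e -(exZ 2 h3) -(exB (L1Z 2 h3) h2) -(exB h1 (L1B (L1Z 2 h3) h2)).
    by apply: eq_Rintegral => w _; ring.
  by apply: ex_ge0 => w; exact: sqr_ge0.
have q_ge0 i : 0 <= q i by apply: ex_ge0 => w; exact: sqr_ge0.
have [LU hX] := fbsde_forward T_gt0 hF hS (L2_cst P 0) LBT.
have LDN := LDV N (leqnn N).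
have Le j : (j < N)%N -> L2 Pt (e_ j) by exact: (L2_incr T_gt0 hF hW N_gt0).
(* [B T] is itself in the chaos, as the sum of all increments; the coefficients [sdB] undo the
   normalization. *)
have noise0 : \int[P]_w (B T w.2 * DV N w) = 0.
  have e0 : \int[P]_w (DV N w * chaos_ N (fun j _ => sdB T Pt B N j) w) = 0.
    apply: (chaos_orth (leqnn N) LDN); first by have [_] := hc N (leqnn N).
    move=> j jN; split; first exact: L2_cst.
    by exists (fun=> sdB T Pt B N j); [exact: measurable_cst|exact: aeW].
  have Lb : L2 P (chaos_ N (fun j _ => sdB T Pt B N j)).
    by apply: (L2_chaos T_gt0 hF hW N_gt0 (leqnn N)) => j _; exact: L2_cst.
  rewrite -[RHS]e0; apply: ex_ae.
  - exact: L1_meas (L2_mul LBT LDN).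
  - exact: L1_meas (L2_mul LDN Lb).
  - case: hW => _ _ + _; apply: filterS => w /= [_ B0].
    rewrite mulrC; congr (_ * _); rewrite /chaos.
    transitivity (\sum_(i < N) (B (t_ i.+1) w.2 - B (t_ i) w.2)).
      rewrite -(big_mkord xpredT (fun i => B (t_ i.+1) w.2 - B (t_ i) w.2)).
      by rewrite (telescope_sumr (fun i => B (t_ i) w.2))// tN tk0 B0 subr0.
    apply: eq_bigr => -[i iN] _ /=; rewrite /incr mulrA mulfV ?mul1r//.
    by rewrite gt_eqF// (sdB_gt0 T_gt0 hF hW).
have gU : mg (F (t_ N)) (U T) by rewrite tN; exact: (fbsde_mgX hF hS T0T).
have [cU [hcU orthU]] := grid_proj T_gt0 hF hW xi_F0 N_gt0 (leqnn N) gU LU.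
have LcU j : (j < N)%N -> L2 P0 (cU j) by move=> jN; have [] := hcU j jN.
pose DU (w : Om) := U T w - chaos_ N cU w.
have LCU : L2 P (chaos_ N cU) by exact: (L2_chaos T_gt0 hF hW N_gt0 (leqnn N)).
have LDU : L2 P DU by exact: L2B.
have La f : L2 P0 f -> L2 P0 (fun w => a w * f w).
  by move=> hf; exact: (@L2_mul_bounded _ _ _ P0 _ _ C ma a_le hf).
(* The coefficients of the terminal operator applied to the chaos part of U_T; they are again
   idiosyncratic, so this image is orthogonal to [DU]. *)
pose eta j w := a w * cU j w + L (cU j) w.
have Leta j : (j < N)%N -> L2 P0 (eta j).
  by move=> jN; apply: L2D; [exact: La (LcU j jN)|exact: L2L (LcU j jN)].
have LCeta : L2 P (chaos_ N eta) by exact: (L2_chaos T_gt0 hF hW N_gt0 (leqnn N)).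
have eta0 : \int[P]_w (DU w * chaos_ N eta w) = 0.
  apply: (chaos_orth (leqnn N) LDU) => // j jN; split; first exact: Leta.
  have [a' ga' aa'] := a_info; have [l gl Ll] := L_info (LcU j jN).
  have [gj _] := hcU j jN; rewrite tN in gj.
  exists (fun w => a' w * cU j w + l w).
    by apply: measurable_funD => //; exact: measurable_funM.
  by apply: filterS2 aa' Ll => w; rewrite /eta => -> ->.
have energy : \int[time_law T_gt0]_s \int[P]_w (cutoff T V s w * DV N w) <= 0.
  have LaDU : L2 P (fun w => a w.1 * DU w).
    by apply: (@L2_mul_bounded _ _ _ P _ _ C) => //; exact: measurableT_comp ma measurable_fst.
  have LVT := LV T0T.
  (* Almost surely [S] is [L] applied to [DU]. Written through V_T it is visibly jointly measurable
     and square integrable. *)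
  pose S w := V T w - a w.1 * DU w - chaos_ N eta w.
  have LS : L2 P S by apply: L2B => //; exact: L2B.
  have LaS : L2 P (fun w => a w.1 * DU w + S w) by exact: L2D.
  (* Positivity of the operator holds on each section at a fixed path of the common noise, then is
     integrated over the paths. *)
  have pos : 0 <= \int[P]_w ((a w.1 * DU w + S w) * DU w).
    have [m2 ->] := ex_prod2 (L2_mul LaS LDU).
    apply: ex_ge0_ae => //.
    have VG : {ae P, forall w, V T w = a w.1 * U T w + L (fun v => U T (v, w.2)) w.1}.
      by case: hS.
    have := ae_section2 VG; have := L2_section2 LDU; have := L2_section2 LS.
    apply: filterS3 => wt LSw LDUw VGw.
    have SE : {ae P0, forall w0, S (w0, wt) = L (fun v => DU (v, wt)) w0}.
      apply: filterS VGw => w0 /= e; rewrite /S e.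
      have -> : (fun v => U T (v, wt)) =
          (fun v => DU (v, wt) + \sum_(i < N) cU i v * e_ i wt).
        by apply/funext => v; rewrite /DU /chaos/= subrK.
      rewrite LD//; last first.
        apply: L2_sum => -[i iN] /=; under eq_fun do rewrite mulrC.
        by apply: L2Z; exact: LcU.
      rewrite (L_sum (fun i => e_ i wt))// /DU /chaos /eta /=.
      under [X in _ - X]eq_bigr do rewrite mulrDl -mulrA.
      by rewrite big_split/= -mulr_sumr; ring.
    apply: le_trans (L_pos LDUw) _; rewrite le_eqVlt; apply/orP; left; apply/eqP.
    apply: ex_ae.
    - exact: L1_meas (L2_mul (L2D (La _ LDUw) (L2L LDUw)) LDUw).
    - exact: L1_meas (L2_mul (L2D (La _ LDUw) LSw) LDUw).
    - by apply: filterS SE => w0 ->.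
  have posV : \int[P]_w ((a w.1 * DU w + S w) * DU w) = \int[P]_w (V T w * DU w).
    rewrite -[RHS]subr0 -eta0 -(exB (L2_mul LVT LDU) (L2_mul LDU LCeta)).
    by apply: eq_Rintegral => w _; rewrite /S; ring.
  have UDV : \int[P]_w (V T w * DU w) = \int[P]_w (U T w * DV N w).
    have o1 : \int[P]_w (DU w * chaos_ N (c N) w) = 0.
      apply: (chaos_orth (leqnn N) LDU) => // j jN; have [h _] := hc N (leqnn N).
      have [gj Lj] := h j jN; split => //; exists (c N j); last exact: aeW.
      by rewrite tN in gj.
    have o2 : \int[P]_w (DV N w * chaos_ N cU w) = 0.
      apply: (chaos_orth (leqnn N) LDN); first by have [_] := hc N (leqnn N).
      move=> j jN; have [gj Lj] := hcU j jN; split => //; exists (cU j); last exact: aeW.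
      by rewrite tN in gj.
    have LCN := LC N (leqnn N).
    rewrite -[LHS]subr0 -o1 -[RHS]subr0 -o2.
    rewrite -(exB (L2_mul LVT LDU) (L2_mul LDU LCN)) -(exB (L2_mul LU LDN) (L2_mul LDN LCU)).
    by apply: eq_Rintegral => w _; rewrite /DV /DU tN; ring.
  have [_ e] := hX _ LDN.
  move: pos; rewrite posV UDV e.
  have -> : \int[P]_w ((0 + B T w.2) * DV N w) = 0.
    by rewrite -[RHS]noise0; apply: eq_Rintegral => w _; rewrite add0r.
  by rewrite sub0r oppr_ge0 pmulr_rle0.
have [lphi _] := hX _ (LDV N (leqnn N)).
(* The Young weight balancing the telescoping sum, lam E[V_T^2], with the N remaining terms, N
   E[V_T^2] / lam. *)
pose lam : R := Num.sqrt N%:R.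
have N0 : (0 : R) < N%:R by rewrite ltr0n.
have lam0 : 0 < lam by rewrite sqrtr_gt0.
pose b i := dd i - (lam * (q i.+1 - q i) + dd N / lam) / 2.
have := @cell_sum _ _ T_gt0 _ N_gt0 b _ lphi.
move=> /(_ _ _)/le_trans /(_ energy) => sum_b.
have {}sum_b : \sum_(i < N) b i <= 0.
  have h : (\sum_(i < N) b i) / N%:R <= 0.
    apply: sum_b => [i s iN /andP[s1 s2]|s sout].
      have [/andP[i0 iT] /andP[i0' iT']] := (tT i (ltnW iN), tT i.+1 iN).
      have s0 : 0 <= s by exact: le_trans s1.
      have sT : s <= T by exact: le_trans (ltW s2) iT'.
      have sTT : 0 <= s <= T by rewrite s0.
      have -> : \int[P]_w (cutoff T V s w * DV N w) = \int[P]_w (V s w * DV N w).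
        by apply: eq_Rintegral => w _; rewrite cutoff_in.
      have Ld : L2 P (fun w => V s w - V (t_ i) w).
        by apply: L2B; [exact: LV|exact: LV (tT i (ltnW iN))].
      have -> : \int[P]_w (V s w * DV N w) =
          dd i + \int[P]_w ((V s w - V (t_ i) w) * DV N w).
        have h1 := L2_mul (LV (tT i (ltnW iN))) (LDV N (leqnn N)).
        rewrite -(VDle i N (ltnW iN) (leqnn N)) -(exD h1 (L2_mul Ld (LDV N (leqnn N)))).
        by apply: eq_Rintegral => w _; ring.
      rewrite /b lerD2l; apply: le_trans (ex_mul_lower lam0 Ld (LDV N (leqnn N))).
      rewrite mulNr lerN2 ler_pM2r// lerD2r ler_pM2l//.
      rewrite (mart i0 s1 sT) lerD2r -subr_ge0 -(mart s0 (ltW s2) iT').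
      by apply: ex_ge0 => w; exact: sqr_ge0.
    (* The cells leave out s = T, where the cutoff is still active; the integrand there is [dd N],
       which is nonnegative. *)
    have [sT|sT] := pselect (0 <= s <= T); last first.
      have -> : \int[P]_w (cutoff T V s w * DV N w) = \int[P]_w 0.
        by apply: eq_Rintegral => w _; rewrite cutoff_out// mul0r.
      by rewrite ex_cst.
    have sE : s = T.
      have /andP[s0 sT'] := sT; apply/eqP; rewrite eq_le sT' leNgt.
      by apply/negP => sT2; apply: sout; rewrite s0.
    have -> : \int[P]_w (cutoff T V s w * DV N w) = \int[P]_w (V (t_ N) w * DV N w).
      by apply: eq_Rintegral => w _; rewrite cutoff_in// tN sE.
    by rewrite VDle.
  by move: h; rewrite pmulr_lle0// invr_gt0.
have sum_d : \sum_(i < N) dd i <= lam * q N.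
  have tele : \sum_(i < N) (q i.+1 - q i) = q N - q 0%N.
    by rewrite -(big_mkord xpredT (fun i => q i.+1 - q i)) telescope_sumr.
  have e : \sum_(i < N) b i = \sum_(i < N) dd i - (lam * (q N - q 0%N) + N%:R * (dd N / lam)) / 2.
    rewrite /b sumrB -mulr_suml big_split/= -mulr_sumr tele sumr_const card_ord.
    by rewrite (mulr_natl (dd N / lam) N).
  move: sum_b; rewrite e subr_le0 => /le_trans; apply.
  have -> : N%:R * (dd N / lam) = lam * dd N.
    rewrite -[X in X * (_ / _)]sqr_sqrtr; last exact: ltW.
    by rewrite -/lam; field; rewrite gt_eqF.
  rewrite -mulrDr ler_pdivrMr// -mulrA ler_pM2l//.
  by have := q_ge0 0%N; have := ddN_le; lra.
move=> kN; exists (c k); split => //; first by move=> j; exact: L2c.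
  exact: LDV.
rewrite -/(dd k) -tN; apply: le_trans sum_d.
(* As [dd] is nondecreasing, each term with index at least [k] is at least [dd k]. *)
have part M : (M <= N)%N -> (M - k)%:R * dd k <= \sum_(i < M) dd i.
  elim: M => [|M IH] MN; first by rewrite sub0n mul0r big_ord0.
  rewrite big_ord_recr/=; have [kM|Mk] := leqP k M.
    rewrite subSn// -natr1 mulrDl mul1r; apply: lerD; first by apply: IH; exact: ltnW.
    by apply: dd_mono => //; exact: ltnW.
  by rewrite (eqP (_ : M.+1 - k == 0)%N) ?subn_eq0// mul0r addr_ge0// sumr_ge0.
exact: part.
Qed.

End grid_defect.

(** * Gaussian combinations of Brownian increments *)

Section gaussian_sums.
Context {R : realType}.
Local Notation mu := (@lebesgue_measure R).
Local Notation gam := (normal_law (1 : R)).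

Lemma gaussN d (E : measurableType d) (P : probability E R) s X :
  gauss P s X -> gauss P s (fun w => - X w).
Proof.
move=> [mX s0 hX]; split => //; first exact: measurableT_comp.
move=> f tf.
have tN : test_fun (fun y => f (- y)).
  by under eq_fun do rewrite -mulN1r; exact: continuous_test_scale.
rewrite (hX _ tN).
have [c c01] := continuous_test_scale tf s.
have c0 y : 0 <= f (s * y) by have /andP[] := c01 y.
rewrite -(normal_law_sym ltr01 c c0).
by apply: eq_Rintegral => y _; rewrite mulrN.
Qed.

(** Averaging over an independent increment leaves a test function of what precedes it, to which
    [gauss] applies in turn. *)
Lemma test_fun_smooth (f : R -> R) b : test_fun f ->
  test_fun (fun x => \int[gam]_y f (x + b * y)).
Proof.
move=> tf; have [cf f01] := tf.
have tfx x : test_fun (fun y => f (x + b * y)).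
  split => // y; apply: (@continuous_comp _ _ _ (fun y => x + b * y) f); last exact: cf.
  by apply: cvgD; [exact: cvg_cst|apply: cvgM; [exact: cvg_cst|exact: cvg_id]].
have Lx x : L1 gam (fun y => f (x + b * y)).
  apply: (@L1_bounded _ _ _ _ _ 1); first exact: test_fun_meas.
  by move=> y; exact: (test_fun_norm y (tfx x)).
split; last first.
  move=> x; apply/andP; split.
    by apply: ex_ge0 => y; have /andP[] := f01 (x + b * y).
  rewrite -[leRHS](ex_cst gam); apply: ex_le => //; first exact: L1_cst.
  by move=> y; have /andP[] := f01 (x + b * y).
move=> x; apply/(@cvg_nbhsP _ R^o) => u ux.
apply: (@ex_dct_bounded _ _ _ _ _ _ 1).
- by move=> n; exact: test_fun_meas (tfx (u n)).
- exact: test_fun_meas (tfx x).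
- by move=> n y; exact: (test_fun_norm y (tfx (u n))).
- apply: aeW => y; apply: continuous_cvg; first exact: cf.
  by apply: cvgD => //; exact: cvg_cst.
Qed.

End gaussian_sums.

Section brownian_sums.
Context {R : realType} {d} {Om : measurableType d} (P : probability Om R).
Variables (T : R) (F : R -> set (set Om)) (W W' : R -> Om -> R).
Hypothesis hF : complete_filtration P T F.
Hypothesis hW : independent_brownian_motions P T F W W'.
Local Notation gam := (normal_law (1 : R)).

Let gauss_increment_pos r t X c s : 0 <= r -> r < t -> t <= T -> 0 < c ->
  mg (F r) X -> gauss P s X ->
  exists s', gauss P s' (fun w => X w + c * (W' t w - W' r w)).
Proof.
move=> r0 rt tT c0 gX [mX s0 hX].
have rT : 0 <= r <= T by rewrite r0 (le_trans (ltW rt)).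
have tT' : 0 <= t <= T by rewrite tT (le_trans r0)// ltW.
have md : measurable_fun setT (fun w => W' t w - W' r w).
  by apply: measurable_funB; apply: (meas_F hF _ (mg_W' hF hW _)).
pose b := c * Num.sqrt (t - r).
have sd0 : 0 < Num.sqrt (t - r) by rewrite sqrtr_gt0 subr_gt0.
have b0 : 0 < b by rewrite mulr_gt0.
(* [normal_convolution] needs positive deviations, so a degenerate [X] is treated apart. *)
pose s' := if s == 0 then b else Num.sqrt (s ^+ 2 + b ^+ 2).
exists s'; split.
- by apply: measurable_funD => //; exact: measurable_funM.
- by rewrite /s'; case: ifP => _; [exact: ltW|exact: sqrtr_ge0].
move=> f tf; have [cf f01] := tf.
have tc : test_fun (fun x => f (c * x)) by exact: continuous_test_scale.
have gXc : mg (F r) (fun w => c^-1 * X w) by exact: measurable_funM.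
(* [indep_comp] adds the increment with coefficient 1, so the sum is read as c times (X / c plus the
   increment). *)
have := @indep_comp _ _ _ P (F r) (fun w => W' t w - W' r w)
  (normal_law (Num.sqrt (t - r))) (filtration_meas hF rT) (filtrationI hF rT)
  (filtrationT hF rT) md (indep_W' hW r0 rt tT) (fun=> 1) (fun w => c^-1 * X w)
  (fun x => f (c * x)) 1 (@measurable_cst _ _ (g_sigma_algebraType (F r)) R setT 1)
  (L1_cst P 1) gXc (test_fun_meas tc) (fun x => test_fun_norm x tc).
under eq_Rintegral do rewrite mul1r mulrDr mulrA mulfV ?gt_eqF// mul1r.
move=> ->.
have ch : test_fun (fun x => \int[gam]_y f (x + b * y)) by exact: test_fun_smooth.
transitivity (\int[P]_w (fun x => \int[gam]_y f (x + b * y)) (X w)).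
  apply: eq_Rintegral => w _; rewrite mul1r.
  have tx : test_fun (fun y => f (X w + c * y)).
    split => // y; apply: (@continuous_comp _ _ _ (fun y => X w + c * y) f); last exact: cf.
    by apply: cvgD; [exact: cvg_cst|apply: cvgM; [exact: cvg_cst|exact: cvg_id]].
  transitivity (\int[normal_law (Num.sqrt (t - r))]_y f (X w + c * y)).
    by apply: eq_Rintegral => y _; rewrite mulrDr mulrA mulfV ?gt_eqF// mul1r.
  rewrite (normal_law_scale_test sd0 tx).
  by apply: eq_Rintegral => y _; rewrite /b mulrA.
rewrite (hX _ ch) /s'; have [->|sn0] := eqVneq s 0.
  under eq_Rintegral do rewrite mul0r.
  rewrite (ex_cst gam).
  by apply: eq_Rintegral => y _; rewrite add0r.
have sp : 0 < s by rewrite lt_neqAle eq_sym sn0.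
congr fine; rewrite -(normal_convolution sp b0 tf).
apply: eq_integral => x _; rewrite EFin_ex//.
apply: (@L1_bounded _ _ _ gam _ 1).
  apply: (measurableT_comp (test_fun_meas tf)).
  by apply: measurable_funD => //; exact: measurable_funM.
by move=> y; exact: test_fun_norm.
Qed.

Lemma gauss_increment r t X c s : 0 <= r -> r <= t -> t <= T ->
  mg (F r) X -> gauss P s X ->
  exists s', gauss P s' (fun w => X w + c * (W' t w - W' r w)).
Proof.
move=> r0; rewrite le_eqVlt => /orP[/eqP <- _ gX hX|rt tT gX hX].
  exists s; have -> : (fun w => X w + c * (W' r w - W' r w)) = X by apply/funext => w; ring.
  exact: hX.
have [c0|c0|->] := ltgtP c 0.
- have gN : mg (F r) (fun w => - X w) by exact: measurableT_comp.
  have c0' : 0 < - c by rewrite oppr_gt0.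
  have [s' hs'] := gauss_increment_pos r0 rt tT c0' gN (gaussN hX).
  exists s'; have := gaussN hs'; congr (gauss _ _ _).
  by apply/funext => w; ring.
- exact: (gauss_increment_pos r0 rt tT c0 gX hX).
- exists s; have -> : (fun w => X w + 0 * (W' t w - W' r w)) = X by apply/funext => w; ring.
  exact: hX.
Qed.

Let earlier (p q : R * R) := p.1 <= q.1.

(* The coefficient of the increment from [r] to the next time is the sum of all
   remaining coefficients. *)
Let gauss_sorted (l : seq (R * R)) r z X s : 0 <= r -> r <= T -> path earlier (r, z) l ->
  all (fun p => p.1 <= T) l -> mg (F r) X -> gauss P s X ->
  exists s', gauss P s' (fun w => X w + \sum_(p <- l) p.2 * (W' p.1 w - W' r w)).
Proof.
elim: l r z X s => [|[t c] l IH] r z X s r0 rT /=.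
  move=> _ _ _ hX; exists s; have -> : (fun w => X w + \sum_(p <- [::]) p.2 * (W' p.1 w - W' r w)) = X.
    by apply/funext => w; rewrite big_nil addr0.
  exact: hX.
rewrite /earlier/= => /andP[rt pl] /andP[tT allT] gX hX.
have t0 : 0 <= t by exact: le_trans rt.
pose C := c + \sum_(p <- l) p.2.
have [s1 hs1] := gauss_increment C r0 rt tT gX hX.
have gX1 : mg (F t) (fun w => X w + C * (W' t w - W' r w)).
  apply: measurable_funD; first exact: (mg_filtration_mono hF r0 rt tT).
  apply: measurable_funM => //; apply: measurable_funB.
    by apply: (mg_W' hF hW); rewrite t0.
  apply: (mg_filtration_mono hF r0 rt tT).
  by apply: (mg_W' hF hW); rewrite r0.
have [s' hs'] := IH t c _ _ t0 tT pl allT gX1 hs1.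
exists s'; move: hs'; congr (gauss _ _ _); apply/funext => w.
rewrite big_cons/= -addrA; congr (_ + _).
rewrite /C mulrDl -addrA; congr (_ + _).
rewrite mulr_suml -big_split/=; apply: eq_bigr => p _; ring.
Qed.

Lemma gauss_brownian_sum (l : seq (R * R)) : 0 <= T ->
  (forall p, p \in l -> 0 <= p.1 <= T) ->
  exists s, gauss P s (fun w => \sum_(p <- l) p.2 * (W' p.1 w - W' 0 w)).
Proof.
move=> T0 lT.
have tot : total earlier by move=> p q; exact: le_total.
have srt := sort_sorted tot l.
have pm : perm_eq (sort earlier l) l by rewrite perm_sort.
have zero : gauss P 0 (fun=> 0 : R).
  split => // f tf; rewrite ex_cst -[LHS](ex_cst gam).
  by apply: eq_Rintegral => y _; rewrite mul0r.
have pth : path earlier (0, 0) (sort earlier l).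
  case e : (sort earlier l) srt => [|p q]//= ->; rewrite andbT.
  have : p \in l by rewrite -(perm_mem pm) e mem_head.
  by move=> /lT /andP[].
have allT : all (fun p => p.1 <= T) (sort earlier l).
  by apply/allP => p; rewrite (perm_mem pm) => /lT /andP[].
have g0 : mg (F 0) (fun=> 0 : R) by exact: measurable_cst.
have [s hs] := gauss_sorted (lexx 0) T0 pth allT g0 zero.
exists s; move: hs; congr (gauss _ _ _); apply/funext => w.
by rewrite add0r; apply: perm_big.
Qed.

End brownian_sums.

(** * Approximation by Brownian increments *)

Section summable_convergence.
Context {R : realType} {d} {Om : measurableType d} (P : probability Om R).

(** The series of the u_n has finite expectation, hence is finite almost surely, and its terms tend
    to 0. *)
Lemma summable_ae_cvg (u : nat -> Om -> R) :
  (forall n, L1 P (u n)) -> (forall n w, 0 <= u n w) ->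
  (forall n, \int[P]_w u n w <= 2 ^- n) ->
  {ae P, forall w, u n w @[n --> \oo] --> 0}.
Proof.
move=> Lu u0 hu.
have mu n : measurable_fun setT (fun w => (u n w)%:E).
  by apply/measurable_EFinP; exact: L1_meas (Lu n).
have uE0 n w : (0 <= (u n w)%:E)%E by rewrite lee_fin.
have fin_sum : (\int[P]_w (\sum_(0 <= n <oo) (u n w)%:E) < +oo)%E.
  rewrite integral_nneseries//.
  apply: (@le_lt_trans _ _ (\sum_(0 <= n <oo) (2 ^- n)%:E)%E).
    apply: lee_nneseries => [n _ _|n _]; first by apply: integral_ge0 => w _; exact: uE0.
    by rewrite -EFin_ex// lee_fin.
  have e n : (2 ^- n : R) = geometric 1 2^-1 n by rewrite /geometric/= mul1r exprVn.
  under eq_eseriesr do rewrite e.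
  have h : `|(2^-1 : R)| < 1 by rewrite ger0_norm ?invr_ge0//; lra.
  have -> : (\sum_(0 <= n <oo) (geometric 1 2^-1 n : R)%:E)%E = ((1 - 2^-1)^-1 : R)%:E.
    apply/cvg_lim => //.
    have -> : (fun n => \sum_(0 <= k < n) (geometric 1 (2^-1 : R) k)%:E)%E =
        EFin \o series (geometric 1 (2^-1 : R)).
      by apply/funext => n; rewrite /= sumEFin.
    apply: cvg_EFin; first exact: nearW.
    by have := cvg_geometric_series (a := 1) h; rewrite div1r.
  exact: ltry.
have mS : measurable_fun setT (fun w => (\sum_(0 <= n <oo) (u n w)%:E)%E).
  by apply: ge0_emeasurable_sum => // n w _ _; exact: uE0.
have S0 w : (0 <= \sum_(0 <= n <oo) (u n w)%:E)%E by apply: nneseries_ge0 => n _ _.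
have i : P.-integrable setT (fun w => (\sum_(0 <= n <oo) (u n w)%:E)%E).
  apply/integrableP; split => //.
  by under eq_integral do rewrite gee0_abs//.
have := integrable_ae measurableT i; apply: filterS => w /(_ I) hw.
have fin : (\sum_(0 <= n <oo) (u n w)%:E < +oo)%E by rewrite -ge0_fin_numE.
apply: (@cvg_series_cvg_0 _ R^o); apply: nondecreasing_is_cvgn.
  by apply/nondecreasing_seqP => n; rewrite seriesEnat/= big_nat_recr//= lerDl.
exists (fine (\sum_(0 <= n <oo) (u n w)%:E)%E) => _ [n _ <-].
rewrite -lee_fin fineK ?ge0_fin_numE// seriesEnat/= -sumEFin.
by apply: nneseries_lim_ge => k _ _.
Qed.

End summable_convergence.

(** Values are taken relative to [B 0], which vanishes only almost surely. *)
Definition brownian_sum (R : realType) (Om : Type) (B : R -> Om -> R)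
    (l : seq (R * R)) (w : Om) : R :=
  \sum_(p <- l) p.2 * (B p.1 w - B 0 w).

Definition before (R : realType) (t : R) (l : seq (R * R)) :=
  forall p, p \in l -> 0 <= p.1 <= t.

Definition trunc1 (R : realType) (x : R) : R := Num.min 1 `|x|.

Lemma measurable_brownian_sum (R : realType) d (E : measurableType d) (B : R -> E -> R) t l :
  (forall s, 0 <= s <= t -> measurable_fun setT (B s)) -> before t l ->
  measurable_fun setT (brownian_sum B l).
Proof.
move=> mB; rewrite /brownian_sum; elim: l => [|p l IH] lt.
  by under eq_fun do rewrite big_nil; exact: measurable_cst.
under eq_fun do rewrite big_cons.
have /andP[p0 pt] := lt p (mem_head _ _).
apply: measurable_funD; last first.
  by apply: IH => q ql; apply: lt; rewrite inE ql orbT.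
apply: measurable_funM => //; apply: measurable_funB; apply: mB; first by rewrite p0.
by rewrite lexx (le_trans p0 pt).
Qed.

(** * Limits in probability of Brownian sums *)

Section approximable.
Context {R : realType} {d} {Om : measurableType d} (P : probability Om R).
Variables (T : R) (B : R -> Om -> R).
Hypothesis mB : forall s, 0 <= s <= T -> measurable_fun setT (B s).

Lemma trunc1_ge0 (x : R) : 0 <= trunc1 x.
Proof. by rewrite le_min ler01 normr_ge0. Qed.

Lemma trunc1D (x y : R) : trunc1 (x + y) <= trunc1 x + trunc1 y.
Proof.
have hD := ler_normD x y; have hx := normr_ge0 x; have hy := normr_ge0 y.
rewrite /trunc1 ge_min; have [h1|h1] := leP 1 `|x|; have [h2|h2] := leP 1 `|y|.
- by rewrite lerDl ler01.
- by rewrite lerDl hy.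
- by rewrite lerDr hx.
- by rewrite hD orbT.
Qed.

Lemma trunc1Z (a x : R) : trunc1 (a * x) <= (1 + `|a|) * trunc1 x.
Proof.
have ha := normr_ge0 a; have hx := normr_ge0 x.
rewrite /trunc1 normrM; set u := `|a| in ha *; set v := `|x| in hx *.
rewrite ge_min; have [v1|v1] := leP 1 v.
  by rewrite mulr1 lerDl ha.
by rewrite mulrDl mul1r lerDr hx orbT.
Qed.

Lemma measurable_trunc1 (f : Om -> R) : measurable_fun setT f ->
  measurable_fun setT (fun w => trunc1 (f w)).
Proof. by move=> mf; apply: measurable_minr => //; exact: measurableT_comp. Qed.

Lemma L1_trunc1 (f : Om -> R) : measurable_fun setT f -> L1 P (fun w => trunc1 (f w)).
Proof.
move=> mf; apply: (@L1_bounded _ _ _ _ _ 1); first exact: measurable_trunc1.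
by move=> w; rewrite ger0_norm ?trunc1_ge0// /trunc1 ge_min lexx.
Qed.

(* The expectation of [trunc1] metrizes convergence in probability. *)
Definition approximable (t : R) (h : Om -> R) : Prop :=
  measurable_fun setT h /\ forall eps, 0 < eps -> exists2 l, before t l &
    \int[P]_w trunc1 (h w - brownian_sum B l w) <= eps.

Let mS t l : t <= T -> before t l -> measurable_fun setT (brownian_sum B l).
Proof.
move=> tT lt; apply: (@measurable_brownian_sum _ _ _ _ t) => // s /andP[s0 st].
by apply: mB; rewrite s0 (le_trans st).
Qed.

Lemma approximable_sum t l : t <= T -> before t l -> approximable t (brownian_sum B l).
Proof.
move=> tT lt; split; first exact: mS lt.
move=> eps e0; exists l => //.
under eq_Rintegral do rewrite subrr /trunc1 normr0 minElt ltNge ler01/=.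
by rewrite ex_cst ltW.
Qed.

Lemma approximable_mono s t (h : Om -> R) : s <= t -> approximable s h -> approximable t h.
Proof.
move=> st [mh hh]; split => // eps /hh[l ls le]; exists l => // p /ls /andP[-> ps].
exact: le_trans st.
Qed.

Lemma approximableZ t a h : t <= T -> approximable t h -> approximable t (fun w => a * h w).
Proof.
move=> tT [mh hh]; split; first exact: measurable_funM.
move=> eps e0; have C0 : 0 < 1 + `|a| by rewrite ltr_wpDr.
have e0' : 0 < eps / (1 + `|a|) by rewrite divr_gt0.
have [l lt le] := hh _ e0'; have ml := mS tT lt.
exists (map (fun p => (p.1, a * p.2)) l); first by move=> _ /mapP[p pl ->]; exact: (lt p pl).
have L1l := L1_trunc1 (measurable_funB mh ml).
apply: (@le_trans _ _ (\int[P]_w ((1 + `|a|) * trunc1 (h w - brownian_sum B l w)))); last first.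
  by rewrite exZ// mulrC -ler_pdivlMr.
have e w : a * h w - brownian_sum B [seq (p.1, a * p.2) | p <- l] w = a * (h w - brownian_sum B l w).
  rewrite mulrBr; congr (_ - _); rewrite /brownian_sum big_map mulr_sumr.
  by apply: eq_bigr => p _ /=; rewrite mulrA.
under eq_Rintegral do rewrite e.
apply: ex_le; [|exact: L1Z|by move=> w; exact: trunc1Z].
by apply: L1_trunc1; apply: measurable_funM => //; exact: measurable_funB.
Qed.

Lemma approximableD t h k : t <= T -> approximable t h -> approximable t k ->
  approximable t (fun w => h w + k w).
Proof.
move=> tT [mh hh] [mk hk]; split; first exact: measurable_funD.
move=> eps e0; have e0' : 0 < eps / 2 by rewrite divr_gt0.
have [l lt le] := hh _ e0'; have [l' lt' le'] := hk _ e0'.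
have ml := mS tT lt; have ml' := mS tT lt'.
exists (l ++ l'); first by move=> p; rewrite mem_cat => /orP[/lt|/lt'].
have L := L1_trunc1 (measurable_funB mh ml); have L' := L1_trunc1 (measurable_funB mk ml').
have -> : eps = eps / 2 + eps / 2 by field.
apply: le_trans (lerD le le'); rewrite -exD//.
have e w : h w + k w - brownian_sum B (l ++ l') w =
    (h w - brownian_sum B l w) + (k w - brownian_sum B l' w).
  by rewrite /brownian_sum big_cat/=; ring.
under eq_Rintegral do rewrite e.
apply: ex_le; [|exact: L1D|by move=> w; exact: trunc1D].
by apply: L1_trunc1; apply: measurable_funD; exact: measurable_funB.
Qed.

Lemma approximable_bigsum t n (h : 'I_n -> Om -> R) : t <= T ->
  (forall i, approximable t (h i)) -> approximable t (fun w => \sum_(i < n) h i w).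
Proof.
move=> tT; elim: n h => [|n IH] h hh.
  under eq_fun do rewrite big_ord0.
  have -> : (fun=> 0) = brownian_sum B [::] by apply/funext => w; rewrite /brownian_sum big_nil.
  exact: approximable_sum.
under eq_fun do rewrite big_ord_recr/=.
by apply: approximableD => //; exact: IH.
Qed.

Lemma approximable_ae_lim t (h_ : nat -> Om -> R) (h : Om -> R) : t <= T ->
  (forall n, approximable t (h_ n)) -> measurable_fun setT h ->
  {ae P, forall w, h_ n w @[n --> \oo] --> h w} -> approximable t h.
Proof.
move=> tT hh mh ch; split => // eps e0.
have e0' : 0 < eps / 2 by rewrite divr_gt0.
have mhn n : measurable_fun setT (h_ n) by case: (hh n).
have cv : \int[P]_w trunc1 (h w - h_ n w) @[n --> \oo] --> \int[P]_w (0 : R).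
  apply: (@ex_dct_bounded _ _ _ _ _ _ 1) => //.
  - by move=> n; apply: measurable_trunc1; exact: measurable_funB.
  - by move=> n w; rewrite ger0_norm ?trunc1_ge0// /trunc1 ge_min lexx.
  - apply: filterS ch => w cw; apply/cvgrPdist_le => e e1; near=> n.
    rewrite sub0r normrN ger0_norm ?trunc1_ge0// /trunc1 ge_min; apply/orP; right.
    by near: n; exact: cvgr_dist_le.
rewrite ex_cst in cv.
have [n hn] : exists n, \int[P]_w trunc1 (h w - h_ n w) <= eps / 2.
  have /(cvgr_le _ cv) [N _ /(_ N (leqnn N)) hN] := e0'.
  by exists N.
have [_ /(_ _ e0')[l lt le]] := hh n; have ml := mS tT lt.
exists l => //; have -> : eps = eps / 2 + eps / 2 by field.
have L := L1_trunc1 (measurable_funB mh (mhn n)).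
have L' := L1_trunc1 (measurable_funB (mhn n) ml).
apply: le_trans (lerD hn le); rewrite -exD//.
have e w : h w - brownian_sum B l w = (h w - h_ n w) + (h_ n w - brownian_sum B l w) by ring.
apply: ex_le; [|exact: L1D|by move=> w; rewrite e; exact: trunc1D].
by apply: L1_trunc1; exact: measurable_funB.
Unshelve. all: end_near. Qed.

Lemma approximable_seq t (h : Om -> R) : t <= T -> approximable t h -> exists l : nat -> seq (R * R),
  (forall n, before t (l n)) /\ {ae P, forall w, brownian_sum B (l n) w @[n --> \oo] --> h w}.
Proof.
move=> tT [mh hh].
have [l hl] : exists l : nat -> seq (R * R), forall n,
    before t (l n) /\ \int[P]_w trunc1 (h w - brownian_sum B (l n) w) <= 2 ^- n.
  suff : forall n : nat, exists l, before t l /\ \int[P]_w trunc1 (h w - brownian_sum B l w) <= 2 ^- n.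
    by move=> /choice[l hl]; exists l.
  move=> n; have e0 : (0 : R) < 2 ^- n by rewrite invr_gt0 exprn_gt0.
  by have [l lt le] := hh _ e0; exists l.
exists l; split; first by move=> n; have [] := hl n.
have ml n : measurable_fun setT (brownian_sum B (l n)) by have [lt _] := hl n; exact: mS lt.
have := @summable_ae_cvg _ _ _ P (fun n w => trunc1 (h w - brownian_sum B (l n) w))
  (fun n => L1_trunc1 (measurable_funB mh (ml n))) (fun n w => trunc1_ge0 _)
  (fun n => proj2 (hl n)).
apply: filterS => w cw; apply/cvgrPdist_lt => e e0; near=> n.
have : trunc1 (h w - brownian_sum B (l n) w) < Num.min 1 e.
  by near: n; apply: (cvgr_lt _ cw); rewrite lt_min ltr01.
by rewrite lt_min /trunc1 !gt_min ltxx/= => /andP[h1 /orP[|//]]; exact: lt_trans.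
Unshelve. all: end_near. Qed.

Lemma approximable_gauss h :
  (forall l, before T l -> exists s, gauss P s (brownian_sum B l)) ->
  approximable T h -> exists s, gauss P s h.
Proof.
move=> hg ah; have [l [lT cl]] := approximable_seq (lexx T) ah.
suff [s hs] : exists s : nat -> R, forall n, gauss P (s n) (brownian_sum B (l n)).
  by have [mh _] := ah; exact: gauss_limit hs mh cl.
suff : forall n, exists s, gauss P s (brownian_sum B (l n)) 
  by move=> /choice[s hs]; exists s.
by move=> n; exact: hg (lT n).
Qed.

(** The upper limit of the approximating sums is everywhere defined and [G]-measurable, so [G] is
    not completed; it is finite and equal to [h] almost surely. *)
Lemma approximable_adapted (G : set (set Om)) t h : t <= T ->
  (forall s, 0 <= s <= t -> mg G (B s)) -> approximable t h ->
  exists2 h', mg G h' & {ae P, forall w, h w = h' w}.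
Proof.
move=> tT gB ah; have [l [lt cl]] := approximable_seq tT ah.
exists (fun w => fine (limn_esup (fun n => (brownian_sum B (l n) w)%:E))).
  apply: (@measurableT_comp _ _ _ (g_sigma_algebraType G)) => //.
  apply: (@measurable_fun_limn_esup _ (g_sigma_algebraType G)) => n.
  apply/measurable_EFinP.
  exact: (@measurable_brownian_sum _ _ (g_sigma_algebraType G) B t _ gB (lt n)).
apply: filterS cl => w cw.
have cE : (brownian_sum B (l n) w)%:E @[n --> \oo] --> (h w)%:E.
  by apply: cvg_EFin => //; exact: nearW.
rewrite is_cvg_limn_esupE; last by apply/cvg_ex; exists (h w)%:E.
by rewrite (cvg_lim _ cE).
Qed.

End approximable.

(** * Gaussian conditional processes *)

Section paths.
Context {R : realType}.
Local Notation lam := (@lebesgue_measure R).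

Lemma within_cvg (f : R -> R) (a b s : R) (u : nat -> R) :
  {within `[a, b], continuous f} -> a <= s <= b -> (forall n, a <= u n <= b) ->
  u n @[n --> \oo] --> s -> f (u n) @[n --> \oo] --> f s.
Proof.
move=> /subspace_continuousP cf sab uab us.
have /cf h : `[a, b]%classic s by rewrite /= in_itv.
apply: cvg_trans h => A; rewrite /nbhs/= /within/= => hA.
have /us : nbhs s [set y | `[a, b]%classic y -> A (f y)] by exact: hA.
move=> [n _ hn]; exists n => // k nk; apply: (hn k nk).
by rewrite /= in_itv/=; exact: uab.
Qed.

(** A Riemann sum is the integral of a step function under the uniform law, and dominated
    convergence applies. *)
Lemma riemann_sum (f : R -> R) (t : R) : 0 <= t -> {within `[0, t], continuous f} ->
  t / n.+1%:R * (\sum_(k < n.+1) f (tk t n.+1 k)) @[n --> \oo] -->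
    \int[lam]_(s in `[0, t]) f s.
Proof.
rewrite le_eqVlt => /orP[/eqP <- _|t0 cf].
  rewrite set_itv1 Rintegral_set1.
  under eq_fun do rewrite mul0r mul0r.
  exact: cvg_cst.
(* The half-open interval, because the step functions vanish at the right end point. *)
pose g := f \_ `[0, t[.
have mf : measurable_fun `[0, t] f by exact: subspace_continuous_measurable_fun.
have sub : `[0, t[%classic `<=` `[0, t]%classic by move=> s /=; rewrite !in_itv/= => /andP[-> /ltW].
have mfo : measurable_fun `[0, t[ f.
  by apply: measurable_funS mf.
have mgg : measurable_fun setT g.
  by have /measurable_restrictT := mfo; apply; exact: measurable_itv.
have [C hC] : exists C, forall s, 0 <= s <= t -> `|f s| <= C.
  have [c _ hc] := EVT_max (ltW t0) cf; have [c' _ hc'] := EVT_min (ltW t0) cf.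
  exists (`|f c| + `|f c'|) => s st.
  have h1 : f s <= f c by apply: hc; rewrite in_itv.
  have h2 : f c' <= f s by apply: hc'; rewrite in_itv.
  have h3 := ler_norm (f c); have h4 := ler_norm (- f c'); rewrite normrN in h4.
  have h5 := normr_ge0 (f c); have h6 := normr_ge0 (f c').
  by rewrite ler_norml; apply/andP; split; lra.
have C0 : 0 <= C by apply: le_trans (normr_ge0 (f 0)) (hC 0 _); rewrite lexx ltW.
have intE : \int[lam]_(s in `[0, t]) f s = t * \int[time_law t0]_s g s.
  rewrite -integral_time_law//.
  have gf : \int[lam]_(s in `[0, t[) g s = \int[lam]_(s in `[0, t[) f s.
    by apply: eq_Rintegral => s st; rewrite /g patchE st.
  rewrite -[LHS]Rintegral_itv_bndo_bndc; last first.
    apply: (@integrableS _ _ _ lam `[0, t]%classic) => //.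
    by apply: continuous_compact_integrable => //; exact: segment_compact.
  rewrite -gf Rintegral_itv_bndo_bndc//.
  apply: (@eq_integrable _ _ _ lam _ _ (EFin \o f)) => //.
    by move=> s st; rewrite /= /g patchE st.
  apply: (@integrableS _ _ _ lam `[0, t]%classic) => //.
  by apply: continuous_compact_integrable => //; exact: segment_compact.
rewrite intE.
have -> : (fun n => t / n.+1%:R * (\sum_(k < n.+1) f (tk t n.+1 k))) =
    (fun n => t * \int[time_law t0]_s step t n.+1 (fun k => f (tk t n.+1 k)) s).
  by apply/funext => n; rewrite step_integral// mulrAC mulrA.
apply: cvgM; first exact: cvg_cst.
apply: (@ex_dct_bounded _ _ _ _ _ _ C).
- by move=> n; exact: (L1_meas (@L1_step _ _ t0 n.+1 (fun k => f (tk t n.+1 k)))).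
- exact: mgg.
- move=> n s; have [st|st] := pselect (0 <= s < t); last by rewrite step_out// normr0.
  rewrite step_in//; apply: hC; apply: tk_itv => //.
  by have [h _] := cellP t0 (ltn0Sn n) st; exact: ltnW.
- apply: aeW => s; have [st|st] := pselect (0 <= s < t); last first.
    rewrite /g patchE memNset; last by rewrite /= in_itv.
    by under eq_fun do rewrite step_out//; exact: cvg_cst.
  rewrite /g patchE mem_set; last by rewrite /= in_itv.
  under eq_fun do rewrite step_in//.
  have h n := cellP t0 (ltn0Sn n) st.
  apply: (within_cvg (u := fun n => tk t n.+1 (cell t n.+1 s)) cf).
  - by have /andP[-> /ltW] := st.
  - by move=> n; have [h1 _] := h n; apply: tk_itv => //; exact: ltnW.
  - apply/cvgrPdist_le => e e0; near=> n.
    have [_ /andP[h1 h2]] := h n.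
    have : s - tk t n.+1 (cell t n.+1 s) <= t / n.+1%:R.
      by move: h2; rewrite /tk -natr1 mulrDl mul1r -/(tk _ _ _); move=> h2; rewrite lerBlDl ltW.
    rewrite ger0_norm ?subr_ge0//; move/le_trans; apply.
    rewrite ler_pdivrMr// -ler_pdivrMl//.
    apply: (@le_trans _ _ n%:R); last by rewrite ler_nat.
    by near: n; exact: nbhs_infty_ger.
Unshelve. all: end_near. Qed.

(* The predecessor keeps the index at most [n], also for [t = T]. *)
Definition below (T t : R) (n : nat) : nat := (Num.truncn (t * n.+1%:R / T)).-1.

(** In the factor 2, one cell is lost by rounding down and one by the predecessor. *)
Lemma belowP (T t : R) n : 0 < T -> 0 <= t <= T ->
  [/\ (below T t n < n.+1)%N, 0 <= tk T n.+1 (below T t n) <= t &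
      t - 2 * (T / n.+1%:R) <= tk T n.+1 (below T t n)].
Proof.
move=> T0 /andP[t0 tT]; rewrite /below; set x := t * n.+1%:R / T.
have x0 : 0 <= x by rewrite divr_ge0 ?mulr_ge0// ltW.
have /andP[h1 h2] := truncn_itv x0.
have xn : x <= n.+1%:R by rewrite ler_pdivrMr// mulrC ler_wpM2l.
have d0 : 0 < T / n.+1%:R by rewrite divr_gt0.
have tE : t = x * (T / n.+1%:R) by rewrite /x; field; rewrite !gt_eqF.
have k1 : ((Num.truncn x).-1%:R : R) <= x.
  by apply: le_trans h1; rewrite ler_nat leq_pred.
split.
- have : (Num.truncn x <= n.+1)%N by rewrite -(ler_nat R) (le_trans h1).
  by case: (Num.truncn x).
- by rewrite /tk (mulr_ge0 _ (ltW d0))//= [leRHS]tE (ler_wpM2r (ltW d0)).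
- rewrite /tk [X in X - _]tE -mulrBl (ler_wpM2r (ltW d0))// lerBlDr.
  apply: le_trans (ltW h2) _; rewrite -natrD ler_nat addn2.
  by case: (Num.truncn x).
Qed.

End paths.

(** * Passage to fixed omega^0 and to all times *)

Section conditional_paths.
Context {R : realType} (T : R) {d0} {Om0 : measurableType d0}
  {dt} {Omt : measurableType dt}.
Variables (P0 : probability Om0 R) (Pt : probability Omt R).
Local Notation Om := (Om0 * Omt)%type.
Local Notation P := ((P0 \x Pt)%E : probability (Om0 * Omt)%type R).
Variables (F : R -> set (set Om)) (W : R -> Om0 -> R) (B : R -> Omt -> R).
Hypothesis T_gt0 : (0 : R) < T.
Hypothesis hF : complete_filtration P T F.
Local Notation iW := (fun t (w : Om) => W t w.1).
Local Notation iB := (fun t (w : Om) => B t w.2).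
Hypothesis hW : independent_brownian_motions P T F iW iB.
Let T0 : (0 : R) <= T. Proof. exact: ltW. Qed.
Let T0T : 0 <= T <= T. Proof. by rewrite T0 lexx. Qed.
Local Notation lam := (@lebesgue_measure R).
Local Notation approx := (approximable Pt B).

Lemma measurable_noise s : 0 <= s <= T -> measurable_fun setT (B s).
Proof.
move=> sT; have m : measurable_fun setT (fun w : Om => B s w.2) := meas_F hF sT (mg_W' hF hW sT).
exact: (meas_sndV m).
Qed.

Let mB := measurable_noise.

Lemma approximable_increment s t : 0 <= s <= t -> t <= T ->
  approx t (fun w => B s w - B 0 w).
Proof.
move=> st tT; have h : before t [:: (s, 1 : R)] by move=> p; rewrite inE => /eqP ->.
have := approximable_sum Pt mB tT h; congr approximable.
by apply/funext => w; rewrite /brownian_sum big_seq1 mul1r.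
Qed.

Lemma approximable_chaos N k (c : nat -> Om0 -> R) w0 : (0 < N)%N -> (k <= N)%N ->
  approx (tk T N k) (fun wt => chaos T Pt B N k c (w0, wt)).
Proof.
move=> N0 kN; have /andP[k0 kT] := tk_itv T_gt0 N0 kN.
apply: (approximable_bigsum mB) => // -[i ik] /=.
apply: (approximableZ mB) => //; apply: (approximableZ mB) => //.
have a j : (j <= k)%N -> approx (tk T N k) (fun w => B (tk T N j) w - B 0 w).
  move=> jk; apply: approximable_increment => //.
  have /andP[-> _] := tk_itv T_gt0 N0 (leq_trans jk kN).
  exact: tk_le.
have := approximableD mB kT (a i.+1 ik) (approximableZ mB (-1) kT (a i (ltnW ik))).
congr approximable; apply/funext => w; ring.
Qed.

Lemma gauss_noise_sum l : before T l -> exists s, gauss Pt s (brownian_sum B l).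
Proof.
move=> lT; have [s [_ s0 hs]] := gauss_brownian_sum hF hW T0 lT.
have m : measurable_fun setT (brownian_sum B l).
  by apply: (@measurable_brownian_sum _ _ _ _ T).
exists s; split => // f tf; rewrite -(hs f tf).
rewrite -(ex_snd P0 Pt (f := fun w => f (brownian_sum B l w)))//.
exact: (measurableT_comp (test_fun_meas tf)).
Qed.

Variables (G : Om -> R) (U V Q Q' : R -> Om -> R).
Hypothesis hS : fbsde_solution P T F iW iB (fun=> 0) iB G U V Q Q'.

Hypothesis defect : forall N k, (0 < N)%N -> (k <= N)%N -> exists c : nat -> Om0 -> R,
  [/\ forall j, (j < k)%N -> L2 P0 (c j),
      L2 P (fun w => V (tk T N k) w - chaos T Pt B N k c w) &
      (N - k)%:R * \int[P]_w ((V (tk T N k) w - chaos T Pt B N k c w) ^+ 2)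
        <= Num.sqrt N%:R * \int[P]_w (V T w ^+ 2)].

(** The defect bound is used on the refinements with M j^2 points, in which the same time has index
    i j^2; there the squared defect is of order 1 / j. Choosing j to make it at most 2^-n gives
    almost sure convergence, which is then read on sections. *)
Lemma approximable_grid M i : (i < M)%N ->
  {ae P0, forall w0, approx (tk T M i) (fun wt => V (tk T M i) (w0, wt))}.
Proof.
move=> iM; have M0 : (0 < M)%N by exact: leq_ltn_trans iM.
have tT : 0 <= tk T M i <= T by exact: (tk_itv T_gt0 M0 (ltnW iM)).
pose q := \int[P]_w (V T w ^+ 2).
have q0 : 0 <= q by apply: ex_ge0 => w; exact: sqr_ge0.
have [e he] : exists e : nat -> Om -> R, forall n, [/\ L2 P (e n),
    \int[P]_w (e n w ^+ 2) <= 2 ^- n &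
    forall w0, approx (tk T M i) (fun wt => V (tk T M i) (w0, wt) - e n (w0, wt))].
  suff : forall n : nat, exists e : Om -> R, [/\ L2 P e, \int[P]_w (e w ^+ 2) <= 2 ^- n &
    forall w0, approx (tk T M i) (fun wt => V (tk T M i) (w0, wt) - e (w0, wt))].
    by move=> /choice[e he]; exists e.
  (* The squared defect is at most sqrt M * q / j, so j >= [C] brings it below 2^-n. *)
  move=> n; pose C := Num.sqrt M%:R * q * 2 ^+ n.
  have C0 : 0 <= C by rewrite mulr_ge0// mulr_ge0// sqrtr_ge0.
  pose j := (Num.truncn C).+1.
  have jC : C <= j%:R by apply: ltW; exact: truncnS_gt.
  have j0 : (0 : R) < j%:R by rewrite ltr0n.
  have N0 : (0 < M * j ^ 2)%N by rewrite muln_gt0 M0 expn_gt0.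
  have kN : (i * j ^ 2 <= M * j ^ 2)%N by rewrite leq_mul2r ltnW ?orbT.
  have tkE : tk T (M * j ^ 2) (i * j ^ 2) = tk T M i.
    rewrite /tk !natrM; field.
    by rewrite pnatr_eq0 -lt0n M0 gt_eqF.
  have [c [_ Lc]] := defect N0 kN.
  rewrite tkE in Lc *; move=> hc.
  exists (fun w => V (tk T M i) w - chaos T Pt B (M * j ^ 2) (i * j ^ 2) c w); split => //.
    move: hc; set E := \int[P]_w _; rewrite -/q.
    have E0 : 0 <= E by apply: ex_ge0 => w; exact: sqr_ge0.
    have s1 : Num.sqrt (M * j ^ 2)%:R = Num.sqrt M%:R * j%:R :> R.
      by rewrite natrM natrX sqrtrM// sqrtr_sqr gtr0_norm.
    have s2 : (j%:R ^+ 2 : R) <= (M * j ^ 2 - i * j ^ 2)%:R.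
      by rewrite -mulnBl -natrX ler_nat leq_pmull// subn_gt0.
    rewrite s1 => h1.
    have h2 : j%:R ^+ 2 * E <= Num.sqrt M%:R * j%:R * q.
      by apply: le_trans h1; rewrite ler_wpM2r.
    have h3 : j%:R * E <= Num.sqrt M%:R * q.
      rewrite -(ler_pM2l j0) mulrA -expr2 (le_trans h2)// le_eqVlt.
      by apply/orP; left; apply/eqP; ring.
    have p0 : (0 : R) < 2 ^+ n by rewrite exprn_gt0.
    rewrite -[2 ^- n]mul1r ler_pdivlMr// -(ler_pM2l j0) mulr1 mulrA.
    by apply: le_trans jC; rewrite /C ler_wpM2r// ltW.
  move=> w0; have := @approximable_chaos _ _ c w0 N0 kN; rewrite tkE.
  by congr approximable; apply/funext => wt; rewrite subKr.
have := @summable_ae_cvg _ _ _ P (fun n w => e n w ^+ 2)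
  (fun n => let: And3 h _ _ := he n in L2_sq h) (fun n w => sqr_ge0 _)
  (fun n => let: And3 _ h _ := he n in h).
move=> /ae_section; apply: filterS => w0 cw0.
have /andP[_ tT'] := tT.
apply: (approximable_ae_lim mB (h_ := fun n wt => V (tk T M i) (w0, wt) - e n (w0, wt))) => //.
- by move=> n; have [_ _] := he n; apply.
- exact: (meas_section w0 (fbsde_measY hF hS tT)).
- apply: filterS cw0 => wt cw; apply/cvgrPdist_lt => eps eps0; near=> n.
  have : e n (w0, wt) ^+ 2 < eps ^+ 2.
    by near: n; apply: (cvgr_lt _ cw); rewrite exprn_gt0.
  by rewrite subKr -[_ ^+ 2]real_normK ?num_real// ltr_pXn2r// nnegrE ltW.
Unshelve. all: end_near. Qed.

(** Every t, including T, is a limit from below of grid times before T; staying below [t] keeps the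
    approximations within the noise up to [t]. *)
Let approximable_continuous (f : R -> Omt -> R) :
  (forall t, 0 <= t <= T -> measurable_fun setT (f t)) ->
  {ae Pt, forall w, {within `[0, T], continuous (fun t => f t w)}} ->
  (forall M i, (i < M)%N -> approx (tk T M i) (f (tk T M i))) ->
  forall t, 0 <= t <= T -> approx t (f t).
Proof.
move=> mf cf gf t tT; have /andP[_ tT'] := tT.
have b n := belowP n T_gt0 tT.
apply: (approximable_ae_lim mB (h_ := fun n => f (tk T n.+1 (below T t n)))) => //.
- move=> n; have [b1 /andP[_ b2] _] := b n.
  exact: approximable_mono b2 (gf _ _ b1).
- exact: mf.
- apply: filterS cf => w cw.
  apply: (within_cvg (u := fun n => tk T n.+1 (below T t n)) cw tT).
    move=> n; have [_ /andP[-> b2] _] := b n; exact: le_trans tT'.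
  apply: (@squeeze_cvgr _ _ _ _ (fun n => t - 2 * (T / n.+1%:R)) (fun=> t)).
  - by apply: nearW => n; have [_ /andP[_ ->] ->] := b n.
  - rewrite -[X in _ --> X]subr0; apply: cvgB; first exact: cvg_cst.
    rewrite -[X in _ --> X](mulr0 2); apply: cvgM; first exact: cvg_cst.
    rewrite -[X in _ --> X](mulr0 T); apply: cvgM; first exact: cvg_cst.
    exact: cvg_harmonic.
  - exact: cvg_cst.
Qed.

Lemma approximable_paths : {ae P0, forall w0, forall t, 0 <= t <= T ->
  approx t (fun wt => U t (w0, wt)) /\ approx t (fun wt => V t (w0, wt))}.
Proof.
(* Only the countably many grid times share a null set of omega^0; all other times are reached by
   continuity on each section. *)
have h1 : {ae P0, forall w0, forall M i, (i < M)%N ->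
    approx (tk T M i) (fun wt => V (tk T M i) (w0, wt))}.
  apply/ae_foralln => M; apply/ae_foralln => i.
  have [iM|iM] := boolP (i < M)%N; last by apply: aeW.
  by have := approximable_grid iM; apply: filterS.
have [cU cV] : continuous_paths P T U /\ continuous_paths P T V by case: hS.
have hE t : 0 <= t <= T -> {ae P, forall w,
    U t w = 0 - \int[lam]_(s in `[0%R, t]) V s w + B t w.2} by case: hS => _ _ h _ _; exact: (h t).
have h2 : {ae P0, forall w0, forall M i, (i < M)%N -> {ae Pt, forall wt,
    U (tk T M i) (w0, wt) = 0 - \int[lam]_(s in `[0%R, tk T M i]) V s (w0, wt) + B (tk T M i) wt}}.
  apply/ae_foralln => M; apply/ae_foralln => i.
  have [iM|iM] := boolP (i < M)%N; last by apply: aeW.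
  have M0 : (0 < M)%N by exact: leq_ltn_trans iM.
  have := ae_section (hE _ (tk_itv T_gt0 M0 (ltnW iM))).
  by apply: filterS.
have B0 : {ae Pt, forall wt, B 0 wt = 0}.
  by case: hW => _ _ + _ => h; apply: (ae_sndV (P0 := P0)); apply: filterS h => w [].
have h3 := ae_section cU; have h4 := ae_section cV.
have h34 : {ae P0, forall w0,
    {ae Pt, forall wt, {within `[0, T], continuous (fun t => U t (w0, wt))}} /\
    {ae Pt, forall wt, {within `[0, T], continuous (fun t => V t (w0, wt))}}}.
  by apply: filterS2 h3 h4 => w0.
apply: filterS3 h1 h2 h34 => w0 gV eU [kU kV].
have mV t : 0 <= t <= T -> measurable_fun setT (fun wt => V t (w0, wt)).
  by move=> tT; exact: (meas_section w0 (fbsde_measY hF hS tT)).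
have mU t : 0 <= t <= T -> measurable_fun setT (fun wt => U t (w0, wt)).
  by move=> tT; exact: (meas_section w0 (meas_F hF tT (fbsde_mgX hF hS tT))).
have aV : forall t, 0 <= t <= T -> approx t (fun wt => V t (w0, wt)).
  exact: (approximable_continuous mV kV gV).
suff aU : forall t, 0 <= t <= T -> approx t (fun wt => U t (w0, wt)).
  by move=> t tT; split; [exact: aU|exact: aV].
apply: (approximable_continuous mU kU) => M i iM.
have M0 : (0 < M)%N by exact: leq_ltn_trans iM.
have tT := tk_itv T_gt0 M0 (ltnW iM).
move: (eU M i iM) tT; set t := tk T M i => eUt tT; have /andP[t0 tT'] := tT.
have in_t n k : (k < n.+1)%N -> 0 <= tk t n.+1 k <= t.
  move=> kn; move: t0; rewrite le_eqVlt => /orP[/eqP <-|t0'].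
    by rewrite /tk mul0r mulr0 lexx.
  by apply: tk_itv => //; exact: ltnW.
(* The forward equation at the grid time [t], with the drift replaced by Riemann sums of V, which
   are approximable at every time in [0, t]. *)
apply: (approximable_ae_lim mB (h_ := fun n wt =>
    - (t / n.+1%:R) * (\sum_(k < n.+1) V (tk t n.+1 k) (w0, wt)) + (B t wt - B 0 wt))) => //.
- move=> n; apply: (approximableD mB) => //; last first.
    by apply: approximable_increment => //; rewrite t0 lexx.
  apply: (approximableZ mB) => //; apply: (approximable_bigsum mB) => // -[k kn] /=.
  have /andP[k0 kt] := in_t n k kn.
  by apply: (approximable_mono kt); apply: aV; rewrite k0 (le_trans kt).
- exact: mU.
- apply: filterS3 kV eUt B0 => wt cV' -> ->.
  rewrite sub0r; apply: cvgD; last by rewrite subr0; exact: cvg_cst.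
  under eq_fun do rewrite mulNr.
  apply: cvgN; apply: riemann_sum => //.
  apply: continuous_subspaceW cV' => s /=; rewrite !in_itv/= => /andP[-> st].
  exact: le_trans tT'.
Qed.

Lemma conditionally_gaussian (Gt : R -> set (set Omt)) :
  (forall s t, 0 <= s <= t -> t <= T -> mg (Gt t) (B s)) ->
  (forall t, 0 <= t <= T -> sigma_algebra setT (Gt t)) ->
  {ae P0, forall w0,
    [/\ centered_gaussian_pair Pt T (fun t wt => U t (w0, wt)) (fun t wt => V t (w0, wt)),
        adapted_ae Pt T Gt (fun t wt => U t (w0, wt)) &
        adapted_ae Pt T Gt (fun t wt => V t (w0, wt))]}.
Proof.
move=> gB sG; have := approximable_paths; apply: filterS => w0 h; split.
- move=> n t a b tT.
  suff : approx T (fun wt => \sum_(i < n) (a i * U (t i) (w0, wt) + b i * V (t i) (w0, wt))).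
    move=> /(approximable_gauss mB gauss_noise_sum)[s hs].
    exact: gauss_centered hs.
  apply: (approximable_bigsum mB) => // i; have [hU hV] := h _ (tT i).
  have /andP[_ tT'] := tT i.
  apply: (approximableD mB) => //; apply: (approximableZ mB) => //.
  + exact: approximable_mono hU.
  + exact: approximable_mono hV.
- move=> t tT; have [hU _] := h t tT; have /andP[_ tT'] := tT.
  have [U' gU' eU] := approximable_adapted mB tT' (fun s st => gB s t st tT') hU.
  by exists U' => //; apply/mgP => //; exact: sG.
- move=> t tT; have [_ hV] := h t tT; have /andP[_ tT'] := tT.
  have [V' gV' eV] := approximable_adapted mB tT' (fun s st => gB s t st tT') hV.
  by exists V' => //; apply/mgP => //; exact: sG.
Qed.

End conditional_paths.

Theorem theorem8 (R : realType) (T sigma K : R) (T_gt0 : 0 < T)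
  (* the atomless Polish probability space carrying the lifts *)
  (Omh : pseudoPMetricType R) (Ph : probability (borel Omh) R)
  (Omh_polish : polish Omh) (Ph_atomless : atomless Ph)
  (* the product space, its filtration, the noises and the initial state *)
  (d0 : measure_display) (Om0 : measurableType d0) (P0 : probability Om0 R)
  (Pt : probability (canonical_space T) R)
  (F : R -> set (set (Om0 * canonical_space T)))
  (W : R -> Om0 -> R) (xi0 : Om0 -> R)
  (F_filtration : complete_filtration (P0 \x Pt)%E T F)
  (W_brownian : independent_brownian_motions (P0 \x Pt)%E T F
     (idiosyncratic_noise T W) (common_noise T))
  (xi0_L2 : L2 P0 xi0)
  (xi0_F0 : measurable_wrt (F 0)
     (fun w : Om0 * canonical_space T => xi0 w.1))
  (* the cost function and a version of its mixed second derivative *)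
  (g : R -> P2 R -> R) (D : R -> P2 R -> R -> R)
  (g_lip : lipschitz_dx g K) (g_mono : monotone_dx g)
  (g_lip_law : lipschitz_dx_law g K) (g_weak_mono : weakly_monotone_dx g)
  (g_smooth : smooth_dx g Ph (P0 \x Pt)%E D K)
  (g_mixed : smooth_mixed (P0 \x Pt)%E D K)
  (* the solution of the 0-MFG system *)
  (X0 : R -> Om0 -> R) (Y0 Z0 Zt0 : R -> Om0 * canonical_space T -> R)
  (X0_solution : zero_mfg_solution P0 Pt F W g sigma xi0
     (fun t w => X0 t w.1) Y0 Z0 Zt0)
  (m0T : P2 R) (X0_law : has_law P0 (X0 T) m0T)
  (* the solution of the linear variational system *)
  (U V Q Qt : R -> Om0 * canonical_space T -> R)
  (UV_solution : variational_solution P0 Pt F W g D X0 m0T U V Q Qt) :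
  {ae P0, forall w0 : Om0,
    [/\ centered_gaussian_pair Pt T (fun t wt => U t (w0, wt))
          (fun t wt => V t (w0, wt)),
        adapted_ae Pt T path_filtration (fun t wt => U t (w0, wt)) &
        adapted_ae Pt T path_filtration (fun t wt => V t (w0, wt))]}.
Proof.
pose B : R -> canonical_space T -> R := fun t w => path_coord t w.
have hW : independent_brownian_motions (P0 \x Pt)%E T F
  (fun t w => W t w.1) (fun t w => B t w.2) := W_brownian.
have T0T : 0 <= T <= T by rewrite lexx ltW.
have [dxx_der g_D [dxx_le dxx_lip] _ _] := g_smooth.
have dx_lip x x' m : `|dx g x m - dx g x' m| <= K * `|x - x'| by case: g_lip => _ h; exact: h.
have K0 := lipschitz_dx_ge0 g_lip m0T.
have [mu law_mu X0_sol] := X0_solution.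
have mX : measurable_fun setT (X0 T).
  exact: (meas_fstV (meas_F F_filtration T0T (fbsde_mgX F_filtration X0_sol T0T))).
pose phi x := dx g x m0T.
have mphi : measurable_fun setT phi by exact: (measurable_dx g_lip m0T).
have phi_lin x : `|phi x| <= (`|phi 0| + K) * (1 + `|x|).
  have h1 : `|phi x| <= `|phi 0| + K * `|x|.
    rewrite -lerBlDl; apply: le_trans (lerB_dist _ _) _.
    by have := dx_lip x 0 m0T; rewrite subr0.
  apply: le_trans h1 _; rewrite mulrDr mulr1 mulrDl -addrA lerD2l.
  have h2 : 0 <= `|phi 0| * `|x| by rewrite mulr_ge0.
  by rewrite addrA lerDr addr_ge0.
(* [mu w] and [m0T] agree on Borel sets, hence are at W2-distance 0, and the Lipschitz bound in the
   measure identifies the two derivatives. *)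
have GE : {ae (P0 \x Pt)%E, forall w, dx g (X0 T w.1) (mu w) = phi (X0 T w.1)}.
  have := @conditional_law_indep _ _ _ _ (canonical_space T) P0 Pt (path_filtration T)
    (X0 T) mu m0T (fun _ hA => hA) mX law_mu X0_law.
  apply: filterS => w e.
  have := g_lip_law (X0 T w.1) (mu w) m0T.
  by rewrite (W2_eq0 e) mulr0 normr_le0 subr_eq0 => /eqP.
have [c [gc Lc Xc]] := state_measurable T_gt0 F_filtration hW xi0_F0
  (fun x y => g_mono x y m0T) mphi phi_lin xi0_L2 X0_sol GE.
pose a w := dxx g (X0 T w) m0T.
pose L := law_operator P0 D (X0 T) m0T.
have mdxx := measurable_dxx dxx_lip m0T.
have ma : measurable_fun setT a by exact: (measurableT_comp mdxx mX).
have spec f : L2 P0 f -> _ := law_operator_spec g_lip g_mono g_lip_law g_weak_mono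
  dxx_der g_D dxx_le dxx_lip mX X0_law (f := f).
(* Functions of the terminal state are idiosyncratic up to a null set, through the representative
   [c]. *)
have a_info : exists2 a', mg (cylinder W xi0 T) a' & {ae P0, forall w, a w = a' w}.
  exists (fun w => dxx g (c w) m0T); first exact: (measurableT_comp mdxx gc).
  by apply: filterS Xc => w e; rewrite /a e.
have L2L f : L2 P0 f -> L2 P0 (L f).
  move=> /spec[[H [mH [C HC] HE]] _].
  have -> : L f = fun w => H (X0 T w) by apply/funext.
  exact: (L2_bounded P0 (measurableT_comp mH mX) (fun w => HC (X0 T w))).
have L_info f : L2 P0 f -> exists2 e, mg (cylinder W xi0 T) e & {ae P0, forall w, L f w = e w}.
  move=> /spec[[H [mH _ HE]] _].
  exists (fun w => H (c w)); first exact: (measurableT_comp mH gc).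
  by apply: filterS Xc => w e; rewrite /L HE e.
have L_pos f : L2 P0 f -> 0 <= \int[P0]_w ((a w * f w + L f w) * f w).
  by move=> /spec[].
have LD f h w : L2 P0 f -> L2 P0 h -> L (fun v => f v + h v) w = L f w + L h w.
  exact: (law_operatorD g_D mX X0_law).
have LZ f b w : L2 P0 f -> L (fun v => b * f v) w = b * L f w.
  exact: (law_operatorZ g_D mX X0_law).
apply: (conditionally_gaussian T_gt0 F_filtration hW UV_solution).
- move=> N k N0 kN.
  exact: (grid_defect T_gt0 F_filtration hW xi0_F0 ma (fun w => dxx_le _ _) a_info
    LD LZ L2L L_info L_pos UV_solution N0 kN).
(* Two inclusions, since [path_filtration] is already generated and [mg] generates once more. *)
- move=> s t st _ _ A mA; rewrite setTI; apply: sub_sigma_algebra; apply: sub_sigma_algebra.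
  by exists s => //; exists A.
- by move=> t _; exact: smallest_sigma_algebra.
Qed.
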